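(* Let $X$ be a normed linear space, $Y$ a Banach space, and $k\in\mathbb N\cup\{\infty\}$ such that the pair $(X,Y)$ has properties (LE) and (LA$_1$), both with the same constant $C\ge1$, and moreover it has property (LA$_k$). Let $U\subset X$ be an open set with property (WQ), let $f\in C^1(U;Y)$ be $L$-Lipschitz, and suppose that the mapping $Df\colon U\to\mathcal L(X;Y)$ has a continuous extension $G\colon\overline U\to\mathcal L(X;Y)$. Then $f$ can be extended to a $17C^3L$-Lipschitz mapping $g\in C^1(X;Y)$ such that $g$ is $C^k$-smooth on $X\setminus\overline U$.
   Context: All normed linear spaces are real. $U(x,r)$ is the open ball with centre $x$ and radius $r$, $U_X$ is the open unit ball of $X$. An $L$-Lipschitz mapping is a mapping with a (not necessarily minimal) Lipschitz constant $L$. $\mathcal L(X;Y)$ is the normed space of continuous linear operators from $X$ to $Y$. $Df$ is the Fréchet derivative. For open $\Omega\subset X$, $C^k(\Omega;Y)$ is the space of $C^k$-smooth (in the Fréchet sense) mappings from $\Omega$ to $Y$. Property (WQ): a subset $U$ of a metric space $(X,\rho)$ has property (WQ) if for each $a\in\partial U$ there exist $r>0$ and $c\ge1$ such that for each $x,y\in U\cap U(a,r)$ there exists a continuous rectifiable curve $\gamma\colon[0,1]\to U$ such that $\gamma(0)=x$, $\gamma(1)=y$, and $\operatorname{len}\gamma\le c\rho(x,y)$, where $\operatorname{len}\gamma$ is the length of $\gamma$. Property (LE) with $C$: the pair $(X,Y)$ of normed linear spaces has property (LE) with $C>0$ if for every $A\subset X$ every $L$-Lipschitz mapping $f\colon A\to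 Y$ has a $CL$-Lipschitz extension to the whole of $X$. Property (LA$_k$), $k\in\mathbb N\cup\{\infty\}$: the pair $(X,Y)$ of normed linear spaces has property (LA$_k$) with $C\ge0$ if for any $L$-Lipschitz mapping $f\colon U_X\to Y$ and any $\varepsilon>0$ there is a $CL$-Lipschitz mapping $g\in C^k(U_X;Y)$ such that $\sup_{U_X}\|f-g\|\le\varepsilon$. It has property (LA$_k$) if it has it with some $C\ge0$. *)

(* Defs.v *)
From HB Require Import structures.
From mathcomp Require Import all_boot all_order all_algebra.
From mathcomp Require Import all_classical all_reals all_analysis.

Set Implicit Arguments.
Unset Strict Implicit.
Unset Printing Implicit Defensive.

Import Order.TTheory GRing.Theory Num.Theory.
Import numFieldNormedType.Exports.

Local Open Scope classical_set_scope.
Local Open Scope ring_scope.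

Section continuous_linear_operators.
Context {R : realType} (X Y : normedModType R).

Definition clin_pred : {pred X -> Y} :=
  [pred T | `[< linear T /\ continuous T >]].

Record clin := CLin { clin_fun :> X -> Y ; _ : clin_fun \in clin_pred }.

HB.instance Definition _ := [isSub for clin_fun].
HB.instance Definition _ := [Choice of clin by <:].

Lemma clin_submod_closed : submod_closed clin_pred.
Proof.
split=> [|a S T /asboolP[Sl Sc] /asboolP[Tl Tc]]; apply/asboolP; split.
- by move=> a x y; rewrite /= scaler0 addr0.
- exact: cst_continuous.
- move=> b x y; rewrite !fctE Sl Tl !scalerDr !scalerA [a * b]mulrC.
  by rewrite addrACA.
- move=> x; apply: cvgD; last exact: Tc.
  by apply: cvgZl_tmp; exact: Sc.
Qed.

HB.instance Definition _ :=
  GRing.isSubmodClosed.Build R (X -> Y) clin_pred clin_submod_closed.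
HB.instance Definition _ := [SubChoice_isSubLmodule of clin by <:].

Lemma clin_linear (T : clin) : linear T.
Proof. by case: T => T /= /asboolP[]. Qed.

Lemma clin_continuous (T : clin) : continuous T.
Proof. by case: T => T /= /asboolP[]. Qed.

HB.instance Definition _ (T : clin) :=
  GRing.isLinear.Build R X Y *:%R (T : X -> Y) (@clin_linear T).

Definition opnorm (T : clin) : R := sup [set `|T x| | x in [set x | `|x| <= 1]].

Lemma opnorm_has_sup (T : clin) :
  has_sup [set `|T x| | x in [set x | `|x| <= 1]].
Proof.
split; first by exists `|T 0|, 0; rewrite //= normr0.
have [k k0 Tk] := linear_lipschitz (clin_continuous (T := T)).
exists k => _ [x /= x1 <-].
by rewrite (le_trans (Tk x))// ler_piMr// ltW.
Qed.

Lemma opnorm_ub (T : clin) (x : X) : `|x| <= 1 -> `|T x| <= opnorm T.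
Proof.
by move=> x1; apply: ub_le_sup; [case: (opnorm_has_sup T)|exists x].
Qed.

Lemma opnorm_le (T : clin) (c : R) :
  (forall x, `|x| <= 1 -> `|T x| <= c) -> opnorm T <= c.
Proof.
move=> Tc; apply: ge_sup; first by case: (opnorm_has_sup T).
by move=> _ [x x1 <-]; exact: Tc.
Qed.

Lemma ler_opnormD (S T : clin) : opnorm (S + T) <= opnorm S + opnorm T.
Proof.
apply: opnorm_le => x x1.
by rewrite (le_trans (ler_normD _ _))// lerD// opnorm_ub.
Qed.

Lemma opnormZ (l : R) (T : clin) : opnorm (l *: T) = `|l| * opnorm T.
Proof.
have le (a : R) (S : clin) : opnorm (a *: S) <= `|a| * opnorm S.
  by apply: opnorm_le => x x1; rewrite normrZ ler_wpM2l// opnorm_ub.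
apply/le_anti; rewrite le /=.
have [->|l0] := eqVneq l 0.
  rewrite normr0 mul0r (le_trans (normr_ge0 ((0 *: T : clin) 0)))//.
  by rewrite opnorm_ub// normr0.
have := le l^-1 (l *: T); rewrite scalerA mulVf// scale1r.
by rewrite normfV ler_pdivlMl// normr_gt0.
Qed.

Lemma opnorm0_eq0 (T : clin) : opnorm T = 0 -> T = 0.
Proof.
move=> T0; apply/val_inj/funext => x /=.
have [->|x0] := eqVneq x 0; first exact: (linear0 T).
have := opnorm_ub T (x := `|x|^-1 *: x).
rewrite normrZ normfV normr_id mulVf ?normr_eq0// => /(_ (lexx _)).
rewrite T0 linearZ normr_le0 scaler_eq0 invr_eq0 normr_eq0 (negPf x0) /=.
by move=> /eqP.
Qed.

HB.instance Definition _ :=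
  Lmodule_isNormed.Build R clin ler_opnormD opnormZ opnorm0_eq0.

End continuous_linear_operators.

Section smooth_maps.
Context {R : realType}.

(* When [f] is not differentiable at [x], ['d f x] is an arbitrary linear map
   and may fail to be continuous; [insubd] then returns 0. *)
Definition frechet {X Y : normedModType R} (f : X -> Y) (x : X) : clin X Y :=
  insubd (0 : clin X Y) ('d f x : X -> Y).

(* Only the values of [f] on [Omega] matter since [Omega] is always an open
   set in what follows. The codomain changes from [Y] to [clin X Y] in the
   recursive call. *)
Fixpoint Cn {X : normedModType R} (Omega : set X) (n : nat)
    {Y : normedModType R} (f : X -> Y) : Prop :=
  if n is n'.+1 then
    (forall x, Omega x -> differentiable f x) /\ Cn Omega n' (frechet f)
  else {within Omega, continuous f}.

Variant smoothness := SmoothN of nat | SmoothInfty.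

Definition Ck {X Y : normedModType R} (k : smoothness) (Omega : set X)
    (f : X -> Y) : Prop :=
  match k with
  | SmoothN n => Cn Omega n f
  | SmoothInfty => forall n, Cn Omega n f
  end.

End smooth_maps.

Section properties.
Context {R : realType}.

Definition curve_length {X : normedModType R} (a b : R) (gamma : R -> X) :
    \bar R :=
  ereal_sup [set (\sum_(0 <= i < size s)
      `|gamma (nth b (a :: s) i.+1) - gamma (nth b (a :: s) i)|)%:E
    | s in itv_partition a b].

(* The length is [+oo] for a non-rectifiable curve, so the final inequality
   forces rectifiability. *)
Definition property_WQ {X : normedModType R} (U : set X) : Prop :=
  forall a, (closure U `\` interior U) a ->
    exists r c : R, [/\ 0 < r, 1 <= c &
      forall x y, (U `&` ball a r) x -> (U `&` ball a r) y ->
        exists gamma : R -> X,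
          [/\ {within `[0, 1], continuous gamma},
              forall t : R, t \in `[0, 1] -> U (gamma t),
              gamma 0 = x,
              gamma 1 = y &
              (curve_length 0 1 gamma <= (c * `|x - y|)%:E)%E]].

(* A mapping defined on a subset is represented by a total function of which
   only the values on that subset are constrained. *)
Definition property_LE (X Y : normedModType R) (C : R) : Prop :=
  0 < C /\
  forall (A : set X) (L : R) (f : X -> Y), 0 <= L -> L.-lipschitz_A f ->
    exists g : X -> Y,
      (C * L).-lipschitz g /\ (forall x, A x -> g x = f x).

Definition property_LA (k : smoothness) (X Y : normedModType R) (C : R) : Prop :=
  0 <= C /\
  forall (L : R) (f : X -> Y) (eps : R),
    0 <= L -> L.-lipschitz_(ball 0 1) f -> 0 < eps ->
    exists g : X -> Y,
      [/\ (C * L).-lipschitz_(ball 0 1) g,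
          Ck k (ball 0 1) g &
          forall x, ball 0 1 x -> `|f x - g x| <= eps].

End properties.

(* Main.v *)
(* The jet (f, Df) extends to the closure A of U, and (WQ) with the mean value
   inequality along curves makes the extension strict: near each b in A, f - G b
   has arbitrarily small Lipschitz constant on A.  Gluing the affine maps G a plus
   (LE)-extensions of f - G a by a smooth partition of unity yields, for every
   eps, an extension of f whose difference to G b is eps-Lipschitz near each b in
   A.  Interpolating between these extensions (eps -> 0) at a rate proportional
   to the inverse of the distance to A gives a single extension F, Lipschitz with
   constant 5CL + L/5 and strictly differentiable at the points of A.  Off A, F
   is replaced by a C^1 map: locally one subtracts from F an almost optimal
   linear map, approximates the remainder by (LA_1), and glues with an error so
   small that the slopes of the partition of unity do not matter.  Repeating
   this with (LA_k), whose constant only multiplies the arbitrarily small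
   oscillation of the derivative, gives C^k off A.  The partitions of unity come
   from Stone's sigma-discrete refinement; their members are cutoffs of (LA_k)
   approximations of distance functions, made scalar by a norming functional. *)

Require Import Defs.
From HB Require Import structures.
From mathcomp Require Import all_boot all_order all_algebra.
From mathcomp Require Import ring lra.
From mathcomp Require Import all_classical all_reals all_analysis.
From mathcomp Require wochoice.

Set Implicit Arguments.
Unset Strict Implicit.
Unset Printing Implicit Defensive.

Import Order.TTheory GRing.Theory Num.Theory.
Import numFieldNormedType.Exports.

Local Open Scope classical_set_scope.
Local Open Scope ring_scope.

(** The obstacle is that the Lipschitz constants of the members of a partition of unity are not
    uniformly bounded, so gluing must never multiply them by a quantity of fixed size. Near a point
    b of A all glued extensions share the value f b, so they differ only by O(|z - b|); off A the
    approximants may be taken as close as the slopes demand. The interpolation between extensions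
    has to keep an explicit Lipschitz constant, so its weights are explicit quotients of distances,
    not smooth, and only two extensions are mixed at each point. Strictness on A, rather than mere
    differentiability there, is what survives smoothing: F - G b has a small Lipschitz constant also
    between points off A, so every almost optimal slope near b is close to G b and the new
    derivative tends to G b. The constant 17 arises because smoothing turns a Lipschitz constant M
    into about (2 + C)M: 2M bounds an almost optimal slope, CM the derivative of the approximated
    remainder. *)

Section lincomb.
Context {R : comNzRingType} {V : lmodType R}.

(** * Linear identities in modules, by reflection *)

Inductive lincomb :=
| LAtom of nat
| LZero
| LAdd of lincomb & lincomb
| LOpp of lincomb
| LScale of R & lincomb.

Fixpoint lincomb_eval (env : seq V) (e : lincomb) : V :=
  match e with
  | LAtom i => env`_i
  | LZero => 0
  | LAdd a b => lincomb_eval env a + lincomb_eval env b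
  | LOpp a => - lincomb_eval env a
  | LScale k a => k *: lincomb_eval env a
  end.

Fixpoint lincomb_coef (e : lincomb) (i : nat) : R :=
  match e with
  | LAtom j => if eqn i j then 1 else 0
  | LZero => 0
  | LAdd a b => lincomb_coef a i + lincomb_coef b i
  | LOpp a => - lincomb_coef a i
  | LScale k a => k * lincomb_coef a i
  end.

(** An iterated conjunction rather than a quantified statement, so that computation leaves one
    closed coefficient equation per atom. *)
Fixpoint lincomb_eqs (n : nat) (a b : lincomb) : Prop :=
  if n is n'.+1 then lincomb_coef a n' = lincomb_coef b n' /\ lincomb_eqs n' a b
  else True.

Lemma lincomb_evalE (env : seq V) (e : lincomb) :
  lincomb_eval env e = \sum_(i < size env) lincomb_coef e i *: env`_i.
Proof.
elim: e => [j||a IHa b IHb|a IHa|k a IHa] /=.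
- have [js|sj] := ltnP j (size env).
    rewrite (bigD1 (Ordinal js))//= (_ : eqn j j = true) ?scale1r; last exact: eqxx.
    rewrite big1 ?addr0// => i ij; rewrite (_ : eqn i j = false) ?scale0r//.
    by apply: contraNF ij => /eqnP h; apply/eqP/val_inj.
  rewrite nth_default// big1// => i _; rewrite (_ : eqn i j = false) ?scale0r//.
  by apply/negbTE; rewrite -[eqn _ _]/(nat_of_ord i == j) neq_ltn (leq_trans (ltn_ord i) sj).
- by rewrite big1// => i _; rewrite scale0r.
- by rewrite IHa IHb -big_split; apply: eq_bigr => i _; rewrite scalerDl.
- by rewrite IHa -sumrN; apply: eq_bigr => i _; rewrite scaleNr.
- by rewrite IHa scaler_sumr; apply: eq_bigr => i _; rewrite scalerA.
Qed.

Lemma lincomb_eq (env : seq V) (a b : lincomb) :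
  lincomb_eqs (size env) a b -> lincomb_eval env a = lincomb_eval env b.
Proof.
rewrite !lincomb_evalE; move: (size env) => n h; apply: eq_bigr => i _.
suff -> : lincomb_coef a i = lincomb_coef b i by [].
elim: n i h => [[]//|n IH i /= [h1 h2]].
have := ltn_ord i; rewrite ltnS leq_eqVlt => /orP[/eqP->//|ni].
exact: (IH (Ordinal ni)).
Qed.

End lincomb.

Ltac lincomb_add x env :=
  lazymatch env with
  | nil => constr:(cons x env)
  | cons x _ => env
  | cons ?y ?l => let l' := lincomb_add x l in constr:(cons y l')
  end.
Ltac lincomb_atoms env e :=
  lazymatch e with
  | (?a + ?b)%R => let env1 := lincomb_atoms env a in lincomb_atoms env1 b
  | (- ?a)%R => lincomb_atoms env a
  | (_ *: ?a)%R => lincomb_atoms env a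
  | 0%R => env
  | _ => lincomb_add e env
  end.
Ltac lincomb_index x env :=
  lazymatch env with
  | cons x _ => constr:(O)
  | cons _ ?l => let i := lincomb_index x l in constr:(S i)
  end.
Ltac lincomb_reify R env e :=
  lazymatch e with
  | (?a + ?b)%R => let a' := lincomb_reify R env a in
                   let b' := lincomb_reify R env b in constr:(@LAdd R a' b')
  | (- ?a)%R => let a' := lincomb_reify R env a in constr:(@LOpp R a')
  | (?k *: ?a)%R => let a' := lincomb_reify R env a in constr:(@LScale R k a')
  | 0%R => constr:(@LZero R)
  | _ => let i := lincomb_index e env in constr:(@LAtom R i)
  end.
(* Proves equalities in a left module by comparing the coefficients of the
   atoms with [tac]. *)
Ltac module_ring_with R tac :=
  lazymatch goal with
  | |- @eq ?V ?a ?b =>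
    let env0 := constr:(@nil V) in
    let env1 := lincomb_atoms env0 a in
    let env := lincomb_atoms env1 b in
    let a' := lincomb_reify R env a in
    let b' := lincomb_reify R env b in
    refine (@lincomb_eq R _ env a' b' _);
    cbv [lincomb_eqs lincomb_coef size eqn];
    repeat (split; [tac|]); exact I
  end.
Ltac module_ring :=
  match goal with R : realType |- _ => module_ring_with R ltac:(ring) end.

(** * Bounded operators, Frechet derivatives in epsilon form, bounded bilinear maps *)

Section clin_theory.
Context {R : realType}.
Implicit Types W X Y Z : normedModType R.

Lemma ball_center_dist X (x y : X) (r : R) : ball x r y <-> `|y - x| < r.
Proof. by rewrite -ball_normE /ball_ /= distrC. Qed.

Lemma near_ball_dist X (x : X) (P : X -> Prop) :
  (\forall y \near x, P y) <->
  exists2 r : R, 0 < r & forall y, `|y - x| < r -> P y.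
Proof.
split=> [/nbhs_ballP[r /= r0 xP]|[r r0 xP]].
  by exists r => // y yx; apply: xP; apply/ball_center_dist.
by apply/nbhs_ballP; exists r => //= y /ball_center_dist; exact: xP.
Qed.

Lemma near_dist X (x : X) (r : R) : 0 < r -> \forall y \near x, `|y - x| < r.
Proof. by move=> r0; apply/near_ball_dist; exists r. Qed.

Lemma clin_le X Y (T : clin X Y) (x : X) : `|T x| <= `|T| * `|x|.
Proof.
have [->|x0] := eqVneq x 0; first by rewrite linear0 !normr0 mulr0.
have := opnorm_ub T (x := `|x|^-1 *: x).
rewrite normrZ normfV normr_id mulVf ?normr_eq0// => /(_ (lexx _)).
by rewrite linearZ normrZ normfV normr_id mulrC ler_pdivrMr ?normr_gt0.
Qed.

(** By homogeneity a bound near 0 is a bound on the unit ball. This is how increment estimates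
    become operator norm estimates. *)
Lemma clin_norm_le X Y (T : clin X Y) (c : R) : 0 <= c ->
  (\forall x \near (0 : X), `|T x| <= c * `|x|) -> `|T| <= c.
Proof.
move=> c0 /near_ball_dist[r r0 Tc]; apply: opnorm_le => x x1.
have r20 : 0 < r / 2 by rewrite divr_gt0.
have := Tc ((r / 2) *: x); rewrite subr0 linearZ [X in X <= _]normrZ [X in _ <= _ * X]normrZ (gtr0_norm r20) mulrCA.
rewrite ler_pM2l// => Tx; rewrite (le_trans (Tx _)) ?ler_piMr//.
rewrite normrZ (gtr0_norm r20) (@le_lt_trans _ _ (r / 2))//; last by lra.
by rewrite ler_piMr// ltW.
Qed.

Lemma clinP X Y (f g : clin X Y) : (forall x, f x = g x) -> f = g.
Proof. by move=> fg; apply/val_inj/funext. Qed.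

Lemma clinDE X Y (S T : clin X Y) x : (S + T) x = S x + T x. Proof. by []. Qed.
Lemma clinBE X Y (S T : clin X Y) x : (S - T) x = S x - T x. Proof. by []. Qed.
Lemma clinZE X Y (a : R) (T : clin X Y) x : (a *: T) x = a *: T x.
Proof. by []. Qed.
Lemma clin0E X Y x : (0 : clin X Y) x = 0. Proof. by []. Qed.

Lemma clinB X Y (T : clin X Y) x y : T (x - y) = T x - T y.
Proof. exact: linearB. Qed.

Lemma clinD X Y (T : clin X Y) x y : T (x + y) = T x + T y.
Proof. exact: linearD. Qed.

Lemma clinZ X Y (T : clin X Y) a x : T (a *: x) = a *: T x.
Proof. exact: linearZ. Qed.

(** Outside [clin_pred] the result is 0; [to_clinE] removes the default once a linear bound is
    known. *)
Definition to_clin X Y (f : X -> Y) : clin X Y := insubd (0 : clin X Y) f.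

Lemma linear_bound_continuous X Y (f : X -> Y) (K : R) :
  linear f -> (forall x, `|f x| <= K * `|x|) -> continuous f.
Proof.
move=> fl fK x.
have fB (u v : X) : f (u - v) = f u - f v.
  have := fl (-1) v u; rewrite !scaleN1r => h.
  by rewrite addrC h addrC.
apply/cvgrPdist_le => e e0.
have K1 : 0 < `|K| + 1 by rewrite ltr_wpDl.
have : \forall y \near x, `|y - x| < e / (`|K| + 1).
  by apply: near_dist; rewrite divr_gt0.
apply: filterS => y; rewrite ltr_pdivlMr// distrC => /ltW xy.
rewrite -fB (le_trans (fK _))// (le_trans _ xy)// mulrC ler_wpM2l//.
by rewrite (le_trans (ler_norm _)) // lerDl.
Qed.

Lemma to_clinE X Y (f : X -> Y) (K : R) :
  linear f -> (forall x, `|f x| <= K * `|x|) -> forall x, to_clin f x = f x.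
Proof.
move=> fl fK x; rewrite /to_clin.
rewrite -[LHS]/(clin_fun (insubd 0 f) x) -[clin_fun _]/(val _) insubdK//.
by apply/asboolP; split=> //; exact: linear_bound_continuous fK.
Qed.

Lemma continuous_linear_clin X Y (T : X -> Y) :
  linear T -> continuous T -> exists S : clin X Y, forall x, S x = T x.
Proof.
move=> Tl Tc; have h : T \in @clin_pred _ X Y by apply/asboolP.
by exists (CLin h).
Qed.

(** Differentiability with the derivative as an explicit bounded operator, which can be transported
    and estimated directly. *)
Definition is_fd X Y (f : X -> Y) (x : X) (T : clin X Y) :=
  forall e : R, 0 < e ->
    \forall y \near x, `|f y - f x - T (y - x)| <= e * `|y - x|.

Lemma is_fd_littleo X Y (f : X -> Y) x (T : clin X Y) :
  is_fd f x T <-> f \o shift x = cst (f x) + T +o_ 0 id.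
Proof.
split=> [fT|/eqaddoP fT e e0].
  apply/eqaddoP => e e0.
  have /near_ball_dist[r r0 h] := fT e e0.
  apply/near_ball_dist; exists r => // y; rewrite subr0 => yr.
  by have := h (y + x); rewrite addrK /= !fctE /= opprD addrA; exact.
have /near_ball_dist[r r0 h] := fT e e0.
apply/near_ball_dist; exists r => // y yr.
by have := h (y - x); rewrite subr0 /= !fctE /= subrK opprD addrA; exact.
Qed.

Lemma is_fdP X Y (f : X -> Y) x (T : clin X Y) :
  is_fd f x T <-> differentiable f x /\ frechet f x = T.
Proof.
have imp S : is_fd f x S -> differentiable f x /\ frechet f x = S.
  move=> /is_fd_littleo fT.
  have h : 'd f x = S :> (X -> Y) by apply: diff_unique fT; exact: clin_continuous.
  split; first by apply/diff_locallyP; rewrite h; split => //; exact: clin_continuous.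
  apply/val_inj; rewrite /frechet insubdK h//.
  by case: (S).
split=> [/imp//|[fd <-]].
have [S dS] : exists S : clin X Y, forall x0, S x0 = 'd f x x0.
  apply: continuous_linear_clin; last exact: diff_continuous.
  by move=> a u v; rewrite linearP.
have fS : is_fd f x S.
  apply/is_fd_littleo; have /diff_locallyP[_ ->] := fd.
  by have -> : 'd f x = S :> (X -> Y) by apply/funext => u; rewrite dS.
by have [_ ->] := imp _ fS.
Qed.

Lemma is_fd_frechet X Y (f : X -> Y) x : differentiable f x -> is_fd f x (frechet f x).
Proof. by move=> fd; apply/is_fdP. Qed.

Lemma is_fd_near X Y (f g : X -> Y) x T :
  (\forall y \near x, f y = g y) -> is_fd f x T -> is_fd g x T.
Proof.
move=> fg fT e e0; have fgx : f x = g x by apply: nbhs_singleton fg.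
near=> y; rewrite -fgx -(near fg y)//; near: y; exact: fT.
Unshelve. all: by end_near. Qed.

Lemma is_fd_near_lip X Y (f : X -> Y) x T : is_fd f x T ->
  \forall y \near x, `|f y - f x| <= (`|T| + 1) * `|y - x|.
Proof.
move=> fT; have := fT 1 ltr01; apply: filterS => y h.
rewrite -(subrK (T (y - x)) (f y - f x)) (le_trans (ler_normD _ _))//.
by rewrite addrC mulrDl lerD// clin_le.
Qed.

Lemma is_fd_continuous X Y (f : X -> Y) x T : is_fd f x T -> {for x, continuous f}.
Proof. by move=> /is_fdP[/differentiable_continuous]. Qed.

Lemma is_fd_cst X Y (c : Y) (x : X) : is_fd (cst c) x 0.
Proof.
move=> e e0; apply: nearW => y.
by rewrite /cst subrr clin0E subrr normr0 mulr_ge0// ltW.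
Qed.

Lemma is_fd_clin X Y (T : clin X Y) (x : X) : is_fd T x T.
Proof.
move=> e e0; apply: nearW => y.
by rewrite clinB subrr normr0 mulr_ge0// ltW.
Qed.

Lemma is_fdD X Y (f g : X -> Y) (x : X) S T :
  is_fd f x S -> is_fd g x T -> is_fd (fun y => f y + g y) x (S + T).
Proof.
move=> fS gT e e0; have e2 : 0 < e / 2 by rewrite divr_gt0.
near=> y; rewrite clinDE.
have -> : f y + g y - (f x + g x) - (S (y - x) + T (y - x)) =
    (f y - f x - S (y - x)) + (g y - g x - T (y - x)).
  by module_ring.
rewrite (le_trans (ler_normD _ _))// [e]splitr mulrDl lerD//; near: y.
  exact: fS.
exact: gT.
Unshelve. all: by end_near. Qed.

Definition bilin X Y Z (K : R) (B : X -> Y -> Z) :=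
  [/\ 0 <= K, forall y, linear (B^~ y), forall x, linear (B x) &
      forall x y, `|B x y| <= K * `|x| * `|y|].

(** The two halves of the product rule for [B (f w) (g w)]. As maps of their arguments they are
    again bounded bilinear, with the same constant, which lets smoothness of products go by
    induction. *)
Definition bilin1 W X Y Z (B : X -> Y -> Z) (x : X) (T : clin W Y) : clin W Z :=
  to_clin (fun w => B x (T w)).

Definition bilin2 W X Y Z (B : X -> Y -> Z) (T : clin W X) (y : Y) : clin W Z :=
  to_clin (fun w => B (T w) y).

Lemma bilin1E W X Y Z K (B : X -> Y -> Z) x (T : clin W Y) w :
  bilin K B -> bilin1 B x T w = B x (T w).
Proof.
move=> [K0 _ Br BK]; apply: (@to_clinE _ _ _ (K * `|x| * `|T|)) => [a u v|u].
  by rewrite linearP Br.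
by rewrite (le_trans (BK _ _))// -!mulrA ler_wpM2l// ler_wpM2l// clin_le.
Qed.

Lemma bilin2E W X Y Z K (B : X -> Y -> Z) (T : clin W X) y w :
  bilin K B -> bilin2 B T y w = B (T w) y.
Proof.
move=> [K0 Bl _ BK]; apply: (@to_clinE _ _ _ (K * `|T| * `|y|)) => [a u v|u].
  by rewrite linearP Bl.
rewrite (le_trans (BK _ _))// [leRHS]mulrAC ler_wpM2r// -mulrA ler_wpM2l//.
exact: clin_le.
Qed.

Lemma clin_norm_le_all X Y (T : clin X Y) (c : R) : 0 <= c ->
  (forall x, `|T x| <= c * `|x|) -> `|T| <= c.
Proof. by move=> c0 h; apply: clin_norm_le => //; exact: nearW. Qed.

Lemma bilin1_bilin W X Y Z K (B : X -> Y -> Z) :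
  bilin K B -> bilin K (@bilin1 W X Y Z B).
Proof.
move=> hB; have [K0 Bl Br BK] := hB; split=> // [T|x|x T].
- by move=> a x y; apply: clinP => w; rewrite clinDE clinZE !(bilin1E _ _ _ hB) Bl.
- by move=> a S T; apply: clinP => w; rewrite clinDE clinZE !(bilin1E _ _ _ hB) Br.
- apply: clin_norm_le_all => [|w]; first by rewrite !mulr_ge0.
  rewrite (bilin1E _ _ _ hB) (le_trans (BK _ _))// -!mulrA.
  by rewrite !ler_wpM2l// clin_le.
Qed.

Lemma bilin2_bilin W X Y Z K (B : X -> Y -> Z) :
  bilin K B -> bilin K (@bilin2 W X Y Z B).
Proof.
move=> hB; have [K0 Bl Br BK] := hB; split=> // [y|T|T y].
- by move=> a S T; apply: clinP => w; rewrite clinDE clinZE !(bilin2E _ _ _ hB) Bl.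
- by move=> a x y; apply: clinP => w; rewrite clinDE clinZE !(bilin2E _ _ _ hB) Br.
- apply: clin_norm_le_all => [|w]; first by rewrite !mulr_ge0.
  rewrite (bilin2E _ _ _ hB) (le_trans (BK _ _))// [leRHS]mulrAC ler_wpM2r//.
  by rewrite -mulrA ler_wpM2l// clin_le.
Qed.

Lemma linear_sub X Y (f : X -> Y) u v : linear f -> f (u - v) = f u - f v.
Proof.
by move=> fl; have := fl (-1) v u; rewrite !scaleN1r ![- _ + _]addrC.
Qed.

Lemma is_fd_bilin W X Y Z K (B : X -> Y -> Z) (f : W -> X) (g : W -> Y) w S T :
  bilin K B -> is_fd f w S -> is_fd g w T ->
  is_fd (fun v => B (f v) (g v)) w (bilin1 B (f w) T + bilin2 B S (g w)).
Proof.
move=> hB fS gT e e0; have [K0 Bl Br BK] := hB.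
(* [M] serves the terms linear in the remainders of [f] and [g], [N] the quadratic term
   [B (f v - f w) (g v - g w)]; each takes half of [e]. *)
pose M := K * `|f w| + K * `|g w| + 1.
pose N := K * (`|S| + 1) * (`|T| + 1) + 1.
have M0 : 0 < M by rewrite /M ltr_wpDl// addr_ge0 ?mulr_ge0.
have N0 : 0 < N by rewrite /N ltr_wpDl// !mulr_ge0 ?addr_ge0.
have eM : 0 < e / 2 / M by rewrite !divr_gt0.
near=> v; rewrite clinDE (bilin1E _ _ _ hB) (bilin2E _ _ _ hB).
have fv : `|f v - f w - S (v - w)| <= e / 2 / M * `|v - w|.
  by near: v; exact: fS.
have gv : `|g v - g w - T (v - w)| <= e / 2 / M * `|v - w|.
  by near: v; exact: gT.
have fl : `|f v - f w| <= (`|S| + 1) * `|v - w|.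
  by near: v; exact: is_fd_near_lip.
have gl : `|g v - g w| <= (`|T| + 1) * `|v - w|.
  by near: v; exact: is_fd_near_lip.
have vw : `|v - w| < e / 2 / N by near: v; apply: near_dist; rewrite !divr_gt0.
have -> : B (f v) (g v) - B (f w) (g w) - (B (f w) (T (v - w)) + B (S (v - w)) (g w)) =
  B (f v - f w) (g v - g w) +
  (B (f w) (g v - g w - T (v - w)) + B (f v - f w - S (v - w)) (g w)).
  rewrite !(linear_sub _ _ (Bl _)) !(linear_sub _ _ (Br _)).
  set a := B (f v) (g v); set b := B (f w) (g w); set c := B (f v) (g w).
  set d := B (f w) (g v); set p := B _ (T _); set q := B (S _) _.
  by module_ring.
rewrite (le_trans (ler_normD _ _))// [e]splitr mulrDl lerD//.
  rewrite (le_trans (BK _ _))//.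
  rewrite (@le_trans _ _ (K * ((`|S| + 1) * `|v - w|) * ((`|T| + 1) * `|v - w|)))//.
    by rewrite ler_pM// ?mulr_ge0// ler_wpM2l.
  rewrite [leLHS](_ : _ = (K * (`|S| + 1) * (`|T| + 1)) * `|v - w| * `|v - w|); last by ring.
  rewrite ler_wpM2r//.
  move: (ltW vw); rewrite ler_pdivlMr// mulrC; apply: le_trans.
  by rewrite ler_wpM2r// lerDl.
rewrite (le_trans (ler_normD _ _))//.
rewrite (@le_trans _ _ (K * `|f w| * (e / 2 / M * `|v - w|) + K * `|g w| * (e / 2 / M * `|v - w|)))//.
  rewrite lerD//.
    by rewrite (le_trans (BK _ _))// ler_wpM2l// mulr_ge0.
  by rewrite (le_trans (BK _ _))// [leRHS]mulrAC ler_wpM2r// ler_wpM2l.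
rewrite -mulrDl mulrA ler_wpM2r// mulrCA ger_pMr ?divr_gt0//.
by rewrite ler_pdivrMr// mul1r lerDl.
Unshelve. all: by end_near. Qed.

End clin_theory.

(** * Calculus of C^n maps *)

Section Cn_theory.
Context {R : realType}.
Implicit Types W X Y Z : normedModType R.

Lemma Cn0P X Y (O : set X) (f : X -> Y) : open O ->
  Cn O 0 f <-> forall x, O x -> {for x, continuous f}.
Proof.
move=> oO; rewrite /= continuous_open_subspace//; split=> h x.
  by move=> Ox; apply: h; rewrite inE.
by rewrite inE; exact: h.
Qed.

Lemma CnSP X Y (O : set X) n (f : X -> Y) :
  Cn O n.+1 f <-> (forall x, O x -> is_fd f x (frechet f x)) /\ Cn O n (frechet f).
Proof.
split=> -[fO Cf]; split=> // x Ox; first exact/is_fd_frechet/fO.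
by have /is_fdP[] := fO x Ox.
Qed.

Lemma open_near X (O : set X) (P : X -> Prop) x : open O -> O x ->
  (forall y, O y -> P y) -> \forall y \near x, P y.
Proof. by move=> oO Ox OP; apply: filterS OP _; exact: open_nbhs_nbhs. Qed.

Lemma near_open X (P : X -> Prop) x : (\forall y \near x, P y) ->
  exists V : set X, [/\ open V, V x & forall y, V y -> P y].
Proof.
move=> /near_ball_dist[r r0 h]; exists (ball x r); split.
- exact: ball_open.
- exact: ballxx.
- by move=> y /ball_center_dist; exact: h.
Qed.

Lemma Cn_ext X Y (O : set X) n (f g : X -> Y) : open O ->
  (forall x, O x -> f x = g x) -> Cn O n f -> Cn O n g.
Proof.
move=> oO; elim: n Y f g => [|n IH] Y f g fg.
  move=> /(Cn0P _ oO) fO; apply/(Cn0P _ oO) => x Ox.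
  have fgx : \forall y \near x, f y = g y by exact: (open_near oO).
  have : f y @[y --> x] --> f x by exact: fO.
  rewrite (fg x Ox); apply: cvg_trans; apply: near_eq_cvg.
  by apply: filterS fgx => y ->.
move=> /CnSP[fO Cf].
have gO x : O x -> is_fd g x (frechet f x).
  by move=> Ox; apply: is_fd_near (fO x Ox); exact: (open_near oO).
have fgD x : O x -> frechet f x = frechet g x.
  by move=> Ox; have /is_fdP[_ ->] := gO x Ox.
apply/CnSP; split=> [x Ox|]; first by rewrite -fgD//; exact: gO.
exact: IH Cf.
Qed.

Lemma CnS X Y (O : set X) n (f : X -> Y) (D : X -> clin X Y) : open O ->
  (forall x, O x -> is_fd f x (D x)) -> Cn O n D -> Cn O n.+1 f.
Proof.
move=> oO fD CD.
have fgD x : O x -> D x = frechet f x by move=> Ox; have /is_fdP[_ ->] := fD x Ox.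
apply/CnSP; split=> [x Ox|]; first by rewrite -fgD//; exact: fD.
exact: Cn_ext CD.
Qed.

Lemma CnW X Y (O : set X) n (f : X -> Y) : open O -> Cn O n.+1 f -> Cn O n f.
Proof.
move=> oO; elim: n Y f => [|n IH] Y f /CnSP[fO Cf].
  by apply/(Cn0P _ oO) => x Ox; apply: is_fd_continuous; exact: fO.
by apply/CnSP; split=> //; exact: IH.
Qed.

Lemma Cn_le X Y (O : set X) m n (f : X -> Y) : open O -> (m <= n)%N ->
  Cn O n f -> Cn O m f.
Proof.
move=> oO /subnK<-; elim: (n - m)%N => [//|k IH] /(CnW oO); exact: IH.
Qed.

Lemma Cn_local X Y (O : set X) n (f : X -> Y) : open O ->
  (forall x, O x -> exists V : set X, [/\ open V, V x & Cn V n f]) -> Cn O n f.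
Proof.
move=> oO; elim: n Y f => [|n IH] Y f h.
  by apply/(Cn0P _ oO) => x /h[V [oV Vx /(Cn0P _ oV)]]; exact.
apply/CnSP; split=> [x /h[V [oV Vx /CnSP[+ _]]]|]; first exact.
by apply: IH => x /h[V [oV Vx /CnSP[_ CV]]]; exists V.
Qed.

Lemma Cn_sub X Y (O V : set X) n (f : X -> Y) : open O -> open V -> V `<=` O ->
  Cn O n f -> Cn V n f.
Proof.
by move=> oO oV VO Cf; elim: n Y f Cf => [|n IH] Y f;
  [move=> /(Cn0P _ oO) fO; apply/(Cn0P _ oV) => x /VO; exact: fO
  |move=> /CnSP[fO Cf]; apply/CnSP; split=> [x /VO|]; [exact: fO|exact: IH]].
Qed.

Lemma Cn_cst X Y (O : set X) n (c : Y) : open O -> Cn O n (fun _ : X => c).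
Proof.
move=> oO; elim: n Y c => [|n IH] Y c.
  by apply/(Cn0P _ oO) => x _; exact: cst_continuous.
by apply: (CnS oO) (IH _ 0) => x _; exact: is_fd_cst.
Qed.

Lemma Cn_clin X Y (O : set X) n (T : clin X Y) : open O -> Cn O n T.
Proof.
move=> oO; case: n => [|n].
  by apply/(Cn0P _ oO) => x _; exact: clin_continuous.
by apply: (CnS oO) (Cn_cst _ _ oO) => x _; exact: is_fd_clin.
Qed.

Lemma CnD X Y (O : set X) n (f g : X -> Y) : open O ->
  Cn O n f -> Cn O n g -> Cn O n (fun x => f x + g x).
Proof.
move=> oO; elim: n Y f g => [|n IH] Y f g.
  move=> /(Cn0P _ oO) fO /(Cn0P _ oO) gO; apply/(Cn0P _ oO) => x Ox.
  by apply: cvgD; [exact: fO|exact: gO].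
move=> /CnSP[fO Cf] /CnSP[gO Cg]; apply: (CnS oO) (IH _ _ _ Cf Cg) => x Ox.
by apply: is_fdD; [exact: fO|exact: gO].
Qed.

Lemma bilin_continuous W X Y Z K (B : X -> Y -> Z) (f : W -> X) (g : W -> Y) w :
  bilin K B -> {for w, continuous f} -> {for w, continuous g} ->
  {for w, continuous (fun v => B (f v) (g v))}.
Proof.
move=> [K0 Bl Br BK] fc gc; apply/cvgrPdist_le => e e0.
pose M := K * (`|f w| + 1) + K * `|g w| + 1.
have M0 : 0 < M by rewrite /M ltr_wpDl// addr_ge0 ?mulr_ge0// addr_ge0.
have eM : 0 < e / M by rewrite divr_gt0.
move/cvgrPdist_le : (fc) => /(_ _ ltr01) fc1.
move/cvgrPdist_le : fc => /(_ _ eM) fc.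
move/cvgrPdist_le : gc => /(_ _ eM) gc.
near=> v.
have fv1 : `|f w - f v| <= 1 by near: v.
have fv : `|f w - f v| <= e / M by near: v.
have gv : `|g w - g v| <= e / M by near: v.
have -> : B (f w) (g w) - B (f v) (g v) =
    B (f v) (g w - g v) + B (f w - f v) (g w).
  by rewrite (linear_sub _ _ (Br _)) (linear_sub _ _ (Bl _)); module_ring.
rewrite (le_trans (ler_normD _ _))//.
rewrite (@le_trans _ _ (K * (`|f w| + 1) * (e / M) + K * (e / M) * `|g w|))//.
  rewrite lerD// (le_trans (BK _ _))//.
    rewrite ler_pM ?mulr_ge0// ler_wpM2l//.
    rewrite -[f v](subKr (f w)) (le_trans (ler_normB _ _))// lerD//.
  by rewrite ler_wpM2r// ler_wpM2l.
rewrite [X in _ + X]mulrAC -mulrDl mulrCA ger_pMr//.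
by rewrite ler_pdivrMr// mul1r lerDl.
Unshelve. all: by end_near. Qed.

(** The derivative is a sum of two terms of the same shape, with [bilin1 B] and [bilin2 B] in place
    of [B]; the induction therefore runs over all target spaces and all bilinear maps at once. *)
Lemma Cn_bilin W X Y Z (O : set W) n K (B : X -> Y -> Z) (f : W -> X) (g : W -> Y) :
  open O -> bilin K B -> Cn O n f -> Cn O n g -> Cn O n (fun w => B (f w) (g w)).
Proof.
move=> oO; elim: n X Y Z B f g => [|n IH] X Y Z B f g hB.
  move=> /(Cn0P _ oO) fO /(Cn0P _ oO) gO; apply/(Cn0P _ oO) => x Ox.
  by apply: bilin_continuous hB _ _; [exact: fO|exact: gO].
move=> Cf Cg; have /CnSP[fO Cf'] := Cf; have /CnSP[gO Cg'] := Cg.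
apply: (CnS oO) => [w Ow|].
  by apply: is_fd_bilin hB _ _; [exact: fO|exact: gO].
apply: (CnD oO).
  by apply: IH; [exact: bilin1_bilin hB|exact: CnW|].
by apply: IH; [exact: bilin2_bilin hB| |exact: CnW].
Qed.

Lemma scale_bilin Y : bilin 1 (fun (a : R^o) (y : Y) => a *: y).
Proof.
split=> //= [y b u v|a b u v|a y]; last by rewrite mul1r normrZ.
  by rewrite scalerDl scalerA.
by module_ring.
Qed.

Lemma Cn_scale X Y (O : set X) n (phi : X -> R^o) (f : X -> Y) : open O ->
  Cn O n phi -> Cn O n f -> Cn O n (fun x => phi x *: f x).
Proof. by move=> oO; apply: Cn_bilin oO (scale_bilin Y). Qed.

Lemma Cn_scaler X Y (O : set X) n (a : R) (f : X -> Y) : open O ->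
  Cn O n f -> Cn O n (fun x => a *: f x).
Proof. by move=> oO; apply: Cn_scale => //; exact: Cn_cst. Qed.

Lemma CnB X Y (O : set X) n (f g : X -> Y) : open O ->
  Cn O n f -> Cn O n g -> Cn O n (fun x => f x - g x).
Proof.
move=> oO Cf Cg.
have : Cn O n (fun x => f x + -1 *: g x) by apply: CnD => //; exact: Cn_scaler.
by apply: Cn_ext => // x _; rewrite scaleN1r.
Qed.

Lemma eval_bilin Y Z : bilin 1 (fun (T : clin Y Z) (y : Y) => T y).
Proof.
split=> //= [T a u v|T y]; first by rewrite linearP.
by rewrite mul1r clin_le.
Qed.

Lemma Cn_postcomp X Y Z (O : set X) n (T : clin Y Z) (f : X -> Y) : open O ->
  Cn O n f -> Cn O n (fun x => T (f x)).
Proof. by move=> oO; apply: (Cn_bilin oO (eval_bilin Y Z)); exact: Cn_cst. Qed.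

Lemma is_fd_affine X Y (f : X -> Y) (a : R) (c x : X) T :
  is_fd f (a *: (x - c)) T -> is_fd (fun y => f (a *: (y - c))) x (a *: T).
Proof.
move=> fT e e0; have a0 : 0 < `|a| + 1 by rewrite ltr_wpDl.
have /near_ball_dist[r r0 h] := fT _ (divr_gt0 e0 a0).
apply/near_ball_dist; exists (r / (`|a| + 1)); first by rewrite divr_gt0.
move=> y; rewrite ltr_pdivlMr// => yx.
have e1 : a *: (y - c) - a *: (x - c) = a *: (y - x) by module_ring.
have h1 := h (a *: (y - c)); rewrite e1 in h1.
have ya : `|a *: (y - x)| < r.
  by rewrite normrZ (le_lt_trans _ yx)// mulrC ler_wpM2l// lerDl.
rewrite clinZE -linearZ (le_trans (h1 ya))// normrZ mulrA ler_wpM2r// -mulrA ger_pMr//.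
by rewrite mulrC ler_pdivrMr// mul1r lerDl.
Qed.

Lemma Cn_affine X Y (O V : set X) n (f : X -> Y) (a : R) (c : X) :
  open O -> open V -> (forall x, V x -> O (a *: (x - c))) ->
  Cn O n f -> Cn V n (fun x => f (a *: (x - c))).
Proof.
move=> oO oV VO; elim: n Y f => [|n IH] Y f.
  move=> /(Cn0P _ oO) fO; apply/(Cn0P _ oV) => x Vx.
  apply: (@continuous_comp _ _ _ (fun x => a *: (x - c)) f); last exact/fO/VO.
  by apply: cvgZl_tmp; apply: cvgB; [exact: cvg_id|exact: cvg_cst].
move=> /CnSP[fO Cf]; apply: (CnS oV) (Cn_scaler _ oV (IH _ _ Cf)) => x Vx.
by apply: is_fd_affine; apply: fO; exact: VO.
Qed.

(* A smooth real function is presented by the sequence of its derivatives. *)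
Definition smooth_family (th : nat -> R -> R) :=
  forall i (t e : R), 0 < e ->
    \forall s \near t, `|th i s - th i t - th i.+1 t * (s - t)| <= e * `|s - t|.

Lemma is_fd_comp X (phi : X -> R^o) (th dth : R -> R) x T :
  is_fd phi x T ->
  (forall e : R, 0 < e ->
    \forall s \near phi x, `|th s - th (phi x) - dth (phi x) * (s - phi x)|
       <= e * `|s - phi x|) ->
  is_fd (fun y => th (phi y) : R^o) x (dth (phi x) *: T).
Proof.
move=> pT thd e e0.
pose M := `|T| + 1 + `|dth (phi x)|.
have M0 : 0 < M by rewrite ltr_wpDr// ltr_wpDl.
have eM : 0 < e / M by rewrite divr_gt0.
have pc : phi y @[y --> x] --> phi x by exact: is_fd_continuous pT.
have h1 := pc _ (thd _ eM).
near=> y; rewrite clinZE.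
have h : `|th (phi y) - th (phi x) - dth (phi x) * (phi y - phi x)|
   <= e / M * `|phi y - phi x| by near: y.
have h2 : `|phi y - phi x - T (y - x)| <= e / M * `|y - x|.
  by near: y; exact: pT.
have h3 : `|phi y - phi x| <= (`|T| + 1) * `|y - x|.
  by near: y; exact: is_fd_near_lip.
have -> : th (phi y) - th (phi x) - dth (phi x) *: T (y - x) =
  (th (phi y) - th (phi x) - dth (phi x) * (phi y - phi x)) +
  dth (phi x) * (phi y - phi x - T (y - x)) :> R.
  by rewrite -[_ *: _]/(_ * _); ring.
rewrite (le_trans (ler_normD _ _))// normrM.
rewrite (@le_trans _ _ (e / M * ((`|T| + 1) * `|y - x|) +
  `|dth (phi x)| * (e / M * `|y - x|)))//.
  rewrite lerD//; first by rewrite (le_trans h)// ler_wpM2l// ltW.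
  by rewrite ler_wpM2l.
by rewrite [X in _ + X]mulrCA -mulrDr -mulrDl mulrA divfK// gt_eqF.
Unshelve. all: by end_near. Qed.

(** The derivative is the composite with the next member of the family times the derivative of
    [phi], so the induction keeps [i] general. *)
Lemma Cn_comp X (O : set X) n (th : nat -> R -> R) i (phi : X -> R^o) :
  open O -> smooth_family th -> Cn O n phi ->
  Cn O n (fun x => th i (phi x) : R^o).
Proof.
move=> oO hth; elim: n i => [|n IH] i Cp.
  move/(Cn0P _ oO) : Cp => pO; apply/(Cn0P _ oO) => x Ox.
  apply: (@continuous_comp _ _ _ phi (th i : R -> R^o)); first exact: pO.
  apply/cvgrPdist_le => e e0.
  have M0 : 0 < `|th i.+1 (phi x)| + 1 by rewrite ltr_wpDl.
  have h0 := hth i (phi x) 1 ltr01.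
  near=> s.
  have h : `|th i s - th i (phi x) - th i.+1 (phi x) * (s - phi x)|
     <= 1 * `|s - phi x| by near: s.
  have h2 : `|s - phi x| < e / (`|th i.+1 (phi x)| + 1).
    by near: s; apply: (@near_dist _ R^o); rewrite divr_gt0.
  rewrite distrC -(subrK (th i.+1 (phi x) * (s - phi x)) (th i s - _)).
  rewrite (le_trans (ler_normD _ _))// normrM.
  move/ltW : h2; rewrite ler_pdivlMr// => h2; apply: le_trans h2.
  rewrite [leRHS]mulrDr mulr1 addrC [X in X + _]mulrC lerD2l.
  by move: h; rewrite mul1r.
have Cp' := CnW oO Cp; move/CnSP : Cp => [pO Cd].
apply: (CnS oO) (Cn_scale oO (IH i.+1 Cp') Cd) => x Ox.
by apply: is_fd_comp; [exact: pO|exact: hth].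
Unshelve. all: by end_near. Qed.

End Cn_theory.

(** * Mean value inequalities by real induction *)

Section mean_value.
Context {R : realType}.
Implicit Types X Y : normedModType R.

(** The supremum [c] of the points of [0, 1] satisfying [P] satisfies it too, by a step from a point
    just below; a step from [c] to the right then contradicts its choice unless [c = 1]. *)
Lemma unit_interval_induction (P : R -> Prop) : P 0 ->
  (forall t, 0 <= t -> t <= 1 -> exists2 r, 0 < r &
    forall s s', 0 <= s -> s <= t -> t <= s' -> s' <= 1 -> t - r < s -> s' < t + r ->
      P s -> P s') ->
  P 1.
Proof.
move=> P0 step; pose S := [set t | 0 <= t /\ t <= 1 /\ P t].
have S0 : S 0 by split; [|split=> //; exact: ler01].
have Sub : has_ubound S by exists 1 => t [_ []].
have hS : has_sup S by split=> //; exists 0.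
pose c := sup S.
have c0 : 0 <= c by apply: ub_le_sup.
have c1 : c <= 1 by apply: ge_sup; [exists 0|move=> t [_ []]].
have [r r0 hr] := step c c0 c1.
have [s [s0 [s1 Ps]] sc] := sup_adherent r0 hS.
have sc' : s <= c by apply: ub_le_sup.
have Pc : P c by apply: (hr s c) => //; rewrite ltrDl.
have [c_eq1|c_ne1] := eqVneq c 1; first by rewrite -c_eq1.
have c_lt1 : c < 1 by rewrite lt_neqAle c_ne1.
pose s' := Num.min 1 (c + r / 2).
have cs' : c < s' by rewrite lt_min c_lt1 ltrDl divr_gt0.
have s'1 : s' <= 1 by rewrite ge_min lexx.
have s'r : s' < c + r by rewrite gt_min ltrD2l ltr_pdivrMr// ltr_pMr// ltr1n orbT.
have Ps' : P s' by apply: (hr c s') => //; [exact: ltW|rewrite gtrBl].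
have : s' <= c by apply: ub_le_sup => //; split; [apply: le_trans (ltW cs')|].
by rewrite leNgt cs'.
Qed.

(** Increments start at the fixed point [z] only. Such one-centre bounds are easy to check for glued
    maps, and along segments or curves they add up to genuine estimates. *)
Definition plip X Y (h : X -> Y) (z : X) (M : R) :=
  \forall w \near z, `|h w - h z| <= M * `|w - z|.

Definition segment_closed X (A : set X) :=
  forall x y t, A x -> A y -> 0 <= t -> t <= 1 -> A (x + t *: (y - x)).

(** Real induction along the segment: a step across [g t] is an increment ending at [g t] plus one
    starting there, both covered by the bound centred at [g t]. *)
Lemma plip_lip X Y (A : set X) (h : X -> Y) M :
  segment_closed A -> (forall z, A z -> plip h z M) ->
  forall x y, A x -> A y -> `|h y - h x| <= M * `|y - x|.
Proof.
move=> cA hA x y Ax Ay; pose g t := x + t *: (y - x).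
have gB s t : g s - g t = (s - t) *: (y - x) by rewrite /g; module_ring.
suff : `|h (g 1) - h x| <= M * (1 * `|y - x|).
  have -> : g 1 = y by rewrite /g; module_ring.
  by rewrite mul1r.
apply: (@unit_interval_induction (fun t => `|h (g t) - h x| <= M * (t * `|y - x|))).
  by rewrite /g scale0r addr0 subrr normr0 mul0r mulr0.
move=> t t0 t1; have /near_ball_dist[r r0 hr] := hA (g t) (cA _ _ _ Ax Ay t0 t1).
have v0 : 0 < `|y - x| + 1 by rewrite ltr_wpDl.
exists (r / (`|y - x| + 1)); first by rewrite divr_gt0.
move=> s s' s0 st ts' s'1 rs s'r hs.
have near_t u : `|u - t| < r / (`|y - x| + 1) -> `|h (g u) - h (g t)| <= M * (`|u - t| * `|y - x|).
  rewrite ltr_pdivlMr// => ut.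
  have := hr (g u); rewrite gB normrZ; apply.
  by rewrite (le_lt_trans _ ut)// ler_wpM2l// lerDl.
have h1 : `|h (g s') - h (g t)| <= M * ((s' - t) * `|y - x|).
  have e : `|s' - t| = s' - t by rewrite ger0_norm// subr_ge0.
  by rewrite -e; apply: near_t; rewrite e ltrBlDl.
have h2 : `|h (g s) - h (g t)| <= M * ((t - s) * `|y - x|).
  have e : `|s - t| = t - s by rewrite distrC ger0_norm// subr_ge0.
  by rewrite -e; apply: near_t; rewrite e ltrBlDl -ltrBlDr.
have -> : h (g s') - h x = (h (g s') - h (g t)) + ((h (g t) - h (g s)) + (h (g s) - h x)).
  by module_ring.
rewrite (le_trans (ler_normD _ _))//.
have -> : M * (s' * `|y - x|) = M * ((s' - t) * `|y - x|) +
   (M * ((t - s) * `|y - x|) + M * (s * `|y - x|)) by ring.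
rewrite lerD// (le_trans (ler_normD _ _))// lerD// distrC//.
Qed.

Lemma ball_segment_closed X (a : X) (r : R) : segment_closed (ball a r).
Proof.
move=> x y t /ball_center_dist xr /ball_center_dist yr t0 t1; apply/ball_center_dist.
have -> : x + t *: (y - x) - a = (1 - t) *: (x - a) + t *: (y - a) by module_ring.
rewrite (le_lt_trans (ler_normD _ _))// !normrZ (ger0_norm t0) ger0_norm ?subr_ge0//.
have [t_eq0|t_ne0] := eqVneq t 0.
  by rewrite t_eq0 subr0 mul1r mul0r addr0.
have t_gt0 : 0 < t by rewrite lt_neqAle eq_sym t_ne0.
rewrite -[ltRHS]mul1r -[X in X * r](subrK t 1) [ltRHS]mulrDl.
rewrite ler_ltD//; last by rewrite ltr_pM2l.
by rewrite ler_wpM2l ?subr_ge0// ltW.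
Qed.

Lemma setT_segment_closed X : segment_closed [set: X].
Proof. by []. Qed.

Lemma is_fd_plip X Y (f : X -> Y) x (S T : clin X Y) (M e : R) : 0 < e ->
  is_fd f x S -> `|S - T| <= M -> plip (fun y => f y - T y) x (M + e).
Proof.
move=> e0 fS STM; have := fS e e0; apply: filterS => y h.
have -> : f y - T y - (f x - T x) = (S - T) (y - x) + (f y - f x - S (y - x)).
  by rewrite clinBE !clinB; module_ring.
rewrite (le_trans (ler_normD _ _))// mulrDl lerD//.
by rewrite (le_trans (clin_le _ _))// ler_wpM2r.
Qed.

Lemma is_fd_lip X Y (A : set X) (f : X -> Y) (D : X -> clin X Y) T M :
  segment_closed A -> (forall z, A z -> is_fd f z (D z) /\ `|D z - T| <= M) ->
  forall x y, A x -> A y -> `|f y - f x - T (y - x)| <= M * `|y - x|.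
Proof.
move=> cA h x y Ax Ay; apply/ler_addgt0Pr => e e0.
have v0 : 0 < `|y - x| + 1 by rewrite ltr_wpDl.
have e1 : 0 < e / (`|y - x| + 1) by rewrite divr_gt0.
have hA z : A z -> plip (fun y => f y - T y) z (M + e / (`|y - x| + 1)).
  by move=> /h[fz Dz]; exact: is_fd_plip fz Dz.
have H := plip_lip cA hA Ax Ay; rewrite clinB.
have -> : f y - f x - (T y - T x) = f y - T y - (f x - T x) by module_ring.
apply: le_trans H _.
rewrite mulrDl lerD2l// mulrAC ler_pdivrMr// ler_wpM2l ?lerDl// ltW//.
Qed.

(** Used to turn increment estimates for glued maps into estimates of their derivatives. *)
Lemma plip_norm_le X Y (f : X -> Y) x (S T : clin X Y) (M : R) : 0 <= M ->
  is_fd f x S -> plip (fun y => f y - T y) x M -> `|S - T| <= M.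
Proof.
move=> M0 fS /near_ball_dist[r r0 fT]; apply/ler_addgt0Pr => e e0.
apply: clin_norm_le; first by rewrite addr_ge0// ltW.
have /near_ball_dist[s s0 hs] := fS e e0.
apply/near_ball_dist; exists (Num.min r s); first by rewrite lt_min r0.
move=> y; rewrite subr0 lt_min => /andP[yr ys].
have := fT (y + x); have := hs (y + x); rewrite addrK => /(_ ys) h1 /(_ yr) h2.
have -> : (S - T) y = (f (y + x) - T (y + x) - (f x - T x)) - (f (y + x) - f x - S y).
  by rewrite clinBE clinD; module_ring.
by rewrite (le_trans (ler_normB _ _))// mulrDl lerD.
Qed.

End mean_value.

(** * A smooth cutoff function on the line *)

Section smooth_cutoff.
Context {R : realType}.

Lemma is_derive_taylor (f : R -> R) (t d : R) : is_derive t (1 : R) f d ->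
  forall e, 0 < e -> \forall s \near t, `|f s - f t - d * (s - t)| <= e * `|s - t|.
Proof.
move=> [fd fE] e e0.
have /cvgrPdist_le/(_ e e0) : h^-1 *: ((f \o shift t) (h *: (1 : R^o)) - f t) @[h --> 0^'] --> d.
  by rewrite -fE; exact: fd.
rewrite near_withinE => /nbhs_ballP[r /= r0 h].
apply/(@near_ball_dist _ R^o); exists r => // s st.
have [->|nst] := eqVneq s t; first by rewrite !subrr mulr0 subrr normr0 mulr0.
have st0 : s - t != 0 by rewrite subr_eq0.
have := h (s - t); rewrite /ball /= sub0r normrN => /(_ st st0).
rewrite [_%:A]mulr1 subrK -[_ *: _]/(_ * _) => hs.
rewrite -[f s - f t](mulfVK st0) [(f s - _) / _]mulrC -mulrBl normrM ler_wpM2r//.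
by rewrite distrC.
Qed.

(* The functions [P(1/t) exp(-1/t)], extended by 0, are closed under derivation;
   [flat_next P] is the polynomial of the derivative. *)
Definition flat (P : {poly R}) (t : R) : R :=
  if 0 < t then P.[t^-1] * expR (- t^-1) else 0.

Definition flat_next (P : {poly R}) : {poly R} := 'X^2 * (P - P^`()).

(** Induction on [P] in Horner form for all [n] at once: multiplication by the variable is absorbed
    by raising [n], and constants are covered by the exponential series. *)
Lemma poly_expR_bound (P : {poly R}) n :
  exists2 K, 0 < K & forall u, 0 < u -> `|P.[u]| * u ^+ n * expR (- u) <= K.
Proof.
elim/poly_ind: P n => [|P c IH] n.
  by exists 1 => // u u0; rewrite horner0 normr0 !mul0r.
have [K K0 PK] := IH n.+1.
have [M M0 nM] : exists2 M, 0 < M & forall u : R, 0 < u -> u ^+ n * expR (- u) <= M.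
  case: n {IH PK} => [|n].
    exists 1 => // u u0; rewrite expr0 mul1r -expR0 ler_expR; lra.
  exists (n.+1)`!%:R => [|u u0]; first by rewrite ltr0n fact_gt0.
  rewrite expRN ler_pdivrMr ?expR_gt0// mulrC -ler_pdivrMr ?ltr0n ?fact_gt0//.
  by rewrite (le_trans _ (expR_ge1Dxn n (ltW u0)))// lerDr.
exists (K + `|c| * M) => [|u u0]; first by rewrite ltr_wpDr// mulr_ge0// ltW.
rewrite hornerMXaddC (@le_trans _ _ (`|P.[u]| * u ^+ n.+1 * expR (- u) +
    `|c| * (u ^+ n * expR (- u))))//; last first.
  by rewrite lerD ?PK// ler_wpM2l// nM.
rewrite mulrA -mulrDl ler_wpM2r ?expR_ge0// exprS mulrA -mulrDl ler_wpM2r//.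
  by rewrite exprn_ge0// ltW.
by rewrite (le_trans (ler_normD _ _))// normrM (gtr0_norm u0).
Qed.

Lemma flat_derive (P : {poly R}) (t e : R) : 0 < e ->
  \forall s \near t,
    `|flat P s - flat P t - flat (flat_next P) t * (s - t)| <= e * `|s - t|.
Proof.
move=> e0; have [t0|t0|t0] := ltgtP t 0.
- have : \forall s \near t, s < 0 by exact: lt_nbhsl.
  apply: filterS => s s0; rewrite /flat !ltNge (ltW t0) (ltW s0) /=.
  by rewrite mul0r !subrr normr0 mulr_ge0// ltW.
- have tn0 : t != 0 by rewrite gt_eqF.
  have fE : \forall s \near t, P.[s^-1] * expR (- s^-1) = flat P s.
    have : \forall s \near t, 0 < s by exact: lt_nbhsr.
    by apply: filterS => s s0; rewrite /flat s0.
  have d1 : is_derive t (1 : R) (fun s : R => s^-1) (- t ^- 2).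
    have hid : derivable (id : R -> R) t 1 by exact: derivable_id.
    split; first exact: derivableV.
    by rewrite deriveV// derive_id [_%:A]mulr1.
  have d2 : is_derive t (1 : R) (fun s : R => - s^-1) (- (- t ^- 2)).
    exact: is_deriveN.
  have d3 : is_derive t (1 : R) (expR \o (fun s : R => - s^-1))
    (expR (- t^-1) * (- (- t ^- 2))) by exact: is_derive1_comp.
  have d4 : is_derive t (1 : R) (horner P \o (fun s : R => s^-1))
    (P^`().[t^-1] * (- t ^- 2)) by exact: is_derive1_comp.
  have := is_derive_taylor (is_deriveM d4 d3) e0.
  have tE : P.[t^-1] * expR (- t^-1) = flat P t by exact: nbhs_singleton fE.
  have dE : flat (flat_next P) t = (horner P \o (fun s : R => s^-1)) t *:
     (expR (- t^-1) * (- (- t ^- 2))) + (expR \o (fun s : R => - s^-1)) t *: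
     (P^`().[t^-1] * (- t ^- 2)).
    rewrite /flat t0 /flat_next /= !hornerE.
    have sE (a b : R) : a *: (b : R^o) = a * b by [].
    by rewrite !sE; field.
  rewrite -dE => h; near=> s; rewrite -(near fE s)// -tE.
  by near: s; exact: h.
(* At 0 the bound with exponent 2 gives [|flat P s| <= K * s ^+ 2] for [s > 0], hence derivative
   0. *)
- rewrite {1}t0; have [K K0 PK] := poly_expR_bound P 2.
  rewrite t0 /flat ltxx.
  apply/(@near_ball_dist _ R^o); exists (e / K); first by rewrite divr_gt0.
  move=> s; rewrite !subr0 mul0r subr0; case: ifPn => s0; last first.
    by rewrite normr0 mulr_ge0// ltW.
  rewrite ltr_pdivlMr// (gtr0_norm s0) => sK.
  have := PK s^-1; rewrite invr_gt0 => /(_ s0).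
  rewrite normrM (ger0_norm (expR_ge0 _)) mulrAC exprVn ler_pdivrMr ?exprn_gt0// => h.
  by rewrite (le_trans h)// expr2 mulrA ler_wpM2r// ltW// mulrC.
Unshelve. all: by end_near. Qed.

Lemma flat_ge0 t : 0 <= flat 1 t.
Proof. by rewrite /flat; case: ifP => // _; rewrite hornerC mul1r expR_ge0. Qed.

Lemma flat_le s t : s <= t -> flat 1 s <= flat 1 t.
Proof.
move=> st; rewrite /flat; case: ifPn => s0; last exact: flat_ge0.
have t0 := lt_le_trans s0 st.
by rewrite t0 !hornerC !mul1r ler_expR lerN2 lef_pV2.
Qed.

Lemma flat_lip : exists2 K, 0 < K & forall s t, `|flat 1 t - flat 1 s| <= K * `|t - s|.
Proof.
have [K K0 h] := poly_expR_bound (flat_next 1) 0.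
exists (K + 1); first by rewrite ltr_wpDr.
move=> s t; apply: (@plip_lip _ R^o R^o setT) => // z _.
have := flat_derive 1 z ltr01; apply: filterS => w hw.
rewrite -(subrK (flat (flat_next 1) z * (w - z)) (flat 1 w - flat 1 z)).
rewrite (le_trans (ler_normD _ _))// addrC mulrDl lerD// normrM ler_wpM2r//.
rewrite {1}/flat; case: ifPn => z0; last by rewrite normr0 ltW.
have := h z^-1; rewrite invr_gt0 expr0 mulr1 => /(_ z0).
by rewrite normrM (ger0_norm (expR_ge0 _)).
Qed.

(* With [e = flat 1], [e (e 1 - e s)] is constant for [s <= 0] and vanishes for
   [1 <= s]; no quotient of smooth functions is needed. *)
Lemma cutoff (a b : R) : a < b -> exists th : R -> R,
  [/\ forall t, 0 <= th t <= 1,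
      forall t, t <= a -> th t = 1,
      forall t, b <= t -> th t = 0,
      exists2 K, 0 < K & forall s t, `|th t - th s| <= K * `|t - s| &
      forall (X : normedModType R) (O : set X) n (phi : X -> R^o), open O ->
        Cn O n phi -> Cn O n (fun x => th (phi x) : R^o)].
Proof.
move=> ab; have ba0 : 0 < b - a by rewrite subr_gt0.
pose E := flat 1 1.
have E0 : 0 < E by rewrite /E /flat ltr01 hornerC mul1r expR_gt0.
have EE : 0 < flat 1 E by rewrite /flat E0 hornerC mul1r expR_gt0.
pose s t := (b - a)^-1 * (t - a).
exists (fun t => (flat 1 E)^-1 * flat 1 (E - flat 1 (s t))); split.
- move=> t; rewrite mulr_ge0 ?invr_ge0 ?flat_ge0//= ler_pdivrMl// mulr1.
  by rewrite flat_le// gerBl flat_ge0.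
- move=> t ta; have -> : flat 1 (s t) = 0.
    have st0 : s t <= 0 by rewrite /s mulr_ge0_le0 ?subr_le0// invr_ge0 ltW.
    by rewrite /flat ltNge st0.
  by rewrite subr0 mulVf// gt_eqF.
- move=> t bt; have -> : flat 1 (E - flat 1 (s t)) = 0; last by rewrite mulr0.
    have Est : E - flat 1 (s t) <= 0.
      by rewrite subr_le0 flat_le// /s ler_pdivlMl// mulr1 lerD2r.
    by rewrite [LHS]/flat ltNge Est.
- have [K K0 hK] := flat_lip.
  exists ((flat 1 E)^-1 * (K * (K * (b - a)^-1))).
    by rewrite !(mulr_gt0, invr_gt0).
  move=> u v; rewrite -mulrBr normrM gtr0_norm ?invr_gt0// -!mulrA.
  rewrite ler_wpM2l//; first by rewrite invr_ge0 ltW.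
  rewrite (le_trans (hK _ _))// ler_wpM2l//; first exact: ltW.
  have -> : E - flat 1 (s v) - (E - flat 1 (s u)) = - (flat 1 (s v) - flat 1 (s u)) by ring.
  rewrite normrN (le_trans (hK _ _))// ler_wpM2l//; first exact: ltW.
  have -> : s v - s u = (b - a)^-1 * (v - u) by rewrite /s; ring.
  by rewrite normrM gtr0_norm ?invr_gt0.
- have fam : smooth_family (fun i => flat (iter i flat_next 1)) by move=> i t e; exact: flat_derive.
  move=> X O n phi oO Cphi.
  have Cs : Cn O n (fun x => s (phi x) : R^o).
    by apply: (@Cn_scaler _ _ R^o) => //; apply: CnB => //; exact: Cn_cst.
  have C1 : Cn O n (fun x => flat 1 (s (phi x)) : R^o) by exact: (Cn_comp 0 oO fam Cs).
  have C2 : Cn O n (fun x => E - flat 1 (s (phi x)) : R^o).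
    by apply: CnB => //; exact: Cn_cst.
  by apply: (@Cn_scaler _ _ R^o) => //; exact: (Cn_comp 0 oO fam C2).
Qed.

End smooth_cutoff.

(** * Norming functionals (Hahn-Banach) *)

Section hahn_banach.
Context {R : realType} (Y : normedModType R).

(** Graph of a partial linear functional below the norm. Single-valuedness follows: two values at
    one vector differ by a value at 0, which is at most 0 with either sign. *)
Definition dominated_graph (M : set (Y * R)) :=
  (forall a p q, M p -> M q -> M (a *: p.1 + q.1, a * p.2 + q.2)) /\
  (forall p, M p -> p.2 <= `|p.1|).

(** A value at [y1] is admissible when it lies above all [q.2 - |q.1 - y1|] and below all
    [|q'.1 + y1| - q'.2]. By the triangle inequality the former numbers lie below the latter, so
    their supremum serves. *)
Lemma dominated_graph_extend (M : set (Y * R)) (y1 : Y) :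
  dominated_graph M -> M !=set0 ->
  exists c, dominated_graph [set p | exists q s, M q /\ p = (q.1 + s *: y1, q.2 + s * c)].
Proof.
move=> [Ml Mn] [p0 Mp0].
pose S := [set q.2 - `|q.1 - y1| | q in M].
have SB q : M q -> forall q', M q' -> q.2 - `|q.1 - y1| <= `|q'.1 + y1| - q'.2.
  move=> Mq q' Mq'; rewrite lerBlDr addrAC lerBrDr -[q.2]mul1r.
  rewrite (le_trans (Mn _ (Ml 1 _ _ Mq Mq')))//= scale1r addrC.
  have -> : q.1 + q'.1 = (q.1 - y1) + (q'.1 + y1) by module_ring.
  exact: ler_normD.
have hS : has_sup S.
  split; first by exists (p0.2 - `|p0.1 - y1|), p0.
  by exists (`|p0.1 + y1| - p0.2) => _ [q Mq <-]; exact: SB.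
exists (sup S); split.
  move=> a _ _ [q [s [Mq ->]]] [q' [s' [Mq' ->]]] /=.
  exists (a *: q.1 + q'.1, a * q.2 + q'.2), (a * s + s'); split; first exact: Ml.
  by congr pair => /=; [module_ring|ring].
move=> _ [q [s [Mq ->]]] /=.
have M0 : M (0, 0).
  have := Ml (-1) _ _ Mp0 Mp0.
  by rewrite scaleN1r addNr mulN1r addNr.
have Ms b : M (b *: q.1, b * q.2) by have := Ml b _ _ Mq M0; rewrite !addr0.
(* Dividing by [- s] or by [s] reduces both signs to the two bounds on the supremum. *)
have [s0|s0|->] := ltgtP s 0.
- have s1 : 0 < - s by rewrite oppr_gt0.
  have : (- s)^-1 * q.2 - `|(- s)^-1 *: q.1 - y1| <= sup S.
    by apply: ub_le_sup; [case: hS|exists ((- s)^-1 *: q.1, (- s)^-1 * q.2)].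
  have -> : `|q.1 + s *: y1| = - s * `|(- s)^-1 *: q.1 - y1|.
    rewrite -[X in X * _](gtr0_norm s1) -normrZ; congr `|_|.
    by rewrite scalerBr scalerA divff ?gt_eqF//; module_ring.
  by rewrite lerBlDr ler_pdivrMl// => h; lra.
- have : sup S <= `|s^-1 *: q.1 + y1| - s^-1 * q.2.
    apply: ge_sup; first by case: hS.
    by move=> _ [q' Mq' <-]; exact: (SB _ Mq' (s^-1 *: q.1, s^-1 * q.2)).
  have -> : `|q.1 + s *: y1| = s * `|s^-1 *: q.1 + y1|.
    rewrite -[X in X * _](gtr0_norm s0) -normrZ; congr `|_|.
    by rewrite scalerDr scalerA divff ?gt_eqF//; module_ring.
  by rewrite lerBrDr addrC -lerBrDr ler_pdivrMl// => h; lra.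
- by rewrite scale0r mul0r !addr0; exact: Mn.
Qed.

Lemma norming_functional (y0 : Y) : exists l : clin Y R^o,
  l y0 = `|y0| /\ forall y, `|l y| <= `|y|.
Proof.
(* The condition for Zorn's lemma is put on the union of [G0] with [A], not on [A]: the empty chain
   is then harmless, and the maximal graph contains the line through [y0]. *)
pose G0 := [set p : Y * R | exists t, p = (t *: y0, t * `|y0|)].
have [|A [[Al An] Amax]] := @Zorn_bigcup (Y * R)%type (fun A => dominated_graph (G0 `|` A)).
- move=> F FP Ftot; split.
    move=> a p q.
    have lin X : F X -> (G0 `|` X) p -> (G0 `|` X) q ->
      (G0 `|` \bigcup_(X in F) X) (a *: p.1 + q.1, a * p.2 + q.2).
      move=> FX Xp Xq; have [Xl _] := FP X FX.
      by have [|h] := Xl a p q Xp Xq; [left|right; exists X].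
    move=> [Gp|[X FX Xp]] [Gq|[X' FX' Xq]].
    + left; case: Gp => t ->; case: Gq => t' ->; exists (a * t + t') => /=.
      by congr pair; [module_ring|ring].
    + by apply: (lin X') => //; [left|right].
    + by apply: (lin X) => //; [right|left].
    + have [XX'|X'X] := Ftot _ _ FX FX'.
        by apply: (lin X') => //; right=> //; exact: XX'.
      by apply: (lin X) => //; right=> //; exact: X'X.
  move=> p [[t ->]|[X FX Xp]] /=.
    by rewrite normrZ ler_wpM2r// ler_norm.
  by have [_] := FP X FX; apply; right.
set M := G0 `|` A in Al An.
have My0 : M (y0, `|y0|) by left; exists 1; rewrite scale1r mul1r.
have Mtot y : exists t, M (y, t).
  apply: contrapT => /forallNP My.
  have [c [Bl Bn]] := @dominated_graph_extend M y (conj Al An) (ex_intro _ _ My0).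
  set B := [set p | _] in Bl Bn.
  have MB : M `<=` B.
    by move=> p Mp; exists p, 0; rewrite scale0r mul0r !addr0; split=> //; case: p Mp.
  have G0B : G0 `|` B = B by apply/setUidPr => p Gp; apply: MB; left.
  apply: (Amax B); last by rewrite G0B.
  split; first by move=> p Ap; apply: MB; right.
  move=> BA; apply: (My c); right; apply: BA.
  exists (y0 - y0, `|y0| - `|y0|), 1 => /=; split; last by congr pair; [module_ring|ring].
  by have := Al (-1) _ _ My0 My0; rewrite /= scaleN1r mulN1r ![- _ + _]addrC.
have Muniq y t t' : M (y, t) -> M (y, t') -> t = t'.
  move=> Mt Mt'; apply/eqP; rewrite eq_le.
  have := An _ (Al (-1) _ _ Mt Mt'); have := An _ (Al (-1) _ _ Mt' Mt).
  by rewrite /= scaleN1r addNr normr0 => h1 h2; apply/andP; split; lra.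
have [l lM] := choice Mtot.
have ll : linear (l : Y -> R^o).
  by move=> a u v; apply: (Muniq _ _ _ (lM _)); exact: (Al a _ _ (lM u) (lM v)).
have ln y : `|l y| <= `|y|.
  rewrite ler_norml lerNl (An _ (lM y)) andbT.
  have M0 : M (0, 0) by have := Al (-1) _ _ My0 My0; rewrite /= scaleN1r mulN1r !addNr.
  have := An _ (Al (-1) _ _ (lM y) M0).
  by rewrite /= !addr0 scaleN1r normrN mulN1r.
have [T TE] : exists T : clin Y R^o, forall y, T y = l y.
  apply: (@continuous_linear_clin _ Y R^o l ll).
  apply: (@linear_bound_continuous _ Y R^o l 1 ll) => y.
  by rewrite mul1r; exact: ln.
exists T; split=> [|y]; last by rewrite TE.
by rewrite TE; exact: Muniq (lM _) My0.
Qed.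

End hahn_banach.

(** * Smooth scalar functions from (LA_k) *)

Section Ck_theory.
Context {R : realType}.
Implicit Types X Y Z : normedModType R.

Definition smooth_order (k : smoothness) (n : nat) : Prop :=
  if k is SmoothN m then (n <= m)%N else True.

Lemma CkP X Y k (O : set X) (f : X -> Y) : open O ->
  Ck k O f <-> forall n, smooth_order k n -> Cn O n f.
Proof.
move=> oO; case: k => [m|] /=; last by split=> [h n _|h n]; exact: h.
by split=> [h n nm|]; [exact: Cn_le h|exact].
Qed.

Lemma lipP X Y (A : set X) (K : R) (f : X -> Y) :
  K.-lipschitz_A f <-> forall x y, A x -> A y -> `|f x - f y| <= K * `|x - y|.
Proof.
split=> [h x y Ax Ay|h]; first exact: (h (x, y)).
by move=> [x y] [/= Ax Ay]; exact: h.
Qed.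

(** Rescaling to the unit ball turns [L] into [L * r] and rescaling back divides by [r], so the
    constant [C] is unchanged. *)
Lemma property_LA_ball k X Y C (L : R) (f : X -> Y) (c : X) (r e : R) :
  property_LA k X Y C -> 0 <= L -> 0 < r -> 0 < e ->
  L.-lipschitz_(ball c r) f ->
  exists g : X -> Y, [/\ (C * L).-lipschitz_(ball c r) g, Ck k (ball c r) g &
    forall x, ball c r x -> `|f x - g x| <= e].
Proof.
move=> [C0 LA] L0 r0 e0 /lipP fL.
have ballE x : ball c r x -> ball 0 1 (r^-1 *: (x - c)).
  move=> /ball_center_dist h; apply/ball_center_dist.
  by rewrite subr0 normrZ gtr0_norm ?invr_gt0// ltr_pdivrMl// mulr1.
have ballE' x : ball 0 1 x -> ball c r (c + r *: x).
  move=> /ball_center_dist; rewrite subr0 => h; apply/ball_center_dist.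
  by rewrite addrC addKr normrZ gtr0_norm// -[ltRHS]mulr1 ltr_pM2l.
have [|||g [/lipP gL Cg fg]] := LA (L * r) (fun x => f (c + r *: x)) e.
- by rewrite mulr_ge0// ltW.
- apply/lipP => x y /ballE' Bx /ballE' By.
  rewrite (le_trans (fL _ _ Bx By))//.
  have -> : c + r *: x - (c + r *: y) = r *: (x - y) by module_ring.
  by rewrite normrZ gtr0_norm// mulrA.
- exact: e0.
exists (fun x => g (r^-1 *: (x - c))); split.
- apply/lipP => x y /ballE Bx /ballE By; rewrite (le_trans (gL _ _ Bx By))//.
  have -> : r^-1 *: (x - c) - r^-1 *: (y - c) = r^-1 *: (x - y) by module_ring.
  rewrite normrZ gtr0_norm ?invr_gt0//.
  suff -> : C * (L * r) * (r^-1 * `|x - y|) = C * L * `|x - y| by [].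
  by field; rewrite gt_eqF.
- apply/CkP => [|n kn]; first exact: ball_open.
  move/CkP : Cg => /(_ (ball_open 0 1) n kn).
  by apply: Cn_affine; [exact: ball_open|exact: ball_open|].
- move=> x /ballE /fg; rewrite scalerA divff ?gt_eqF// scale1r.
  by rewrite [c + _]addrC subrK.
Qed.

(** The values of [D] are placed on the line through a unit vector [y1], approximated in [Y], and
    read off by a functional of norm at most 1 with value 1 at [y1]. *)
Lemma property_LA_scalar k X Y C (y0 : Y) (D : X -> R^o) (c : X) (r e : R) :
  property_LA k X Y C -> y0 != 0 -> 0 < r -> 0 < e ->
  1.-lipschitz_(ball c r) D ->
  exists v : X -> R^o, [/\ C.-lipschitz_(ball c r) v, Ck k (ball c r) v &
    forall x, ball c r x -> `|D x - v x| <= e].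
Proof.
move=> LA y00 r0 e0 /lipP DL.
pose y1 := `|y0|^-1 *: y0.
have y1E : `|y1| = 1 by rewrite normrZ normfV normr_id mulVf ?normr_eq0.
have [l [ly1 ln]] := norming_functional y1; rewrite y1E in ly1.
have fL : 1.-lipschitz_(ball c r) (fun x => D x *: y1).
  by apply/lipP => x y Bx By; rewrite -scalerBl normrZ y1E mulr1 DL.
have [g [/lipP gL /CkP Cg fg]] := property_LA_ball LA ler01 r0 e0 fL.
exists (fun x => l (g x)); split.
- apply/lipP => x y Bx By; rewrite -clinB (le_trans (ln _))//.
  by rewrite (le_trans (gL _ _ Bx By))// mulr1.
- apply/CkP => [|n kn]; first exact: ball_open.
  apply: Cn_postcomp; first exact: ball_open.
  by apply: Cg => //; exact: ball_open.
- move=> x Bx; have -> : D x = l (D x *: y1) by rewrite clinZ ly1 -[_ *: _]/(_ * _) mulr1.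
  by rewrite -clinB (le_trans (ln _))// fg.
Qed.

(* Distance to [S] truncated at 1, so that the empty set is harmless. *)
Definition tdist X (S : set X) (z : X) : R :=
  inf [set t | t = 1 \/ exists2 s, S s & t = `|z - s|].

Lemma tdist_has_inf X (S : set X) z :
  has_inf [set t | t = 1 \/ exists2 s, S s & t = `|z - s|].
Proof.
split; first by exists 1; left.
by exists 0 => _ [->|[s _ ->]].
Qed.

Lemma tdist_ge0 X (S : set X) z : 0 <= tdist S z.
Proof.
apply: lb_le_inf; first by case: (tdist_has_inf S z).
by move=> _ [->|[s _ ->]].
Qed.

Lemma tdist_le1 X (S : set X) z : tdist S z <= 1.
Proof. by apply: ge_inf; [case: (tdist_has_inf S z)|left]. Qed.

Lemma tdist_le X (S : set X) z s : S s -> tdist S z <= `|z - s|.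
Proof. by move=> Ss; apply: ge_inf; [case: (tdist_has_inf S z)|right; exists s]. Qed.

Lemma tdist_lt X (S : set X) z r : tdist S z < r -> r <= 1 ->
  exists2 s, S s & `|z - s| < r.
Proof.
move=> /inf_lt[|_ [->|[s Ss ->]]]; first by case: (tdist_has_inf S z).
  by move=> r1; rewrite leNgt r1.
by move=> sr _; exists s.
Qed.

Lemma tdist_lip X (S : set X) z w : `|tdist S z - tdist S w| <= `|z - w|.
Proof.
have le a b : tdist S a <= tdist S b + `|a - b|.
  rewrite -lerBlDr; apply: lb_le_inf; first by case: (tdist_has_inf S b).
  move=> _ [->|[s Ss ->]].
    by rewrite lerBlDr (le_trans (tdist_le1 _ _))// lerDl.
  rewrite lerBlDr (le_trans (tdist_le a Ss))// [leRHS]addrC.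
  have -> : a - s = (a - b) + (b - s) by module_ring.
  exact: ler_normD.
have := le z w; have := le w z; rewrite (distrC w z) ler_norml => h1 h2.
by apply/andP; split; lra.
Qed.

Lemma tdist_gt0 X (S : set X) z : closed S -> ~ S z -> 0 < tdist S z.
Proof.
move=> cS Sz; have : \forall w \near z, ~ S w.
  by apply: open_near (closed_openC cS) Sz _.
move=> /near_ball_dist[r r0 h]; rewrite (@lt_le_trans _ _ (Num.min r 1))//.
  by rewrite lt_min r0 ltr01.
apply: lb_le_inf; first by case: (tdist_has_inf S z).
move=> _ [->|[s Ss ->]]; first by rewrite ge_min lexx orbT.
rewrite ge_min; apply/orP; left; rewrite leNgt; apply/negP => zs.
by apply: (h s) => //; rewrite distrC.
Qed.

Lemma tdist_eq0 X (S : set X) z : S z -> tdist S z = 0.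
Proof.
move=> Sz; apply/eqP; rewrite eq_le tdist_ge0 andbT.
by have := tdist_le z Sz; rewrite subrr normr0.
Qed.

(** [K] depends on [r] but not on [S], so bumps of the same scale can be added up. As (LA_k) works
    on balls, [S] lies in a unit ball and its distance is approximated on the concentric ball of
    radius 4; at distance above 3 from the centre the bump already vanishes. *)
Lemma smooth_bump k X Y C (y0 : Y) (r : R) : property_LA k X Y C -> y0 != 0 ->
  0 < r -> r <= 1 ->
  exists2 K, 0 <= K & forall (a : X) (S : set X), S `<=` ball a 1 ->
  exists u : X -> R^o,
    [/\ Ck k [set: X] u, forall z, 0 <= u z <= 1,
        forall z w, `|u w - u z| <= K * `|w - z|,
        forall z, tdist S z < r / 4 -> u z = 1 &
        forall z, r <= tdist S z -> u z = 0].
Proof.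
move=> LA y00 r0 r1; have [C0 _] := LA.
(* With error [r / 8], distances below [r / 4] stay below [r / 2], where the cutoff is 1; distances
   of at least [7 * r / 8] stay at least [3 * r / 4], where it is 0. *)
have [th [th01 tha thb [Kt Kt0 thL] thC]] := @cutoff R (r / 2) (3 * r / 4) ltac:(lra).
exists (Kt * C) => [|a S Sa]; first by rewrite mulr_ge0// ltW.
have r8 : 0 < r / 8 by lra.
have DL : 1.-lipschitz_(ball a 4) (tdist S : X -> R^o).
  by apply/lipP => x y _ _; rewrite mul1r; exact: tdist_lip.
have a4 : 0 < 4 :> R by [].
have [v [/lipP vL /CkP Cv Dv]] := property_LA_scalar LA y00 a4 r8 DL.
pose u z : R^o := if `|z - a| < 4 then th (v z) else 0.
have oB : open (ball a 4) by exact: ball_open.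
have uB z : ball a 4 z -> u z = th (v z) by move=> /ball_center_dist h; rewrite /u h.
have far z : 3 < `|z - a| -> 7 * r / 8 <= tdist S z.
  move=> za; rewrite leNgt; apply/negP => /tdist_lt[|s Ss zs]; first lra.
  have /ball_center_dist sa := Sa _ Ss.
  have : `|z - a| <= `|z - s| + `|s - a|.
    have -> : z - a = (z - s) + (s - a) by module_ring.
    exact: ler_normD.
  lra.
have u0 z : 7 * r / 8 <= tdist S z -> u z = 0.
  rewrite /u; case: ifPn => // za Sz; apply: thb.
  have /Dv : ball a 4 z by apply/ball_center_dist.
  rewrite ler_norml => /andP[_ h]; lra.
have ufar z : 3 < `|z - a| -> \forall w \near z, u w = 0.
  move=> za; have r30 : 0 < `|z - a| - 3 by lra.
  apply: filterS (near_dist z r30) => w wz; apply/u0/far.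
  have : `|z - a| <= `|w - z| + `|w - a|.
    have -> : z - a = - (w - z) + (w - a) by module_ring.
    by rewrite -[X in _ <= X + _]normrN; exact: ler_normD.
  lra.
exists u; split.
- apply/CkP => [|n kn]; first exact: openT.
  apply: Cn_local; first exact: openT.
  move=> z _; have [za|za] := ltP `|z - a| 4.
    exists (ball a 4); split => //; first exact/ball_center_dist.
    apply: (Cn_ext oB _ (thC _ _ _ _ oB (Cv oB n kn))) => w /uB ->.
    by [].
  have /ufar : 3 < `|z - a| by lra.
  move=> /near_open[V [oV Vz VP]]; exists V; split => //.
  by apply: (Cn_ext oV _ (@Cn_cst _ _ R^o V n 0 oV)) => w /VP ->.
- by move=> z; rewrite /u; case: ifP => // _; rewrite lexx ler01.
- move=> z w; apply: (@plip_lip _ _ R^o setT) => // {z w} z _.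
  have [za|za] := ltP `|z - a| 4.
    apply: (open_near oB); first exact/ball_center_dist.
    move=> w Bw; rewrite !uB//; last exact/ball_center_dist.
    rewrite (le_trans (thL _ _))// -mulrA ler_wpM2l//; first exact: ltW.
    by apply: vL => //; exact/ball_center_dist.
  have /ufar uz : 3 < `|z - a| by lra.
  apply: filterS (uz) => w ->; rewrite (nbhs_singleton uz) subrr normr0.
  by rewrite !mulr_ge0// ltW.
- move=> z zr; have [za|za] := ltP `|z - a| 4; last first.
    have : 7 * r / 8 <= tdist S z by apply: far; lra.
    lra.
  rewrite /u za; apply: tha.
  have /Dv : ball a 4 z by apply/ball_center_dist.
  rewrite ler_norml => /andP[h _]; lra.
- by move=> z zr; apply: u0; lra.
Qed.

End Ck_theory.

(** * Smooth partitions of unity *)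

Section partition.
Context {R : realType} (X : normedModType R).

Lemma well_order_min (T : eqType) : exists le : T -> T -> Prop,
  (forall a b, le a b -> le b a -> a = b) /\
  forall A : set T, A !=set0 -> exists2 a, A a & forall b, A b -> le a b.
Proof.
have [r rwo] := wochoice.well_ordering_principle T.
have exmin (A : set T) : A !=set0 ->
    exists! a, A a /\ forall b, A b -> r a b.
  move=> [x Ax]; have [|z [[Az zl] zu]] := rwo [pred y | `[< A y >]].
    by exists x; apply/asboolP.
  exists z; split.
    split; first exact/asboolP.
    by move=> b Ab; apply: zl; apply/asboolP.
  move=> b [Ab bl]; apply: zu; split; first exact/asboolP.
  by move=> c /asboolP; exact: bl.
have rxx a : r a a.
  by have [b [[-> bb] _]] := exmin [set a] (ex_intro _ a erefl); exact: bb.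
exists (fun a b => r a b); split.
  move=> a b ab ba; have [|c [_ cu]] := exmin [set a; b]; first by exists a; left.
  rewrite -(cu a) ?(cu b)//.
    by split; [right|move=> _ [->|->]].
  by split; [left|move=> _ [->|->]].
by move=> A /exmin[a [[Aa al] _]]; exists a.
Qed.

(* Stone's construction of a sigma-discrete refinement: [S n a] collects the
   points lying [3 r_n]-deep in [W a] for which [a] is the least index. *)
Lemma sigma_discrete_refinement (O : set X) (W : X -> set X) (r : nat -> R) :
  (forall x, O x -> open (W x) /\ W x x) ->
  (forall n, 0 < r n) -> (forall e, 0 < e -> exists n, 3 * r n < e) ->
  exists S : nat -> X -> set X,
    [/\ forall n a z, S n a z -> O a /\ forall w, `|w - z| < 3 * r n -> W a w,
        forall n a b z w, S n a z -> S n b w -> `|w - z| < 3 * r n -> a = b &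
        forall z, O z -> exists n a, S n a z].
Proof.
move=> OW r0 re; have [le [anti minle]] := well_order_min X.
have r30 n : 0 < 3 * r n by rewrite mulr_gt0.
exists (fun n a => [set z | [/\ O a, forall w, `|w - z| < 3 * r n -> W a w &
  forall b, O b -> W b z -> le a b]]); split.
- by move=> n a z [].
(* Each of two close points lies in the cover member of the other, so minimality applies both
   ways. *)
- move=> n a b z w [Oa Wa la] [Ob Wb lb] wz; apply: anti.
    by apply: la => //; apply: Wb; rewrite distrC.
  by apply: lb => //; exact: Wa.
- move=> z Oz; have [|a [Oa Waz] la] := minle [set a | O a /\ W a z].
    by exists z; split => //; have [] := OW z Oz.
  have [oW _] := OW a Oa.
  have /near_ball_dist[e e0 We] : \forall w \near z, W a w by exact: open_near oW Waz _.
  have [n ne] := re e e0; exists n, a; split => //.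
    by move=> w wz; apply: We; exact: lt_trans wz ne.
  by move=> b Ob Wb; exact: la.
Qed.

Lemma Ck_scale (Y : normedModType R) k (O : set X) (phi : X -> R^o) (f : X -> Y) :
  open O -> Ck k O phi -> Ck k O f -> Ck k O (fun x => phi x *: f x).
Proof.
move=> oO /(CkP _ _ oO) Cp /(CkP _ _ oO) Cf; apply/(CkP _ _ oO) => n kn.
by apply: Cn_scale => //; [exact: Cp|exact: Cf].
Qed.

Lemma CkB (Y : normedModType R) k (O : set X) (f g : X -> Y) :
  open O -> Ck k O f -> Ck k O g -> Ck k O (fun x => f x - g x).
Proof.
move=> oO /(CkP _ _ oO) Cf /(CkP _ _ oO) Cg; apply/(CkP _ _ oO) => n kn.
by apply: CnB => //; [exact: Cf|exact: Cg].
Qed.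

Lemma CkD (Y : normedModType R) k (O : set X) (f g : X -> Y) :
  open O -> Ck k O f -> Ck k O g -> Ck k O (fun x => f x + g x).
Proof.
move=> oO /(CkP _ _ oO) Cf /(CkP _ _ oO) Cg; apply/(CkP _ _ oO) => n kn.
by apply: CnD => //; [exact: Cf|exact: Cg].
Qed.

Lemma Ck_cst (Y : normedModType R) k (O : set X) (c : Y) :
  open O -> Ck k O (fun=> c).
Proof. by move=> oO; apply/(CkP _ _ oO) => n kn; exact: Cn_cst. Qed.

Lemma Ck_ext (Y : normedModType R) k (O : set X) (f g : X -> Y) : open O ->
  (forall x, O x -> f x = g x) -> Ck k O f -> Ck k O g.
Proof.
move=> oO fg /(CkP _ _ oO) Cf; apply/(CkP _ _ oO) => n kn.
by apply: Cn_ext (Cf n kn).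
Qed.

Lemma Ck_sub (Y : normedModType R) k (O V : set X) (f : X -> Y) : open O ->
  open V -> V `<=` O -> Ck k O f -> Ck k V f.
Proof.
move=> oO oV VO /(CkP _ _ oO) Cf; apply/(CkP _ _ oV) => n kn.
by apply: (Cn_sub oO oV VO); exact: Cf.
Qed.

Lemma Ck_local (Y : normedModType R) k (O : set X) (f : X -> Y) : open O ->
  (forall x, O x -> exists V : set X, [/\ open V, V x & Ck k V f]) -> Ck k O f.
Proof.
move=> oO h; apply/(CkP _ _ oO) => n kn; apply: (Cn_local oO) => x /h[V [oV Vx]].
by move=> /(CkP _ _ oV) CV; exists V; split => //; exact: CV.
Qed.

(* [u n] is a sum of bumps with pairwise far apart supports; near each point
   only one of them, with index [a], is active. *)
Lemma discrete_bumps k (Y : normedModType R) C (y0 : Y) (O : set X) (W : X -> set X) :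
  property_LA k X Y C -> y0 != 0 -> (forall x, O x -> open (W x) /\ W x x) ->
  exists (u : nat -> X -> R^o) (K : nat -> R) (p : nat -> X -> X),
    [/\ forall n, Ck k [set: X] (u n) /\ forall z, 0 <= u n z <= 1,
        forall n, 0 <= K n /\ forall z w, `|u n w - u n z| <= K n * `|w - z|,
        forall n (z : X), (\forall w \near z, u n w = 0) \/
          exists2 a, O a & \forall w \near z, W a w /\ (u n w != 0 -> p n w = a) &
        forall z : X, O z -> exists n, \forall w \near z, u n w = 1].
Proof.
move=> LA y00 OW0.
(* The intersection puts every [S n a] into [ball a 1], as [smooth_bump] demands. *)
pose W1 a := W a `&` ball a 1.
have OW1 x : O x -> open (W1 x) /\ W1 x x.
  move=> /OW0[oW Wx]; split; first by apply: openI => //; exact: ball_open.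
  by split => //; exact: ballxx.
pose r n : R := 4^-1 / n.+1%:R.
have r0 n : 0 < r n by rewrite divr_gt0.
have r4 n : r n <= 4^-1 by rewrite ler_pdivrMr// ler_peMr// ler1n.
have re e : 0 < e -> exists n, 3 * r n < e.
  move=> e0; have [n ne] : exists n, e^-1 < n.+1%:R.
    exists (Num.truncn e^-1); exact: truncnS_gt.
  exists n; rewrite /r mulrA ltr_pdivrMr//.
  have : 1 < e * n.+1%:R by rewrite -ltr_pdivrMl// mulr1.
  lra.
have [S [SO SD Scov]] := sigma_discrete_refinement OW1 r0 re.
have SB n a : S n a `<=` ball a 1.
  by move=> z /SO[_ /(_ z)]; rewrite subrr normr0 mulr_gt0// => /(_ isT)[].
have r1 n : r n <= 1 by have := r4 n; lra.
have /choice[K KP] : forall n, exists K, 0 <= K /\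
    forall (a : X) (S : set X), S `<=` ball a 1 -> exists u : X -> R^o,
      [/\ Ck k [set: X] u, forall z, 0 <= u z <= 1,
        forall z w, `|u w - u z| <= K * `|w - z|,
        forall z, tdist S z < r n / 4 -> u z = 1 &
        forall z, r n <= tdist S z -> u z = 0].
  by move=> n; have [K K0 KP] := smooth_bump LA y00 (r0 n) (r1 n); exists K.
have /choice[b bP] : forall na : nat * X, exists u : X -> R^o,
   [/\ Ck k [set: X] u, forall z, 0 <= u z <= 1,
        forall z w, `|u w - u z| <= K na.1 * `|w - z|,
        forall z, tdist (S na.1 na.2) z < r na.1 / 4 -> u z = 1 &
        forall z, r na.1 <= tdist (S na.1 na.2) z -> u z = 0].
  by move=> na; have [_ KS] := KP na.1; exact: KS (SB _ _).
pose active n z := [set a | tdist (S n a) z < r n].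
pose p n z := xget z (active n z).
pose u n z : R^o := if `[< active n z !=set0 >] then b (n, p n z) z else 0.
(* Otherwise [S n a] and [S n c] would have points at distance below [r n + r n / 2 + r n], which is
   less than [3 * r n]. *)
have activeP n (z w : X) a c : `|w - z| < r n / 2 -> active n z a -> active n w c -> a = c.
  move=> wz /tdist_lt/(_ (r1 n))[s Ss zs] /tdist_lt/(_ (r1 n))[s' Ss' ws'].
  apply: (SD n _ _ _ _ Ss Ss').
  have -> : s' - s = - (w - s') + (w - z) + (z - s) by module_ring.
  rewrite (le_lt_trans (ler_normD _ _))// (@le_lt_trans _ _ (`|w - s'| + `|w - z| + `|z - s|))//.
    by rewrite lerD2r (le_trans (ler_normD _ _))// normrN.
  have := r0 n; lra.
have pP n z a : active n z a -> p n z = a.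
  move=> az; apply: (activeP n z z) => //; first by rewrite subrr normr0 divr_gt0.
  exact: (xgetPex _ (ex_intro _ a az)).
have loc n (z : X) : (\forall w \near z, u n w = 0) \/
    exists2 a, O a & \forall w \near z, u n w = b (n, a) w /\
      (W a w /\ (u n w != 0 -> p n w = a)).
  (* Any two points of the ball of radius [r n / 4] are closer than [r n / 2] and so share their
     active index. *)
  have r40 : 0 < r n / 4 by rewrite divr_gt0.
  have [[w [wz [a wa]]]|no] := pselect (exists w, `|w - z| < r n / 4 /\ active n w !=set0).
    right; have [s Ss ws] := tdist_lt wa (r1 n).
    have [Oa Wa] := SO n a s Ss; exists a => //.
    apply: filterS (near_dist z r40) => w' wz'.
    have ww' : `|w' - w| < r n / 2.
      have -> : w' - w = (w' - z) - (w - z) by module_ring.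
      rewrite (le_lt_trans (ler_normB _ _))//; lra.
    have act c : active n w' c -> c = a by move=> h; apply/esym; exact: activeP ww' wa h.
    split.
      rewrite /u; case: asboolP => [[c w'c]|none].
        by rewrite (pP _ _ _ w'c) (act _ w'c).
      have [_ _ _ _ b0] := bP (n, a); rewrite b0//= leNgt; apply/negP => h.
      by apply: none; exists a.
    split.
      have [] : W1 a w'; last by [].
      apply: Wa; have -> : w' - s = (w' - w) + (w - s) by module_ring.
      rewrite (le_lt_trans (ler_normD _ _))//; have := r0 n; lra.
    rewrite /u; case: asboolP => [[c w'c] _|_]; last by rewrite eqxx.
    by rewrite (pP _ _ _ w'c) (act _ w'c).
  left; apply: filterS (near_dist z r40) => w wz.
  by rewrite /u; case: asboolP => // wa; case: no; exists w.
exists u, K, p; split.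
- move=> n; split.
    apply: Ck_local; first exact: openT.
    move=> z _; have [/near_open|[a _ /near_open]] := loc n z => -[V [oV Vz VP]].
      exists V; split => //; apply: (Ck_ext oV _ (Ck_cst k 0 oV)).
      by move=> w /VP ->.
    exists V; split => //; have [Cb _ _ _ _] := bP (n, a).
    apply: (Ck_ext oV _ (Ck_sub openT oV (@subsetT _ _) Cb)).
    by move=> w /VP[-> _].
  move=> z; rewrite /u; case: ifP => _; last by rewrite lexx ler01.
  by have [_ + _ _ _] := bP (n, p n z); apply.
- move=> n; have [K0 _] := KP n; split=> // z w.
  apply: (@plip_lip _ _ R^o setT) => // {z w} z _.
  have [uz|[a _ uz]] := loc n z.
    by apply: filterS (uz) => w ->; rewrite (nbhs_singleton uz) subrr normr0 mulr_ge0.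
  apply: filterS (uz) => w [-> _]; have [-> _] := nbhs_singleton uz.
  by have [_ _ + _ _] := bP (n, a); apply.
- move=> n z; have [?|[a Oa uz]] := loc n z; [by left|right; exists a => //].
  by apply: filterS uz => w [].
- move=> z Oz; have [n [a Sz]] := Scov z Oz; exists n.
  have r40 : 0 < r n / 4 by rewrite divr_gt0.
  apply: filterS (near_dist z r40) => w wz.
  have dw : tdist (S n a) w < r n / 4 by exact: le_lt_trans (tdist_le _ Sz) wz.
  have aw : active n w a by rewrite /active/=; have := r0 n; lra.
  rewrite /u; case: asboolP => [_|none]; last by case: none; exists a.
  by rewrite (pP _ _ _ aw); have [_ _ _ + _] := bP (n, a); apply.
Qed.

(** [phi n] is [u n] times the product of the [1 - u i] for [i < n]. The partial sums telescope to
    one minus that product, which vanishes near a point beyond an index [N] with [u N = 1] there.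
    All factors lie in [0, 1], so Lipschitz constants merely add up. *)
Lemma smooth_partition k (Y : normedModType R) C (y0 : Y) (O : set X) (W : X -> set X) :
  property_LA k X Y C -> y0 != 0 -> (forall x, O x -> open (W x) /\ W x x) ->
  exists (phi : nat -> X -> R^o) (K : nat -> R) (p : nat -> X -> X),
    [/\ forall n, Ck k [set: X] (phi n) /\ forall z, 0 <= phi n z,
        forall n, 0 <= K n /\ forall z w, `|phi n w - phi n z| <= K n * `|w - z|,
        forall n (z : X), (\forall w \near z, phi n w = 0) \/
          exists2 a, O a & \forall w \near z, W a w /\ (phi n w != 0 -> p n w = a) &
        forall z : X, O z -> exists N, \forall w \near z,
          \sum_(n < N) phi n w = 1 /\ forall n, (N <= n)%N -> phi n w = 0].
Proof.
move=> LA y00 OW; have [u [K [p [Cu uK uloc u1]]]] := discrete_bumps LA y00 OW.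
pose m := fix m n z : R^o := if n is n'.+1 then (1 - u n' z) * m n' z else 1.
have m01 n z : 0 <= m n z <= 1.
  elim: n => [|n /andP[m0 m1]] /=; first by rewrite ler01 lexx.
  have [_ /(_ z)/andP[u0 u1']] := Cu n.
  by rewrite mulr_ge0 ?subr_ge0//= mulr_ile1// ?subr_ge0// gerBl.
have Cm n : Ck k [set: X] (m n).
  elim: n => [|n IH] /=; first exact: (@Ck_cst R^o k setT 1 openT).
  have [Cun _] := Cu n.
  apply: (@Ck_scale R^o k setT (fun z => 1 - u n z) (m n) openT _ IH).
  exact: (@CkB R^o k setT (fun=> 1) (u n) openT (@Ck_cst R^o k setT 1 openT) Cun).
pose M := fix M n : R := if n is n'.+1 then K n' + M n' else 0.
have M0 n : 0 <= M n by elim: n => //= n IH; rewrite addr_ge0//; case: (uK n).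
have mM n z w : `|m n w - m n z| <= M n * `|w - z|.
  elim: n => [|n IH] /=; first by rewrite subrr normr0 mul0r.
  have [K0 Ku] := uK n; have [_ u01] := Cu n.
  have /andP[m0 m1] := m01 n w; have /andP[uz0 uz1] := u01 z.
  have -> : (1 - u n w) * m n w - (1 - u n z) * m n z =
    (1 - u n z) * (m n w - m n z) - m n w * (u n w - u n z) by ring.
  rewrite (le_trans (ler_normB _ _))// !normrM addrC mulrDl lerD//.
    by rewrite (ger0_norm m0) (le_trans _ (Ku z w))// ler_piMl.
  by rewrite ger0_norm ?subr_ge0// (le_trans _ IH)// ler_piMl// gerBl.
exists (fun n z => u n z * m n z), (fun n => K n + M n), p; split.
- move=> n; split.
    exact: (@Ck_scale R^o k setT (u n) (m n) openT (Cu n).1 (Cm n)).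
  by move=> z; have [_ /(_ z)/andP[u0 _]] := Cu n; have /andP[m0 _] := m01 n z; rewrite mulr_ge0.
- move=> n; have [K0 Ku] := uK n; split; first by rewrite addr_ge0.
  move=> z w; have -> : u n w * m n w - u n z * m n z =
    m n w * (u n w - u n z) + u n z * (m n w - m n z) by ring.
  have /andP[m0 m1] := m01 n w; have [_ /(_ z)/andP[u0 u1']] := Cu n.
  rewrite (le_trans (ler_normD _ _))// !normrM mulrDl lerD//.
    by rewrite (ger0_norm m0) (le_trans _ (Ku z w))// ler_piMl.
  by rewrite (ger0_norm u0) (le_trans _ (mM n z w))// ler_piMl.
- move=> n z; have [uz|[a Oa uz]] := uloc n z.
    by left; apply: filterS uz => w ->; rewrite mul0r.
  right; exists a => //; apply: filterS uz => w [Wa pa]; split => //.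
  by rewrite mulf_eq0 negb_or => /andP[/pa].
- move=> z Oz; have [N uN] := u1 z Oz; exists N.+1.
  apply: filterS uN => w uN.
  have sumE n : \sum_(i < n) (u i w * m i w) = 1 - m n w.
    elim: n => [|n IH]; first by rewrite big_ord0 subrr.
    by rewrite big_ord_recr /= IH; ring.
  have mN n : (N < n)%N -> m n w = 0.
    elim: n => // n IH; rewrite ltnS leq_eqVlt => /orP[/eqP<-|/IH h] /=.
      by rewrite uN subrr mul0r.
    by rewrite h mulr0.
  split; first by rewrite sumE mN// subr0.
  by move=> n Nn; rewrite mN// mulr0.
Qed.

End partition.

(** * Locally finite sums and gluing estimates *)

Section gluing.
Context {R : realType}.
Implicit Types X Y : normedModType R.

Lemma near_all_ord X (z : X) (P : nat -> X -> Prop) N :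
  (forall n, \forall w \near z, P n w) ->
  \forall w \near z, forall n, (n < N)%N -> P n w.
Proof.
move=> zP; elim: N => [|N IH]; first by apply: nearW => w n.
near=> w => n; rewrite ltnS leq_eqVlt => /orP[/eqP->|nN]; first by near: w; exact: zP.
by move: n nN; near: w.
Unshelve. all: by end_near. Qed.

(** The cut is at some index beyond which the terms at [z] vanish; by [lfsumE] its choice is
    immaterial, so neighbouring points may be summed up to a common index. *)
Definition lfsum X Y (T : nat -> X -> Y) (z : X) : Y :=
  \sum_(n < xget 0%N [set N | forall n, (N <= n)%N -> T n z = 0]) T n z.

Lemma lfsumE X Y (T : nat -> X -> Y) (z : X) N :
  (forall n, (N <= n)%N -> T n z = 0) -> lfsum T z = \sum_(n < N) T n z.
Proof.
move=> zN; rewrite /lfsum; set M := xget _ _.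
have zM : forall n, (M <= n)%N -> T n z = 0.
  by apply: (@xgetPex _ 0%N [set N | forall n, (N <= n)%N -> T n z = 0]); exists N.
have le a b : (a <= b)%N -> (forall n, (a <= n)%N -> T n z = 0) ->
    \sum_(n < a) T n z = \sum_(n < b) T n z.
  move=> ab za; rewrite -(subnKC ab); elim: (b - a)%N => [|k IH].
    by rewrite addn0.
  by rewrite addnS big_ord_recr /= -IH za ?addr0// leq_addr.
by have [MN|/ltnW NM] := leqP M N; [exact: le|exact/esym/le].
Qed.

Lemma convex_sum_le Y N (a : nat -> R) (p : nat -> Y) (y : Y) (e : R) :
  (forall n, 0 <= a n) -> \sum_(n < N) a n = 1 ->
  (forall n, (n < N)%N -> a n = 0 \/ `|p n - y| <= e) ->
  `|\sum_(n < N) a n *: p n - y| <= e.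
Proof.
move=> a0 a1 h.
have -> : \sum_(n < N) a n *: p n - y = \sum_(n < N) a n *: (p n - y).
  rewrite -[X in _ - X]scale1r -a1 scaler_suml -sumrB.
  by apply: eq_bigr => i _; rewrite scalerBr.
rewrite (le_trans (ler_norm_sum _ _ _))// -[leRHS]mul1r -a1 mulr_suml.
apply: ler_sum => i _; rewrite normrZ ger0_norm//.
by have [->|?] := h i (ltn_ord i); [rewrite !mul0r|rewrite ler_wpM2l].
Qed.

(* The weights sum to 1, so their increments may be tested against
   [q n - y] for any fixed [y] instead of [q n]. *)
Lemma glue_bound Y N (a b K eta : nat -> R) (p q : nat -> Y) (y : Y) (c d : R) :
  0 <= c -> 0 <= d -> (forall n, 0 <= a n) -> (forall n, 0 <= K n) ->
  (forall n, 0 <= eta n) ->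
  \sum_(n < N) a n = 1 -> \sum_(n < N) b n = 1 ->
  (forall n, `|a n - b n| <= K n * d) ->
  (forall n, (n < N)%N -> (a n = 0 /\ b n = 0) \/
     (`|p n - q n| <= c * d /\ `|q n - y| <= eta n)) ->
  `|\sum_(n < N) a n *: p n - \sum_(n < N) b n *: q n|
     <= (c + \sum_(n < N) K n * eta n) * d.
Proof.
move=> c0 d0 a0 K0 eta0 a1 b1 ab h.
have -> : \sum_(n < N) a n *: p n - \sum_(n < N) b n *: q n =
    \sum_(n < N) (a n *: (p n - q n) + (a n - b n) *: (q n - y)).
  rewrite -sumrB; apply/eqP; rewrite -subr_eq0 -sumrB.
  under eq_bigr => i _.
    have -> : a i *: p i - b i *: q i - (a i *: (p i - q i) + (a i - b i) *: (q i - y)) =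
      a i *: y - b i *: y by module_ring.
    over.
  by rewrite sumrB -!scaler_suml a1 b1 subrr.
rewrite (le_trans (ler_norm_sum _ _ _))// mulrDl -[X in X * d + _]mul1r -a1.
rewrite !mulr_suml -big_split /=.
apply: ler_sum => i _.
have [[-> ->]|[pq qy]] := h i (ltn_ord i).
  by rewrite subrr !scale0r addr0 normr0 !mul0r add0r mulr_ge0// mulr_ge0.
rewrite (le_trans (ler_normD _ _))// !normrZ (ger0_norm (a0 _)) lerD//.
  by rewrite -mulrA ler_wpM2l.
by rewrite mulrAC ler_pM.
Qed.

Lemma sum_half_le1 N : \sum_(n < N) (2^-1 ^+ n.+1 : R) <= 1.
Proof.
suff -> : \sum_(n < N) (2^-1 ^+ n.+1 : R) = 1 - 2^-1 ^+ N by rewrite gerBl exprn_ge0.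
elim: N => [|N IH]; first by rewrite big_ord0 expr0 subrr.
by rewrite big_ord_recr /= IH exprS; lra.
Qed.

(* The approximants are chosen after the partition of unity, with an error that
   offsets the (uncontrolled) slopes [K n] of its members. *)
Lemma LA_approximation k X Y C (y0 : Y) (O : set X) (F : X -> Y)
    (T : X -> clin X Y) (c r eps : X -> R) :
  property_LA k X Y C -> smooth_order k 1 -> y0 != 0 -> open O ->
  (forall x, O x -> [/\ 0 < r x, ball x (r x) `<=` O, 0 <= c x & 0 < eps x] /\
     forall u v, ball x (r x) u -> ball x (r x) v ->
       `|F u - F v - T x (u - v)| <= c x * `|u - v|) ->
  exists g : X -> Y, Ck k O g /\ forall z, O z ->
    (forall e, (forall x, O x -> ball x (r x) z -> eps x <= e) -> `|g z - F z| <= e) /\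
    (forall T0 rho e, (forall x, O x -> ball x (r x) z ->
         `|T x - T0| + C * c x <= rho /\ eps x <= e) ->
       `|frechet g z - T0| <= rho + e).
Proof.
move=> LA k1 y00 oO OF; have [C0 _] := LA.
have OW x : O x -> open (ball x (r x)) /\ ball x (r x) x.
  by move=> /OF[[r0 _ _ _] _]; split; [exact: ball_open|exact: ballxx].
have [phi [K [p [Cphi phiK philoc phi1]]]] := smooth_partition LA y00 OW.
pose eta n x := eps x * 2^-1 ^+ n.+1 / (1 + K n).
have K1 n : 0 < 1 + K n by rewrite ltr_wpDr//; case: (phiK n).
have /choice[h hP] : forall nx : nat * X, exists h : X -> Y, O nx.2 ->
    [/\ Ck k (ball nx.2 (r nx.2)) h,
        forall u, ball nx.2 (r nx.2) u -> `|h u - F u| <= eta nx.1 nx.2 &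
        forall u v, ball nx.2 (r nx.2) u -> ball nx.2 (r nx.2) v ->
          `|h u - h v - T nx.2 (u - v)| <= C * c nx.2 * `|u - v|].
  move=> [n x] /=; have [Ox|nOx] := pselect (O x); last by exists F.
  have [[r0 _ c0 e0] FT] := OF x Ox.
  have eta0 : 0 < eta n x by rewrite divr_gt0// mulr_gt0// exprn_gt0.
  have FL : (c x).-lipschitz_(ball x (r x)) (fun u => F u - T x u).
    apply/lipP => u v Bu Bv; have -> : F u - T x u - (F v - T x v) = F u - F v - T x (u - v).
      by rewrite clinB; module_ring.
    exact: FT.
  have [g [/lipP gL Cg Fg]] := property_LA_ball LA c0 r0 eta0 FL.
  have oB := ball_open x (r x).
  exists (fun u => g u + T x u) => _; split.
  - apply: CkD => //; apply/(CkP _ _ oB) => m _; exact: Cn_clin.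
  - move=> u /Fg; rewrite distrC; congr (_ <= _); congr `|_|.
    by module_ring.
  - move=> u v Bu Bv; have -> : g u + T x u - (g v + T x v) - T x (u - v) = g u - g v.
      by rewrite clinB; module_ring.
    exact: gL.
have etaE n x e : 0 < eps x -> eps x <= e -> eta n x <= e * 2^-1 ^+ n.+1 / (1 + K n).
  by move=> e0 xe; rewrite /eta ler_pM2r ?invr_gt0// ler_pM2r// exprn_gt0.
have eta_le n x e : 0 < eps x -> eps x <= e -> eta n x <= e.
  move=> e0 xe; rewrite (le_trans (etaE n x e e0 xe))//.
  rewrite ler_pdivrMr// (@le_trans _ _ (e * 1))//.
    by rewrite ler_wpM2l ?(le_trans (ltW e0))// exprn_ile1//; lra.
  by rewrite ler_wpM2l ?(le_trans (ltW e0))// lerDl; case: (phiK n).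
pose Tm n z := phi n z *: h (n, p n z) z.
pose g := lfsum Tm.
(* Near [z] the centre [p n w] of an active member is a constant [al n], so [g] is locally a finite
   sum of fixed smooth maps. *)
have gE z : O z -> exists N, exists al : nat -> X,
   (\forall w \near z, g w = \sum_(n < N) phi n w *: h (n : nat, al n) w /\
      \sum_(n < N) phi n w = 1) /\
   forall n, (\forall w \near z, phi n w = 0) \/
     (O (al n) /\ \forall w \near z, ball (al n) (r (al n)) w).
  move=> Oz; have [N zN] := phi1 z Oz; exists N.
  have /choice[al alP] : forall n, exists a, (\forall w \near z, phi n w = 0) \/
      (O a /\ \forall w \near z, ball a (r a) w /\ (phi n w != 0 -> p n w = a)).
    by move=> n; have [?|[a Oa za]] := philoc n z; [exists z; left|exists a; right].
  exists al; split; last first.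
    move=> n; have [?|[Oa za]] := alP n; [by left|right; split => //].
    by apply: filterS za => w [].
  have locN : \forall w \near z, forall n, (n < N)%N -> phi n w != 0 -> p n w = al n.
    apply: near_all_ord => n; have [za|[_ za]] := alP n.
      by apply: filterS za => w ->; rewrite eqxx.
    by apply: filterS za => w [].
  near=> w.
  have [w1 w0] : \sum_(n < N) phi n w = 1 /\ forall n, (N <= n)%N -> phi n w = 0.
    by near: w.
  have wl : forall n, (n < N)%N -> phi n w != 0 -> p n w = al n by near: w.
  split => //.
  rewrite /g (@lfsumE _ _ _ _ N); last by move=> n /w0; rewrite /Tm => ->; rewrite scale0r.
  apply: eq_bigr => i _; rewrite /Tm; have [->|pn0] := eqVneq (phi i w) 0.
    by rewrite !scale0r.
  by rewrite wl.
have Cg : Ck k O g.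
  apply: Ck_local => // z Oz.
  have [N [al [gN aln]]] := gE z Oz.
  have [V [oV Vz CV]] : exists V, [/\ open V, V z &
      Ck k V (fun w => \sum_(n < N) phi n w *: h (n : nat, al n) w)].
    elim: (N) => [|M [V [oV Vz CV]]].
      exists setT; split => //; first exact: openT.
      by apply: (Ck_ext openT _ (Ck_cst k 0 openT)) => w _; rewrite big_ord0.
    have [V' [oV' V'z CV']] : exists V, [/\ open V, V z &
        Ck k V (fun w => phi M w *: h (M, al M) w)].
      have [/near_open[V' [oV' V'z V'P]]|[Oa /near_open[V' [oV' V'z V'P]]]] := aln M;
          exists V'; split => //.
        by apply: (Ck_ext oV' _ (Ck_cst k 0 oV')) => w /V'P ->; rewrite scale0r.
      have [Ch _ _] := hP (M, al M) Oa.
      apply: Ck_scale => //; first exact: Ck_sub openT oV' (@subsetT _ _) (Cphi M).1.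
      by apply: (Ck_sub (ball_open (al M) (r (al M))) oV' _ Ch) => w; exact: V'P.
    have oVV := openI oV oV'.
    exists (V `&` V'); split => //.
    apply: (Ck_ext oVV (f := fun w => \sum_(n < M) phi n w *: h (n : nat, al n) w + phi M w *: h (M, al M) w)).
      by move=> w _; rewrite big_ord_recr.
    apply: CkD => //; first exact: (Ck_sub oV oVV (@subIsetl _ _ _)).
    exact: (Ck_sub oV' oVV (@subIsetr _ _ _)).
  have /near_open[V' [oV' V'z V'P]] := gN.
  have oVV := openI oV oV'.
  exists (V `&` V'); split => //.
  apply: (Ck_ext oVV _ (Ck_sub oV oVV (@subIsetl _ _ _) CV)) => w [_ /V'P[-> _]].
  by [].
exists g; split => // z Oz; have [N [al [gN aln]]] := gE z Oz.
have [rz0 _ cz0 ez0] := (OF z Oz).1.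
have Bz : ball z (r z) z by exact: ballxx.
split.
  move=> e he; have [-> s1] := nbhs_singleton gN.
  apply: (@convex_sum_le Y N (phi^~ z) (fun n => h (n, al n) z) (F z) e) => //; first by move=> n; exact: (Cphi n).2.
  move=> n nN; have [/nbhs_singleton->|[Oa /nbhs_singleton Ba]] := aln n; [by left|right].
  have [_ hF _] := hP (n, al n) Oa; rewrite (le_trans (hF z Ba))//.
  by apply: eta_le => /=; [have [[]] := OF _ Oa|exact: he].
move=> T0 rho e he.
(* The centre [x = z] is itself admissible, which gives the signs of [rho] and [e]. *)
have [Tz ez] := he z Oz Bz.
have rho0 : 0 <= rho by rewrite (le_trans _ Tz)// addr_ge0// mulr_ge0.
have e0 : 0 < e by exact: lt_le_trans ez.
have gd : is_fd g z (frechet g z).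
  by apply: is_fd_frechet; move/(CkP _ _ oO) : Cg => /(_ 1%N k1)[dg _]; exact: dg.
apply: plip_norm_le gd _; first by rewrite addr_ge0// ltW.
have alN : \forall w \near z, forall n, (n < N)%N -> (phi n w = 0 /\ phi n z = 0) \/
    [/\ O (al n), ball (al n) (r (al n)) w & ball (al n) (r (al n)) z].
  apply: near_all_ord => n; have [zn|[Oa zn]] := aln n.
    by apply: filterS (zn) => w ->; left; rewrite (nbhs_singleton zn).
  by apply: filterS (zn) => w Bw; right; split => //; exact: nbhs_singleton zn.
near=> w.
have [gw w1] : g w = \sum_(n < N) phi n w *: h (n : nat, al n) w /\ \sum_(n < N) phi n w = 1.
  by near: w.
have [gz z1] := nbhs_singleton gN.
have wz : forall n, (n < N)%N -> (phi n w = 0 /\ phi n z = 0) \/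
    [/\ O (al n), ball (al n) (r (al n)) w & ball (al n) (r (al n)) z] by near: w.
have subE v : \sum_(n < N) phi n v = 1 ->
    \sum_(n < N) phi n v *: h (n : nat, al n) v - T0 v =
    \sum_(n < N) phi n v *: (h (n : nat, al n) v - T0 v).
  move=> v1; rewrite -[X in _ - X]scale1r -v1 scaler_suml -sumrB.
  by apply: eq_bigr => i _; rewrite scalerBr.
rewrite gw gz !subE//.
pose et n := e * 2^-1 ^+ n.+1 / (1 + K n).
have et0 n : 0 <= et n by rewrite divr_ge0 ?ltW// mulr_gt0// exprn_gt0.
(* The increments of the weights are tested against [F z - T0 z], which is within [et n] of every
   active piece. *)
rewrite (le_trans (@glue_bound Y N (phi^~ w) (phi^~ z) K et
   (fun n => h (n : nat, al n) w - T0 w) (fun n => h (n : nat, al n) z - T0 z) (F z - T0 z) rho `|w - z|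
   _ _ _ _ _ _ _ _ _))//.
- by move=> n; exact: (Cphi n).2.
- by move=> n; case: (phiK n).
- by move=> n; have [_ +] := phiK n; apply.
- move=> n nN; have [?|[Oa Bw Baz]] := wz n nN; [by left|right].
  have [_ hF hT] := hP (n, al n) Oa; have [Ta ea] := he _ Oa Baz; split.
    have -> : h (n : nat, al n) w - T0 w - (h (n : nat, al n) z - T0 z) =
      (h (n : nat, al n) w - h (n : nat, al n) z - T (al n) (w - z)) + (T (al n) - T0) (w - z).
      by rewrite clinBE !clinB; module_ring.
    rewrite (le_trans (ler_normD _ _))// (le_trans (lerD (hT _ _ Bw Baz) (clin_le _ _)))//.
    by rewrite -mulrDl ler_wpM2r// addrC.
  have -> : h (n : nat, al n) z - T0 z - (F z - T0 z) = h (n : nat, al n) z - F z by module_ring.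
  by rewrite (le_trans (hF _ Baz))//; apply: etaE => //=; have [[]] := OF _ Oa.
rewrite ler_wpM2r// lerD2l (@le_trans _ _ (\sum_(n < N) e * 2^-1 ^+ n.+1))//.
  apply: ler_sum => n _; rewrite /et mulrA ler_pdivrMr// mulrC ler_wpM2l ?lerDr//.
  by rewrite mulr_ge0 ?exprn_ge0// ltW.
by rewrite -mulr_sumr ler_piMr ?sum_half_le1// ltW.
Unshelve. all: by end_near. Qed.

End gluing.

(** * Strict jets and extensions with a prescribed error *)

Section strict_extension.
Context {R : realType}.
Implicit Types X Y : normedModType R.

Definition near_affine X Y (F : X -> Y) (A : set X) (T : clin X Y) (e : R) :=
  forall x y, A x -> A y -> `|F x - F y - T (x - y)| <= e * `|x - y|.

(** Whitney's condition for C^1 jets, uniform over pairs of points near [b] and with the slope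
    frozen at [b]; the second clause allows it to be exchanged for slopes at nearby points of
    [A]. *)
Definition strict_jet X Y (A : set X) (f : X -> Y) (G : X -> clin X Y) :=
  forall b e, A b -> 0 < e -> exists2 d, 0 < d &
    near_affine f (A `&` ball b d) (G b) e /\
    forall y, A y -> ball b d y -> `|G y - G b| <= e.

Lemma near_affineW X Y (F : X -> Y) (A B : set X) T e :
  A `<=` B -> near_affine F B T e -> near_affine F A T e.
Proof. by move=> AB h x y /AB Bx /AB By; exact: h. Qed.

Lemma near_affine_shift X Y (F : X -> Y) (A : set X) (S T : clin X Y) e d :
  near_affine F A S e -> `|S - T| <= d -> near_affine F A T (e + d).
Proof.
move=> h STd x y Ax Ay.
have -> : F x - F y - T (x - y) = (F x - F y - S (x - y)) + (S - T) (x - y).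
  by rewrite clinBE; module_ring.
rewrite (le_trans (ler_normD _ _))// mulrDl lerD ?h//.
by rewrite (le_trans (clin_le _ _))// ler_wpM2r.
Qed.

Lemma LE_extension_near_affine X Y C (f : X -> Y) (A : set X) (T : clin X Y) e :
  property_LE X Y C -> 0 <= e -> near_affine f A T e ->
  exists E : X -> Y, near_affine E setT T (C * e) /\ forall x, A x -> E x = f x.
Proof.
move=> [C0 LE] e0 fT.
have [||E [/lipP EL Ef]] := LE A e (fun x => f x - T x) => //.
  apply/lipP => x y Ax Ay.
  have -> : f x - T x - (f y - T y) = f x - f y - T (x - y) by rewrite clinB; module_ring.
  exact: fT.
exists (fun x => E x + T x); split=> [x y _ _|x Ax]; last by rewrite Ef// subrK.
have -> : E x + T x - (E y + T y) - T (x - y) = E x - E y by rewrite clinB; module_ring.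
exact: EL.
Qed.

(** Near [b] finitely many extensions [E a] are active, all with value [f b] at [b] and slope close
    to [G b]. Their deviations from the affine map at [b] are O(|z - b|); within distance [Ks^-1],
    where [Ks] exceeds the sum of the active slopes, the partition costs no more than the extensions
    do. *)
Lemma strict_extension X Y C C' (y0 : Y) (A : set X) (f : X -> Y) (G : X -> clin X Y) e :
  property_LE X Y C -> property_LA (SmoothN 1) X Y C' -> y0 != 0 -> closed A ->
  strict_jet A f G -> 0 < e ->
  exists F : X -> Y, (forall x, A x -> F x = f x) /\
    forall b, A b -> exists2 d, 0 < d & near_affine F (ball b d) (G b) e.
Proof.
move=> LE LA y00 cA fG e0; have [C0 _] := LE.
(* Half of [e] is [C * e1 + e1], the error of an (LE)-extension plus the change of slope from [G a]
   to [G b]; the other half is left to the partition. *)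
pose e1 := e / (2 * (C + 1)).
have C10 : 0 < C + 1 by rewrite addr_gt0.
have e10 : 0 < e1 by rewrite divr_gt0// mulr_gt0.
have e1E : (C * e1 + e1) *+ 2 = e.
  by rewrite /e1; field; rewrite gt_eqF.
have /choice[dl dlP] : forall x, exists d, A x -> 0 < d /\
    (near_affine f (A `&` ball x d) (G x) e1 /\
     forall y, A y -> ball x d y -> `|G y - G x| <= e1).
  move=> x; have [Ax|nAx] := pselect (A x); last by exists 0.
  by have [d d0 h] := fG x e1 Ax e10; exists d.
(* The cover member of a point off [A] avoids [A], so the arbitrary map attached to such a point is
   inactive near every point of [A]. *)
pose W x := if `[< A x >] then ball x (dl x) else ~` A.
have WA x : A x -> W x = ball x (dl x) by move=> Ax; rewrite /W; case: asboolP.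
have WnA x : ~ A x -> W x = ~` A by move=> Ax; rewrite /W; case: asboolP.
have OW x : setT x -> open (W x) /\ W x x.
  move=> _; have [Ax|nAx] := pselect (A x).
    rewrite WA//; split; [exact: ball_open|apply: ballxx; exact: (dlP x Ax).1].
  by rewrite WnA//; split => //; exact: closed_openC.
have [phi [K [p [Cphi phiK philoc phi1]]]] := smooth_partition LA y00 OW.
have /choice[E EP] : forall x, exists E : X -> Y, A x ->
    near_affine E setT (G x) (C * e1) /\ forall y, (A `&` ball x (dl x)) y -> E y = f y.
  move=> x; have [Ax|nAx] := pselect (A x); last by exists f.
  have [_ [h _]] := dlP x Ax.
  by have [E hE] := LE_extension_near_affine LE (ltW e10) h; exists E.
pose Tm n z := phi n z *: E (p n z) z.
pose F := lfsum Tm.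
have locA b : A b -> exists N, exists al : nat -> X,
   (\forall w \near b, F w = \sum_(n < N) phi n w *: E (al n) w /\
      \sum_(n < N) phi n w = 1) /\
   forall n, (\forall w \near b, phi n w = 0) \/ (A (al n) /\ ball (al n) (dl (al n)) b).
  move=> Ab; have [N bN] := phi1 b I; exists N.
  have /choice[al alP] : forall n, exists a, (\forall w \near b, phi n w = 0) \/
      (\forall w \near b, W a w /\ (phi n w != 0 -> p n w = a)).
    by move=> n; have [?|[a _ ba]] := philoc n b; [exists b; left|exists a; right].
  exists al; split; last first.
    move=> n; have [?|/nbhs_singleton[Wa _]] := alP n; [by left|right].
    have [Aa|nAa] := pselect (A (al n)); first by rewrite WA// in Wa.
    by rewrite WnA// in Wa.
  have locN : \forall w \near b, forall n, (n < N)%N -> phi n w != 0 -> p n w = al n.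
    apply: near_all_ord => n; have [za|za] := alP n.
      by apply: filterS za => w ->; rewrite eqxx.
    by apply: filterS za => w [].
  near=> w.
  have [w1 w0] : \sum_(n < N) phi n w = 1 /\ forall n, (N <= n)%N -> phi n w = 0.
    by near: w.
  have wl : forall n, (n < N)%N -> phi n w != 0 -> p n w = al n by near: w.
  split => //.
  rewrite /F (@lfsumE _ _ _ _ _ N); last by move=> n /w0; rewrite /Tm => ->; rewrite scale0r.
  apply: eq_bigr => i _; rewrite /Tm; have [->|pn0] := eqVneq (phi i w) 0.
    by rewrite !scale0r.
  by rewrite wl.
have FA b : A b -> F b = f b.
  move=> Ab; have [N [al [/nbhs_singleton[-> s1] aln]]] := locA b Ab.
  apply/eqP; rewrite -subr_eq0 -normr_le0.
  apply: (@convex_sum_le R Y N (phi^~ b) (fun n => E (al n) b) (f b) 0) => //.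
    by move=> n; exact: (Cphi n).2.
  move=> n nN; have [/nbhs_singleton->|[Aa Ba]] := aln n; [by left|right].
  by rewrite (EP _ Aa).2// subrr normr0.
exists F; split => // b Ab.
have [N [al [bN aln]]] := locA b Ab.
have K0 n : 0 <= K n by case: (phiK n).
pose Ks := \sum_(n < N) K n + 1.
have Ks0 : 0 < Ks by rewrite ltr_wpDl// sumr_ge0.
have alN : \forall w \near b, forall n, (n < N)%N -> phi n w = 0 \/
    (A (al n) /\ ball (al n) (dl (al n)) b).
  by apply: near_all_ord => n; have [zn|?] := aln n;
    [apply: filterS (zn) => w ->; left|apply: nearW => w; right].
have [d d0 dP] : exists2 d, 0 < d & forall w, ball b d w ->
   [/\ F w = \sum_(n < N) phi n w *: E (al n) w, \sum_(n < N) phi n w = 1,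
     `|w - b| < Ks^-1 & forall n, (n < N)%N -> phi n w = 0 \/
      (A (al n) /\ ball (al n) (dl (al n)) b)].
  have : \forall w \near b, [/\ F w = \sum_(n < N) phi n w *: E (al n) w, \sum_(n < N) phi n w = 1,
     `|w - b| < Ks^-1 & forall n, (n < N)%N -> phi n w = 0 \/
      (A (al n) /\ ball (al n) (dl (al n)) b)].
    near=> w; have [] : F w = \sum_(n < N) phi n w *: E (al n) w /\ \sum_(n < N) phi n w = 1.
      by near: w.
    split => //; last by near: w.
    by near: w; apply: near_dist; rewrite invr_gt0.
  by move=> /near_ball_dist[d d0 h]; exists d => // w /ball_center_dist; exact: h.
exists d => // w z Bw Bz.
have [Fw w1 wb nw] := dP w Bw; have [Fz z1 zb nz] := dP z Bz.
have EG a : A a -> ball a (dl a) b -> near_affine (E a) setT (G b) (C * e1 + e1).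
  move=> Aa ab; apply: near_affine_shift (EP a Aa).1 _.
  by rewrite distrC; exact: (dlP a Aa).2.2.
have subE v : \sum_(n < N) phi n v = 1 ->
    \sum_(n < N) phi n v *: E (al n) v - G b v =
    \sum_(n < N) phi n v *: (E (al n) v - G b v).
  move=> v1; rewrite -[X in _ - X]scale1r -v1 scaler_suml -sumrB.
  by apply: eq_bigr => i _; rewrite scalerBr.
have -> : F w - F z - G b (w - z) = (F w - G b w) - (F z - G b z) by rewrite clinB; module_ring.
rewrite Fw Fz !subE//.
have e20 : 0 <= C * e1 + e1 by apply: addr_ge0; [apply: mulr_ge0|]; exact: ltW.
pose et (n : nat) := (C * e1 + e1) * Ks^-1.
have et0 n : 0 <= et n by apply: mulr_ge0 => //; rewrite invr_ge0 ltW.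
rewrite (le_trans (@glue_bound _ Y N (phi^~ w) (phi^~ z) K et
   (fun n => E (al n) w - G b w) (fun n => E (al n) z - G b z) (f b - G b b)
   (C * e1 + e1) `|w - z| _ _ _ _ _ _ _ _ _))//.
- by move=> n; exact: (Cphi n).2.
- by move=> n; have [_ +] := phiK n; apply.
- move=> n nN.
  have [[Aa Ba]|none] := pselect (A (al n) /\ ball (al n) (dl (al n)) b); last first.
    by left; split; [case: (nw n nN)|case: (nz n nN)].
  right; split.
    have -> : E (al n) w - G b w - (E (al n) z - G b z) =
      E (al n) w - E (al n) z - G b (w - z) by rewrite clinB; module_ring.
    exact: EG.
  have -> : E (al n) z - G b z - (f b - G b b) = E (al n) z - E (al n) b - G b (z - b).
    have Eb : E (al n) b = f b by exact: (EP _ Aa).2.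
    by rewrite clinB Eb; module_ring.
  by rewrite (le_trans (EG _ Aa Ba _ _ _ _))// ler_wpM2l// ltW.
rewrite ler_wpM2r// -e1E mulr2n lerD2l /et -mulr_suml mulrCA ler_piMr//.
by rewrite ler_pdivrMr// mul1r lerDl.
Unshelve. all: by end_near. Qed.

End strict_extension.

(** * The strict jet on the closure of [U] *)

Section closure_jet.
Context {R : realType}.
Implicit Types X Y : normedModType R.

Fixpoint polygon_length X (gamma : R -> X) (a : R) (s : seq R) : R :=
  if s is t :: s' then `|gamma t - gamma a| + polygon_length gamma t s' else 0.

Lemma polygon_lengthE X (gamma : R -> X) a b s :
  \sum_(0 <= i < size s) `|gamma (nth b (a :: s) i.+1) - gamma (nth b (a :: s) i)| =
  polygon_length gamma a s.
Proof.
elim: s a => [|t s IH] a /=; first by rewrite big_geq.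
by rewrite big_nat_recl//= -IH.
Qed.

Lemma polygon_length_rcons X (gamma : R -> X) a s t :
  polygon_length gamma a (rcons s t) =
  polygon_length gamma a s + `|gamma t - gamma (last a s)|.
Proof. by elim: s a => [|u s IH] a /=; [rewrite addrC|rewrite IH addrA]. Qed.

Lemma curve_length_ge X (gamma : R -> X) a b B s :
  (curve_length a b gamma <= B%:E)%E -> itv_partition a b s ->
  polygon_length gamma a s <= B.
Proof.
move=> lB sp; rewrite -lee_fin; apply: le_trans lB.
by apply: ereal_sup_ubound; exists s => //; rewrite polygon_lengthE.
Qed.

Lemma curve_length_dist X (gamma : R -> X) B t :
  (curve_length 0 1 gamma <= B%:E)%E -> 0 <= t -> t <= 1 -> `|gamma t - gamma 0| <= B.
Proof.
move=> lB t0 t1; have [->|tn1] := eqVneq t 1.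
  have : itv_partition (0 : R) 1 [:: 1] by exact: itv_partition1.
  by move=> /(curve_length_ge lB) /=; rewrite addr0.
have t_lt1 : t < 1 by rewrite lt_neqAle tn1.
have [->|tn0] := eqVneq t 0.
  have : itv_partition (0 : R) 1 [:: 1] by exact: itv_partition1.
  by rewrite subrr normr0 => /(curve_length_ge lB) /=; rewrite addr0; apply: le_trans.
have t_gt0 : 0 < t by rewrite lt_neqAle eq_sym tn0.
have /(curve_length_ge lB) /= : itv_partition (0 : R) 1 [:: t; 1].
  by split => //=; rewrite t_gt0 t_lt1.
by apply: le_trans; rewrite lerDl addr0.
Qed.

(** The invariant carries a partition of [0, t] whose polygon bounds the increment of [h]. Polygons
    grow by one edge per step, so lengths of subarcs never occur; only the last polygon is compared
    with the curve. *)
Lemma curve_mean_value X Y (h : X -> Y) (gamma : R -> X) (e B : R) : 0 <= e ->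
  {within `[0, 1], continuous gamma} ->
  (forall t, 0 <= t -> t <= 1 -> plip h (gamma t) e) ->
  (curve_length 0 1 gamma <= B%:E)%E ->
  `|h (gamma 1) - h (gamma 0)| <= e * B.
Proof.
move=> e0 gc hp lB.
pose P t := exists s, [/\ path <%O 0 s, last 0 s = t &
  `|h (gamma t) - h (gamma 0)| <= e * polygon_length gamma 0 s].
suff [s [sp s1 hs]] : P 1.
  rewrite (le_trans hs)// ler_wpM2l//; apply: (curve_length_ge lB).
  by split => //; rewrite s1.
apply: unit_interval_induction.
  by exists [::]; rewrite /= subrr normr0 mulr0.
move=> t t0 t1.
have t01 : `[0, 1]%classic t by rewrite /= in_itv/= t0 t1.
have /near_ball_dist[d d0 hd] := hp t t0 t1.
have /cvgrPdist_lt/(_ d d0) := ((subspace_continuousP _ _).1 gc) t t01.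
rewrite near_withinE => /nbhs_ballP[r /= r0 hr].
have step u v : 0 <= u -> u < v -> v <= 1 -> t - r < u -> v < t + r -> u = t \/ v = t ->
    P u -> P v.
  move=> u0 uv v1 ru vr utv [s [sp su hs]]; exists (rcons s v); split.
  - by rewrite rcons_path sp su.
  - by rewrite last_rcons.
  - rewrite polygon_length_rcons su mulrDr.
    have -> : h (gamma v) - h (gamma 0) =
        (h (gamma u) - h (gamma 0)) + (h (gamma v) - h (gamma u)) by module_ring.
    rewrite (le_trans (ler_normD _ _))// lerD//.
    have [ut|vt] := utv; rewrite ?ut ?vt.
      apply: hd; rewrite distrC; apply: hr.
        by rewrite /ball/= -ut ltr_norml; apply/andP; split; lra.
      by rewrite /= in_itv/= v1 andbT (le_trans u0)// ltW.
    rewrite distrC (distrC (gamma t)); apply: hd; rewrite distrC; apply: hr.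
      by rewrite /ball/= -vt ltr_norml; apply/andP; split; lra.
    by rewrite /= in_itv/= u0/= (le_trans (ltW uv)).
exists r => // s s' s0 st ts' s'1 rs s'r Ps.
have Pt : P t.
  have [<-//|nst] := eqVneq s t.
  have lt_st : s < t by rewrite lt_neqAle nst.
  by apply: (step s) => //; [lra|right].
have [<-//|nts] := eqVneq t s'.
have lt_ts : t < s' by rewrite lt_neqAle nts.
by apply: (step t) => //; [lra|left].
Qed.

Lemma closure_dist X (U : set X) (x : X) e : closure U x -> 0 < e ->
  exists2 y, U y & `|y - x| < e.
Proof.
move=> /(_ (ball x e) (nbhsx_ballx _ _ _)) cl e0.
have [y [Uy /ball_center_dist yx]] := cl e0.
by exists y.
Qed.

(** Points of the closure are approximated from [U], inside [V] since [V] is open; the global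
    Lipschitz bound of [F] controls the change on both sides. *)
Lemma near_affine_closure X Y (F : X -> Y) (U V : set X) (T : clin X Y) e M :
  (forall x y, `|F x - F y| <= M * `|x - y|) -> 0 <= e -> open V ->
  near_affine F (U `&` V) T e -> near_affine F (closure U `&` V) T e.
Proof.
move=> FM e0 oV h x y [Ux Vx] [Uy Vy]; apply/ler_addgt0Pr => eta eta0.
pose N := `|M| + `|T| + e + 1.
have N0 : 0 < N by rewrite ltr_wpDl// !addr_ge0.
have approx z : closure U z -> V z -> exists z', (U `&` V) z' /\ `|z' - z| <= eta / 2 / N.
  move=> Uz Vz; have /near_ball_dist[d d0 hd] := open_near oV Vz (fun y Vy => Vy).
  have m0 : 0 < Num.min d (eta / 2 / N) by rewrite lt_min d0 !divr_gt0.
  have [z' Uz'] := closure_dist Uz m0; rewrite lt_min => /andP[z'd z'e].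
  by exists z'; split; [split => //; exact: hd|exact: ltW].
have [x' [UVx' xx']] := approx x Ux Vx; have [y' [UVy' yy']] := approx y Uy Vy.
have := h _ _ UVx' UVy' => hxy.
pose v := (y' - y) - (x' - x).
have vle : `|v| <= eta / N.
  rewrite (le_trans (ler_normB _ _))// (le_trans (lerD yy' xx'))//.
  by rewrite -mulrDl -splitr.
have -> : F x - F y - T (x - y) =
    (F x' - F y' - T (x' - y')) - (F x' - F x) + (F y' - F y) - T v.
  by rewrite /v !clinB; module_ring.
rewrite (le_trans (ler_normB _ _))//.
rewrite (@le_trans _ _ (e * (`|x - y| + eta / N) + `|M| * (eta / 2 / N) + `|M| * (eta / 2 / N) + `|T| * (eta / N)))//.
  rewrite lerD//; last by rewrite (le_trans (clin_le _ _))// ler_wpM2l.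
  have FM' a b : `|a - b| <= eta / 2 / N -> `|F a - F b| <= `|M| * (eta / 2 / N).
    move=> ab; rewrite (le_trans (FM _ _))// (@le_trans _ _ (`|M| * `|a - b|))//.
      by rewrite ler_wpM2r// ler_norm.
    by rewrite ler_wpM2l.
  rewrite (le_trans (ler_normD _ _))// lerD ?FM'//.
  rewrite (le_trans (ler_normB _ _))// lerD ?FM'//.
  rewrite (le_trans hxy)// ler_wpM2l//.
  have -> : x' - y' = (x - y) - v by rewrite /v; module_ring.
  by rewrite (le_trans (ler_normB _ _))// lerD2l.
have -> : e * (`|x - y| + eta / N) + `|M| * (eta / 2 / N) + `|M| * (eta / 2 / N) + `|T| * (eta / N)
  = e * `|x - y| + (`|M| + `|T| + e) * (eta / N) by field; rewrite gt_eqF.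
rewrite lerD2l mulrCA ger_pMr// ler_pdivrMr// mul1r /N; lra.
Qed.

(** [F] is a Lipschitz extension of [f] and supplies the boundary values. At points of [U] the mean
    value inequality on a ball is enough; at boundary points the curves of (WQ) replace segments. *)
Lemma WQ_strict_jet X Y (U : set X) (f F : X -> Y) (G : X -> clin X Y) M :
  open U -> property_WQ U -> (forall x, U x -> is_fd f x (G x)) ->
  {within closure U, continuous G} -> (forall x, U x -> F x = f x) ->
  (forall x y, `|F x - F y| <= M * `|x - y|) -> strict_jet (closure U) F G.
Proof.
move=> oU WQ fG Gc Ff FM b e Ub e0.
have Gnear d : 0 < d -> exists2 r, 0 < r & forall y, closure U y -> `|y - b| < r -> `|G y - G b| <= d.
  move=> d0; have /cvgrPdist_le/(_ d d0) := ((subspace_continuousP _ _).1 Gc) b Ub.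
  rewrite near_withinE => /nbhs_ballP[r /= r0 hr]; exists r => // y Uy yb.
  by rewrite distrC; apply: hr => //; exact/ball_center_dist.
have FG x : U x -> is_fd F x (G x).
  move=> Ux; apply: is_fd_near (fG x Ux).
  by apply: open_near oU Ux _ => y Uy; rewrite Ff.
suff [d d0 hd] : exists2 d, 0 < d & near_affine F (U `&` ball b d) (G b) e.
  have [r r0 hr] := Gnear e e0.
  exists (Num.min d r); first by rewrite lt_min d0.
  split; last first.
    move=> y Uy /ball_center_dist; rewrite lt_min => /andP[_ yr]; exact: hr.
  apply: (@near_affineW _ _ _ _ _ (closure U `&` ball b d)).
    by apply: setIS; apply: le_ball; rewrite ge_min lexx.
  by apply: near_affine_closure FM (ltW e0) _ hd; exact: ball_open.
have [Ib|nIb] := pselect (U b).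
  have [r r0 hr] := Gnear e e0.
  have /near_ball_dist[s s0 hs] := open_near oU Ib (fun y Uy => Uy).
  exists (Num.min r s); first by rewrite lt_min r0.
  move=> x y [_ Bx] [_ By].
  apply: (@is_fd_lip _ _ _ (ball b (Num.min r s)) F G (G b) e) => //.
    exact: ball_segment_closed.
  move=> z /ball_center_dist; rewrite lt_min => /andP[zr zs].
  split; first by apply: FG; exact: hs.
  by apply: hr => //; apply: subset_closure; exact: hs.
have [|r [c [r0 c1 hrc]]] := WQ b.
  by split => //; rewrite ((interior_id U).1 oU).
have c0 : 0 < c by exact: lt_le_trans ltr01 c1.
(* The curve may be longer than the distance by the factor [c], so the one-centre constant along it
   is [e / c]: half for the oscillation of [G], half for the slack of [is_fd_plip]. *)
have ec0 : 0 < e / c / 2 by rewrite !divr_gt0.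
have [rho rho0 hrho] := Gnear _ ec0.
have c20 : 0 < 1 + 2 * c by rewrite addr_gt0// mulr_gt0.
(* A curve with ends in [ball b d] has length below [2 * c * d], so it stays within
   [(1 + 2 * c) * d] of [b]. *)
pose d := Num.min r (rho / (1 + 2 * c)).
have d0 : 0 < d by rewrite lt_min r0 divr_gt0.
have drho : (1 + 2 * c) * d <= rho.
  by rewrite mulrC -ler_pdivlMr// ge_min lexx orbT.
exists d => // x y [Ux Bx] [Uy By].
have Br z : ball b d z -> ball b r z by apply: le_ball; rewrite ge_min lexx.
have [gamma [gc gU g0 g1 gl]] := hrc y x (conj Uy (Br _ By)) (conj Ux (Br _ Bx)).
move/ball_center_dist in Bx; move/ball_center_dist in By.
have yx : `|y - x| < 2 * d.
  have -> : y - x = (y - b) - (x - b) by module_ring.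
  rewrite (le_lt_trans (ler_normB _ _))//; lra.
have gb t : 0 <= t -> t <= 1 -> `|gamma t - b| < rho.
  move=> t0 t1; have := curve_length_dist gl t0 t1; rewrite g0 => gy.
  apply: lt_le_trans drho.
  have -> : gamma t - b = (gamma t - y) + (y - b) by module_ring.
  rewrite (le_lt_trans (ler_normD _ _))//.
  have : c * `|y - x| < c * (2 * d) by rewrite ltr_pM2l.
  lra.
have gp t : 0 <= t -> t <= 1 -> plip (fun z => F z - G b z) (gamma t) (e / c).
  move=> t0 t1; rewrite [e / c]splitr.
  have Ug : U (gamma t) by apply: gU; rewrite in_itv/= t0.
  apply: (is_fd_plip ec0 (FG _ Ug)).
  by apply: hrho; [exact: subset_closure|exact: gb].
have := curve_mean_value (ltW (divr_gt0 e0 c0)) gc gp gl.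
rewrite g0 g1 mulrA divfK ?gt_eqF// (distrC y).
by have -> : F x - G b x - (F y - G b y) = F x - F y - G b (x - y) by rewrite clinB; module_ring.
Qed.

Lemma closure_jet_norm X Y (U : set X) (f F : X -> Y) (G : X -> clin X Y) L :
  open U -> 0 <= L -> (forall x, U x -> is_fd f x (G x)) ->
  (forall x y, U x -> U y -> `|f x - f y| <= L * `|x - y|) ->
  strict_jet (closure U) F G -> forall b, closure U b -> `|G b| <= L.
Proof.
move=> oU L0 fG fL FG b Ub; apply/ler_addgt0Pr => e e0.
have [d d0 [_ hd]] := FG b e Ub e0.
have [y Uy yb] := closure_dist Ub d0.
have -> : G b = (G y - 0) - (G y - G b) by module_ring.
rewrite (le_trans (ler_normB _ _))// lerD//; last first.
  by apply: hd; [exact: subset_closure|exact/ball_center_dist].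
apply: (plip_norm_le L0 (fG y Uy)); apply: (open_near oU Uy) => z Uz.
by rewrite !clin0E !subr0; exact: fL.
Qed.

End closure_jet.

(** * Interpolation between extensions of decreasing error *)

Section strict_interpolation.
Context {R : realType} {X Y : normedModType R}.

(** The increment is the average of two increments with weights frozen at [z], plus the increment of
    [tau] times [P w - Q w]. A piece of weight 0 at [z] is free in the first part, hence the
    disjunctions. *)
Lemma mix_plip (P Q : X -> Y) (tau : X -> R) (T : clin X Y) z c kappa :
  0 <= tau z <= 1 ->
  (tau z = 0 \/ plip (fun x => P x - T x) z c) ->
  (tau z = 1 \/ plip (fun x => Q x - T x) z c) ->
  (\forall w \near z, `|tau w - tau z| * `|P w - Q w| <= kappa * `|w - z|) ->
  plip (fun x => tau x *: P x + (1 - tau x) *: Q x - T x) z (c + kappa).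
Proof.
move=> /andP[t0 t1] hP hQ hPQ.
have part (r : R) (F : X -> Y) : 0 <= r -> (r = 0 \/ plip (fun x => F x - T x) z c) ->
    \forall w \near z, `|r *: (F w - T w - (F z - T z))| <= r * (c * `|w - z|).
  move=> r0 [->|Fp]; first by apply: nearW => w; rewrite scale0r normr0 mul0r.
  by apply: filterS Fp => w h; rewrite normrZ ger0_norm// ler_wpM2l.
have nP := part (tau z) P t0 hP.
have nQ : \forall w \near z, `|(1 - tau z) *: (Q w - T w - (Q z - T z))| <= (1 - tau z) * (c * `|w - z|).
  by apply: part; [rewrite subr_ge0|case: hQ => [->|?]; [left; rewrite subrr|right]].
near=> w.
have -> : tau w *: P w + (1 - tau w) *: Q w - T w - (tau z *: P z + (1 - tau z) *: Q z - T z) =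
  tau z *: (P w - T w - (P z - T z)) + (1 - tau z) *: (Q w - T w - (Q z - T z)) +
  (tau w - tau z) *: (P w - Q w) by module_ring.
rewrite (le_trans (ler_normD _ _))// mulrDl lerD//; last by rewrite normrZ; near: w.
rewrite (le_trans (ler_normD _ _))//.
have -> : c * `|w - z| = tau z * (c * `|w - z|) + (1 - tau z) * (c * `|w - z|) by ring.
by rewrite lerD//; near: w.
Unshelve. all: by end_near. Qed.

Lemma near_affine_plip (F : X -> Y) (V : set X) T z c : open V -> V z ->
  near_affine F V T c -> plip (fun x => F x - T x) z c.
Proof.
move=> oV Vz h; apply: (open_near oV Vz) => w Vw.
have -> : F w - T w - (F z - T z) = F w - F z - T (w - z) by rewrite clinB; module_ring.
exact: h.
Qed.

Lemma plip_near_eq (F F' : X -> Y) T z c : (\forall w \near z, F w = F' w) ->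
  plip (fun x => F x - T x) z c -> plip (fun x => F' x - T x) z c.
Proof.
move=> FF'; have Fz := nbhs_singleton FF'.
by apply: filterS2 FF' => w <-; rewrite -Fz.
Qed.

Lemma plip_le (F : X -> Y) z c c' : c <= c' -> plip F z c -> plip F z c'.
Proof. by move=> cc'; apply: filterS => w h; rewrite (le_trans h)// ler_wpM2r. Qed.

(* [Fs n] is [eps n]-affine around every point of [A]; [Vs n] shrinks to [A]
   and around it [Fs n] is replaced by [Fs n.+1]. *)
Context (A : set X) (F0 : X -> Y) (G : X -> clin X Y) (Fs : nat -> X -> Y) (eps : nat -> R).
Context (cA : closed A) (Fs0 : Fs 0%N = F0) (FsA : forall n x, A x -> Fs n x = F0 x).
Context (eps_gt0 : forall n, 0 < eps n).
Context (Fs_affine : forall n b, A b ->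
  exists2 d, 0 < d & near_affine (Fs n) (ball b d) (G b) (eps n)).

(** The quarter radius leaves room: an almost nearest point of [A] still lies in [ball b d], and the
    two maps are compared through it. The bound on [d] makes these sets shrink to [A]. *)
Definition good n := [set z | exists b d, [/\ A b, 0 < d, d < 2^-1 ^+ n, `|z - b| < d / 4 &
  near_affine (Fs n) (ball b d) (G b) (eps n) /\
  near_affine (Fs n.+1) (ball b d) (G b) (eps n.+1)]].

(** The added condition makes [tau n'] vanish on [Vs n'.+1]: one change of map is complete before
    the next begins. *)
Fixpoint Vs n : set X := if n is n'.+1
  then good n'.+1 `&` [set z | tdist A z < tdist (~` Vs n') z] else good 0.

(* [d / (d + rho)] varies at rate at most [1 / d], where [d] is the distance to
   [A]; as [Fs n] and [Fs n.+1] differ by [O(d)], interpolating between them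
   costs a bounded slope. *)
Definition tau n z : R :=
  Num.max 0 (2 * (tdist A z / (tdist A z + tdist (~` Vs n) z)) - 1).

Fixpoint Hs n (z : X) : Y := if n is n'.+1
  then tau n' z *: Hs n' z + (1 - tau n' z) *: Fs n'.+1 z else F0 z.

(** Off [A] the sequence [Hs n z] is constant from the first [n] with [z] outside [Vs n]. On [A]
    there is no such [n], and the default index 0 yields the right value [F0 z]. *)
Definition interpolation z := Hs (xget 0%N [set N | ~ Vs N z]) z.

Lemma Vs_good n : Vs n `<=` good n.
Proof. by case: n => // n z []. Qed.

Lemma good_open n : open (good n).
Proof.
rewrite openE => z [b [d [Ab d0 dn zb h]]].
have r0 : 0 < d / 4 - `|z - b| by rewrite subr_gt0.
apply: filterS (near_dist z r0) => w wz; exists b, d; split => //.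
have -> : w - b = (w - z) + (z - b) by module_ring.
by rewrite (le_lt_trans (ler_normD _ _))// -ltrBrDr.
Qed.

Lemma good_A n : A `<=` good n.
Proof.
move=> b Ab; have [d d0 h] := Fs_affine n Ab; have [d' d'0 h'] := Fs_affine n.+1 Ab.
pose m := Num.min (Num.min d d') (2^-1 ^+ n / 2).
have n0 : 0 < 2^-1 ^+ n :> R by rewrite exprn_gt0.
have m0 : 0 < m by rewrite !lt_min d0 d'0 divr_gt0.
have md : m <= d by rewrite !ge_min lexx.
have md' : m <= d' by rewrite !ge_min lexx !orbT.
have mn : m <= 2^-1 ^+ n / 2 by rewrite !ge_min lexx !orbT.
exists b, m; split => //; [lra|by rewrite subrr normr0 divr_gt0|split].
  by apply: near_affineW h; exact: le_ball.
by apply: near_affineW h'; exact: le_ball.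
Qed.

Lemma Vs_open_A n : open (Vs n) /\ A `<=` Vs n.
Proof.
elim: n => [|n [oV AV]] /=; first by split; [exact: good_open|exact: good_A].
split.
  apply: openI; first exact: good_open.
  rewrite openE => z /= zA; have r0 : 0 < (tdist (~` Vs n) z - tdist A z) / 2.
    by rewrite divr_gt0// subr_gt0.
  apply: filterS (near_dist z r0) => w wz /=.
  have := tdist_lip A w z; have := tdist_lip (~` Vs n) w z.
  rewrite !ler_norml => /andP[h1 _] /andP[_ h2]; lra.
move=> x Ax; split; first exact: good_A.
rewrite /= tdist_eq0//; apply: tdist_gt0; first exact: open_closedC.
by apply; exact: AV.
Qed.

Lemma Vs_S n : Vs n.+1 `<=` Vs n.
Proof.
move=> z [_ /= zA]; apply: contrapT => nV; move: zA.
by rewrite (@tdist_eq0 _ _ (~` Vs n))// ltNge tdist_ge0.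
Qed.

Lemma Vs_le m n : (m <= n)%N -> Vs n `<=` Vs m.
Proof.
move=> /subnK<-; elim: (n - m)%N => [|k IH]; first by [].
by rewrite addSn => z /Vs_S; exact: IH.
Qed.

Lemma Vs_tdist n z : Vs n z -> tdist A z < 2^-1 ^+ n.
Proof.
move=> /Vs_good[b [d [Ab d0 dn zb _]]].
by rewrite (le_lt_trans (tdist_le _ Ab))// (lt_trans zb)// (lt_trans _ dn)//; lra.
Qed.

Lemma pow_half_lt (e : R) : 0 < e -> exists n, forall m, (n <= m)%N -> 2^-1 ^+ m < e.
Proof.
move=> e0; exists (Num.truncn e^-1) => m nm.
have en : e^-1 < m.+1%:R.
  by rewrite (lt_le_trans (truncnS_gt _))// ler_nat.
rewrite exprVn invf_plt ?posrE ?exprn_gt0// (lt_le_trans en)//.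
by rewrite -natrX ler_nat ltn_expl.
Qed.

Lemma Vs_exit z : ~ A z -> exists N, ~ Vs N z /\ forall j, (j < N)%N -> Vs j z.
Proof.
move=> nAz; have [n hn] := pow_half_lt (tdist_gt0 cA nAz).
have nV : exists n, `[< ~ Vs n z >].
  exists n; apply/asboolP => /Vs_tdist; rewrite ltNge => /negP; apply.
  by rewrite ltW// hn.
case: (ex_minnP nV) => N /asboolP nVN minN; exists N; split => // j jN.
apply: contrapT => /asboolP/minN; by rewrite leqNgt jN.
Qed.

Lemma tau01 n z : 0 <= tau n z <= 1.
Proof.
rewrite /tau le_max lexx/= ge_max ler01/=.
suff : tdist A z / (tdist A z + tdist (~` Vs n) z) <= 1 by lra.
have [S0|Sn0] := eqVneq (tdist A z + tdist (~` Vs n) z) 0.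
  by rewrite S0 invr0 mulr0.
have S_gt0 : 0 < tdist A z + tdist (~` Vs n) z.
  by rewrite lt_neqAle eq_sym Sn0/= addr_ge0// tdist_ge0.
by rewrite ler_pdivrMr// mul1r lerDl tdist_ge0.
Qed.

Lemma tau_out n z : ~ Vs n z -> tau n z = 1.
Proof.
move=> nV; have nAz : ~ A z by move=> /(Vs_open_A n).2.
rewrite /tau (@tdist_eq0 _ _ (~` Vs n))// addr0 divff ?gt_eqF ?tdist_gt0//.
by rewrite max_r; lra.
Qed.

Lemma tau_in n z : tdist A z <= tdist (~` Vs n) z -> tau n z = 0.
Proof.
move=> h; rewrite /tau max_l// subr_le0.
have [S0|Sn0] := eqVneq (tdist A z + tdist (~` Vs n) z) 0.
  by rewrite S0 invr0 !mulr0.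
have S_gt0 : 0 < tdist A z + tdist (~` Vs n) z.
  by rewrite lt_neqAle eq_sym Sn0/= addr_ge0// tdist_ge0.
by rewrite mulrA ler_pdivrMr// mul1r; lra.
Qed.

(** The slope of [tau] may blow up at [A], but weighted with the distance to [A] it is at most 2:
    the quotient inside [tau] contributes 1, its coefficient the factor 2. *)
Lemma tau_lip n z w : `|tau n w - tau n z| * tdist A w <= 2 * `|w - z|.
Proof.
have S_gt0 x : 0 < tdist A x + tdist (~` Vs n) x.
  have [Ax|nAx] := pselect (A x).
    rewrite ltr_wpDl ?tdist_ge0// tdist_gt0//.
      by apply: open_closedC; exact: (Vs_open_A n).1.
    by apply; exact: (Vs_open_A n).2.
  by rewrite ltr_pwDl ?tdist_ge0// tdist_gt0.
set dw := tdist A w; set dz := tdist A z.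
set rw := tdist (~` Vs n) w; set rz := tdist (~` Vs n) z.
have Sw := S_gt0 w; have Sz := S_gt0 z; rewrite -/dw -/rw in Sw; rewrite -/dz -/rz in Sz.
have dw0 : 0 <= dw by exact: tdist_ge0.
have dz0 : 0 <= dz by exact: tdist_ge0.
have rw0 : 0 <= rw by exact: tdist_ge0.
have rz0 : 0 <= rz by exact: tdist_ge0.
have max_lip (a b : R) : `|Num.max 0 a - Num.max 0 b| <= `|a - b|.
  have [a0|a0] := leP 0 a; have [b0|b0] := leP 0 b => //.
  - by rewrite subr0 ger0_norm// (le_trans _ (ler_norm _))//; lra.
  - by rewrite sub0r normrN ger0_norm// distrC (le_trans _ (ler_norm _))//; lra.
  - by rewrite subrr normr0.
have q : `|dw / (dw + rw) - dz / (dz + rz)| * (dw + rw) <= `|w - z|.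
  have -> : dw / (dw + rw) - dz / (dz + rz) =
     ((dw - dz) * rz + dz * (rz - rw)) / (dz + rz) / (dw + rw).
    by field; rewrite !gt_eqF.
  rewrite normrM normfV (gtr0_norm Sw) divfK ?gt_eqF// normrM normfV (gtr0_norm Sz).
  rewrite ler_pdivrMr// (le_trans (ler_normD _ _))// !normrM (ger0_norm rz0) (ger0_norm dz0).
  rewrite [leRHS]mulrDr addrC [X in X + _]mulrC lerD// ler_wpM2r//.
    by rewrite distrC; exact: tdist_lip.
  exact: tdist_lip.
rewrite (@le_trans _ _ (`|(2 * (dw / (dw + rw)) - 1) - (2 * (dz / (dz + rz)) - 1)| * dw))//.
  by rewrite ler_wpM2r//; exact: max_lip.
have -> : 2 * (dw / (dw + rw)) - 1 - (2 * (dz / (dz + rz)) - 1) =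
  2 * (dw / (dw + rw) - dz / (dz + rz)) by ring.
rewrite normrM ger0_norm// -mulrA ler_wpM2l// (le_trans _ q)// ler_wpM2l//.
by rewrite lerDl.
Qed.

(** Both maps equal [F0] on [A] and have increments close to those of the same [G b]; comparison
    through an almost nearest point of [A] leaves only the two errors. *)
Lemma Fs_diff n w : good n w -> `|Fs n w - Fs n.+1 w| <= (eps n + eps n.+1) * tdist A w.
Proof.
move=> [b [d [Ab d0 dn wb [h h']]]].
apply/ler_addgt0Pr => e e0.
have E0 : 0 < eps n + eps n.+1 by rewrite addr_gt0.
(* The bound [d / 4] keeps [a] in [ball b d], and [tdist A w + eta] below the truncation level 1. *)
pose eta := Num.min (d / 4) (e / (eps n + eps n.+1)).
have eta0 : 0 < eta by rewrite lt_min !divr_gt0.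
have eta_d : eta <= d / 4 by rewrite ge_min lexx.
have eta_e : (eps n + eps n.+1) * eta <= e.
  by rewrite mulrC -ler_pdivlMr// ge_min lexx orbT.
have d1 : d < 1 by rewrite (lt_le_trans dn)// exprn_ile1//; lra.
have tA : tdist A w < d / 4 by rewrite (le_lt_trans (tdist_le _ Ab)).
have [||a Aa wa] := @tdist_lt R X A w (tdist A w + eta); [by rewrite ltrDl|lra|].
have Ba : ball b d a.
  apply/ball_center_dist; have -> : a - b = - (w - a) + (w - b) by module_ring.
  by rewrite (le_lt_trans (ler_normD _ _))// normrN; lra.
have Bw : ball b d w by apply/ball_center_dist; lra.
have -> : Fs n w - Fs n.+1 w = (Fs n w - Fs n a - G b (w - a)) -
   (Fs n.+1 w - Fs n.+1 a - G b (w - a)) by rewrite (FsA n Aa) (FsA n.+1 Aa); module_ring.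
rewrite (le_trans (ler_normB _ _))// (le_trans (lerD (h _ _ Bw Ba) (h' _ _ Bw Ba)))//.
rewrite -mulrDl (@le_trans _ _ ((eps n + eps n.+1) * (tdist A w + eta)))//.
  by rewrite ler_wpM2l// ltW.
by rewrite mulrDr lerD2l.
Qed.

Lemma Hs_in n w : (if n is n'.+1 then Vs n' w /\ tdist A w <= tdist (~` Vs n') w else True) ->
  Hs n w = Fs n w.
Proof.
case: n => [|n] /=; first by rewrite Fs0.
by move=> [_ h]; rewrite tau_in// scale0r add0r subr0 scale1r.
Qed.

Lemma Hs_Vs n w : Vs n w -> Hs n w = Fs n w.
Proof.
case: n => [|n] Vw; apply: Hs_in => //; split; first exact: Vs_S.
by case: Vw => _ /ltW.
Qed.

Lemma Hs_out N m w : ~ Vs N w -> (N <= m)%N -> Hs m w = Hs N w.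
Proof.
move=> nV /subnK<-; elim: (m - N)%N => [//|k IH]; rewrite addSn /=.
have nVk : ~ Vs (k + N) w by move=> /(Vs_le (leq_addl k N)).
by rewrite tau_out// subrr scale0r addr0 scale1r.
Qed.

Lemma interpolationE N w : ~ Vs N w -> interpolation w = Hs N w.
Proof.
move=> nV; rewrite /interpolation; set M := xget _ _.
have nM : ~ Vs M w by apply: (@xgetPex _ 0%N [set N | ~ Vs N w]); exists N.
have [MN|/ltnW NM] := leqP M N; first by rewrite (Hs_out nM MN).
by rewrite (Hs_out nV NM).
Qed.

Lemma interpolationA w : A w -> interpolation w = F0 w.
Proof.
move=> Aw; rewrite /interpolation xgetPN// => N /=; apply.
exact: (Vs_open_A N).2.
Qed.

Lemma tau_diff n z : \forall w \near z, Vs n w ->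
  `|tau n w - tau n z| * `|Fs n w - Fs n.+1 w| <= 2 * (eps n + eps n.+1) * `|w - z|.
Proof.
apply: nearW => w /Vs_good/Fs_diff h.
rewrite (@le_trans _ _ (`|tau n w - tau n z| * ((eps n + eps n.+1) * tdist A w)))//.
  by rewrite ler_wpM2l.
rewrite mulrCA [leRHS]mulrAC [leRHS]mulrC ler_wpM2l ?tau_lip//.
by rewrite addr_ge0// ltW.
Qed.

(** Two changes can be felt near [z]: from [Fs N.-1] to [Fs N] and, as [z] may lie on the boundary
    of [Vs N], from [Fs N] to [Fs N.+1]. Each adds the slope from [tau_diff]. *)
Lemma interpolation_plip z N (T : clin X Y) c : ~ Vs N z -> (forall j, (j < N)%N -> Vs j z) ->
  plip (fun x => Fs N.-1 x - T x) z c ->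
  ((0 < N)%N -> plip (fun x => Fs N x - T x) z c) ->
  plip (fun x => interpolation x - T x) z
    (c + (if N is N'.+1 then 2 * (eps N' + eps N) else 0) + 2 * (eps N + eps N.+1)).
Proof.
move=> nV VN hN1 hN.
have nAz : ~ A z by move=> /(Vs_open_A N).2.
have HN : plip (fun x => Hs N x - T x) z
    (c + (if N is N'.+1 then 2 * (eps N' + eps N) else 0)).
  case: N nV VN hN1 hN => [|N] nV VN hN1 hN.
    by rewrite addr0; move: hN1; rewrite Fs0.
  have Vz : Vs N z by exact: VN.
  have [oV _] := Vs_open_A N.
  apply: (@plip_near_eq (fun x => tau N x *: Fs N x + (1 - tau N x) *: Fs N.+1 x)).
    by apply: (open_near oV Vz) => w Vw /=; rewrite Hs_Vs.
  refine (@mix_plip (Fs N) (Fs N.+1) (tau N) T z c _ (tau01 _ _) (or_intror hN1)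
    (or_intror (hN isT)) _).
  have := tau_diff N z; apply: filterS2 (open_near oV Vz (fun w Vw => Vw)).
  by move=> w Vw; apply.
(* Since [z] has distance 0 to the complement of [Vs N] but not to [A], nearby points lie outside
   [Vs N.+1], where the interpolation is [Hs N.+1]. *)
apply: (@plip_near_eq (Hs N.+1)).
  have lt : tdist (~` Vs N) z < tdist A z.
    by rewrite (@tdist_eq0 _ _ (~` Vs N))// tdist_gt0.
  have r0 : 0 < (tdist A z - tdist (~` Vs N) z) / 2 by rewrite divr_gt0// subr_gt0.
  apply: filterS (near_dist z r0) => w wz; rewrite (@interpolationE N.+1)// => -[_ /=].
  have := tdist_lip A w z; have := tdist_lip (~` Vs N) w z.
  rewrite !ler_norml => /andP[_ h1] /andP[h2 _]; lra.
refine (@mix_plip (Hs N) (Fs N.+1) (tau N) T z _ _ (tau01 _ _) (or_intror HN)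
  (or_introl (tau_out nV)) _).
have := tau_diff N z; apply: filterS => w h.
have [Vw|nVw] := pselect (Vs N w); first by rewrite Hs_Vs//; exact: h.
by rewrite !tau_out// subrr normr0 mul0r !mulr_ge0// addr_ge0// ltW.
Qed.

Lemma good_plip n z b d : ball b d z -> near_affine (Fs n) (ball b d) (G b) (eps n) ->
  forall T e, `|G b - T| <= e -> plip (fun x => Fs n x - T x) z (eps n + e).
Proof.
move=> Bz h T e GT; apply: (near_affine_plip (ball_open b d) Bz).
exact: near_affine_shift h GT.
Qed.

Lemma interpolation_strict : strict_jet A F0 G ->
  (forall e, 0 < e -> exists n, forall m, (n <= m)%N -> eps m <= e) ->
  forall b e, A b -> 0 < e -> exists2 d, 0 < d & near_affine interpolation (ball b d) (G b) e.
Proof.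
move=> jet eps0 b e Ab e0.
(* Off [A] the total is [10 * e1]: [2 * e1] for each [Fs j] relative to [G b], and [4 * e1] for each
   of two changes. At points of [A] it is at most [7 * e1]. *)
have e10 : 0 < e / 10 by rewrite divr_gt0.
set e1 := e / 10 in e10.
have [d1 d10 [hd1 Gd1]] := jet b e1 Ab e10.
have [m1 hm1] := eps0 e1 e10.
have [m2 hm2] : exists n, forall m, (n <= m)%N -> 2^-1 ^+ m < d1 / 2.
  by apply: pow_half_lt; rewrite divr_gt0.
pose m := maxn m1 m2.
have epsm j : (m <= j)%N -> eps j <= e1.
  by move=> mj; apply: hm1; apply: leq_trans mj; exact: leq_maxl.
have powm j : (m <= j)%N -> 2^-1 ^+ j < d1 / 2.
  by move=> mj; apply: hm2; apply: leq_trans mj; exact: leq_maxr.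
have [oV AV] := Vs_open_A m.
have /near_ball_dist[r r0 hr] := open_near oV (AV b Ab) (fun w Vw => Vw).
(* Together with [d' < d1 / 2] this keeps the auxiliary points [b'] and [a] of [A] in
   [ball b d1]. *)
pose d := Num.min r (d1 / 4).
have d0 : 0 < d by rewrite lt_min r0 divr_gt0.
have dr : d <= r by rewrite ge_min lexx.
have dd1 : d <= d1 / 4 by rewrite ge_min lexx orbT.
have VB w : ball b d w -> Vs m w.
  by move=> /ball_center_dist wb; apply: hr; exact: lt_le_trans wb dr.
have exitB w : ball b d w -> ~ A w -> exists N, [/\ (m <= N)%N, ~ Vs N.+1 w,
    forall j, (j < N.+1)%N -> Vs j w & exists b' d', [/\ A b', `|w - b'| < d' / 4, 0 < d',
      `|G b' - G b| <= e1 & [/\ d' < d1 / 2, d' <= 1,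
      near_affine (Fs N) (ball b' d') (G b') (eps N) &
      near_affine (Fs N.+1) (ball b' d') (G b') (eps N.+1)]]].
  move=> Bw nAw; have [[|N] [nV VN]] := Vs_exit nAw.
    by case: nV; apply: (Vs_le (leq0n m)); exact: VB.
  have mN : (m <= N)%N.
    rewrite leqNgt; apply/negP => Nm; apply: nV.
    by apply: (Vs_le Nm); exact: VB.
  exists N; split => //.
  have [b' [d' [Ab' d'0 d'N wb' [h h']]]] := Vs_good (VN N (ltnSn N)).
  have d'1 : d' < d1 / 2 by exact: lt_trans d'N (powm N mN).
  have d'1' : d' <= 1 by rewrite (le_trans (ltW d'N))// exprn_ile1//; lra.
  exists b', d'; split => //.
  apply: Gd1 => //; apply/ball_center_dist.
  have -> : b' - b = - (w - b') + (w - b) by module_ring.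
  move/ball_center_dist in Bw.
  rewrite (le_lt_trans (ler_normD _ _))// normrN; lra.
exists d => // x y Bx By.
have -> : interpolation x - interpolation y - G b (x - y) =
   interpolation x - G b x - (interpolation y - G b y) by rewrite clinB; module_ring.
apply: (@plip_lip _ _ _ (ball b d) (fun x => interpolation x - G b x)) => //.
  exact: ball_segment_closed.
move=> z Bz; have [Az|nAz] := pselect (A z).
  near=> w.
  have Bw : ball b d w by near: w; apply: (open_near (ball_open b d) Bz).
  have -> : interpolation w - G b w - (interpolation z - G b z) =
     interpolation w - F0 z - G b (w - z) by rewrite (interpolationA Az) clinB; module_ring.
  have Bd1 u : ball b d u -> ball b d1 u by apply: le_ball; lra.
  have [Aw|nAw] := pselect (A w).
    rewrite interpolationA// (le_trans (hd1 _ _ _ _))//; [by split => //; exact: Bd1..|].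
    by rewrite ler_wpM2r// /e1; lra.
  have [N [mN nV VN [b' [d' [Ab' wb' d'0 Gb' [d'1 d'1' h h']]]]]] := exitB w Bw nAw.
  have wb : `|w - b| < d by exact/ball_center_dist.
  have tw : 0 < tdist A w by exact: tdist_gt0.
  have twz : tdist A w <= `|w - z| by exact: tdist_le.
  have twb : tdist A w <= `|w - b'| by exact: tdist_le.
  (* Now [|w - a| <= 2 * |w - z|] and [|a - z| <= 3 * |w - z|]; the three terms below contribute 2,
     3 and 2 times [e1]. *)
  have [||a Aa wa] := @tdist_lt R X A w (2 * tdist A w); [by lra|by lra|].
  have az : `|a - z| <= 3 * `|w - z|.
    have -> : a - z = - (w - a) + (w - z) by module_ring.
    by rewrite (le_trans (ler_normD _ _))// normrN; lra.
  have Ba : ball b' d' a.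
    apply/ball_center_dist; have -> : a - b' = - (w - a) + (w - b') by module_ring.
    by rewrite (le_lt_trans (ler_normD _ _))// normrN; lra.
  have Ba1 : ball b d1 a.
    apply/ball_center_dist; have -> : a - b = - (w - a) + (w - b) by module_ring.
    by rewrite (le_lt_trans (ler_normD _ _))// normrN; lra.
  have Bw' : ball b' d' w by apply/ball_center_dist; lra.
  have part j : (m <= j)%N -> near_affine (Fs j) (ball b' d') (G b') (eps j) ->
      `|Fs j w - F0 z - G b (w - z)| <= 7 * e1 * `|w - z|.
    move=> mj hj.
    have -> : Fs j w - F0 z - G b (w - z) = (Fs j w - Fs j a - G b' (w - a)) +
       (F0 a - F0 z - G b (a - z)) + (G b' - G b) (w - a).
      by rewrite (FsA j Aa) clinBE !clinB; module_ring.
    have h1 : `|Fs j w - Fs j a - G b' (w - a)| <= e1 * (2 * `|w - z|).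
      rewrite (le_trans (hj _ _ Bw' Ba))// ler_pM ?epsm//; [exact: ltW|lra].
    have h2 : `|F0 a - F0 z - G b (a - z)| <= e1 * (3 * `|w - z|).
      rewrite (le_trans (hd1 _ _ _ _))//; [by split => //; exact: Bd1|].
      by rewrite ler_wpM2l// ltW.
    have h3 : `|(G b' - G b) (w - a)| <= e1 * (2 * `|w - z|).
      by rewrite (le_trans (clin_le _ _))// ler_pM//; lra.
    rewrite (le_trans (ler_normD _ _))// (le_trans (lerD (ler_normD _ _) (lexx _)))//.
    lra.
  rewrite (interpolationE nV) /= (Hs_Vs (VN N (ltnSn N))).
  have /andP[t0 t1] := tau01 N w.
  have -> : tau N w *: Fs N w + (1 - tau N w) *: Fs N.+1 w - F0 z - G b (w - z) =
    tau N w *: (Fs N w - F0 z - G b (w - z)) +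
    (1 - tau N w) *: (Fs N.+1 w - F0 z - G b (w - z)) by module_ring.
  have t1' : 0 <= 1 - tau N w by rewrite subr_ge0.
  rewrite (le_trans (ler_normD _ _))// !normrZ (ger0_norm t0) (ger0_norm t1').
  have -> : e * `|w - z| = tau N w * (e * `|w - z|) + (1 - tau N w) * (e * `|w - z|) by ring.
  have e7 : 7 * e1 * `|w - z| <= e * `|w - z| by rewrite ler_wpM2r// /e1; lra.
  rewrite lerD// ler_wpM2l// (le_trans _ e7)//; first exact: part.
  by apply: part => //; exact: leqW.
have [N [mN nV VN [b' [d' [Ab' zb' d'0 Gb' [d'1 _ h h']]]]]] := exitB z Bz nAz.
have Bz' : ball b' d' z by apply/ball_center_dist; lra.
have plips j : (m <= j)%N -> near_affine (Fs j) (ball b' d') (G b') (eps j) ->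
    plip (fun x => Fs j x - G b x) z (2 * e1).
  move=> mj hj; apply: plip_le (good_plip Bz' hj Gb').
  by have := epsm j mj; lra.
apply: plip_le (interpolation_plip nV VN (plips N mN h) (fun _ => plips N.+1 (leqW mN) h')).
have := epsm _ mN; have := epsm _ (leqW mN); have := epsm _ (leqW (leqW mN)).
by rewrite /e1; lra.
Unshelve. all: by end_near. Qed.

(** At points of [A] strictness bounds the slope by [|G z| + eps 1]. Off [A] the two changes cost
    most at the earliest exit, since [eps] decreases; this leaves [eps 0], [eps 1] and [eps 2]. *)
Lemma interpolation_lip (L c : R) : strict_jet A F0 G ->
  (forall e, 0 < e -> exists n, forall m, (n <= m)%N -> eps m <= e) ->
  (forall n, eps n.+1 <= eps n) -> (forall b, A b -> `|G b| <= L) -> L + eps 1 <= c ->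
  (forall x y, `|F0 x - F0 y| <= c * `|x - y|) ->
  forall x y, `|interpolation x - interpolation y| <=
    (c + 2 * (eps 0 + eps 1) + 2 * (eps 1 + eps 2)) * `|x - y|.
Proof.
move=> jet eps0 eps_anti GL Lc F0c x y.
have eps_le m n : (m <= n)%N -> eps n <= eps m.
  move=> /subnK<-; elim: (n - m)%N => [//|k IH]; exact: le_trans (eps_anti _) IH.
have [e0 e1 e2] : [/\ 0 < eps 0, 0 < eps 1 & 0 < eps 2] by [].
apply: (@plip_lip _ _ _ setT) => // {x y} z _.
have [Az|nAz] := pselect (A z).
  have [d d0 hd] := interpolation_strict jet eps0 Az e1.
  have Bz : ball z d z by exact: ballxx.
  apply: (open_near (ball_open z d) Bz) => w Bw.
  have -> : interpolation w - interpolation z =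
    (interpolation w - interpolation z - G z (w - z)) + G z (w - z) by module_ring.
  rewrite (le_trans (ler_normD _ _))// (le_trans (lerD (hd _ _ Bw Bz) (clin_le _ _)))//.
  by rewrite -mulrDl ler_wpM2r//; have := GL z Az; lra.
suff : plip (fun u => interpolation u - (0 : clin X Y) u) z
    (c + 2 * (eps 0 + eps 1) + 2 * (eps 1 + eps 2)).
  by apply: filterS => w; rewrite !clin0E !subr0.
have plip0 : plip (fun u => Fs 0 u - (0 : clin X Y) u) z c.
  by apply: nearW => w; rewrite !clin0E !subr0 Fs0.
have [N [nV VN]] := Vs_exit nAz.
case: N nV VN => [|N] nV VN.
  by apply: plip_le (interpolation_plip nV VN plip0 _) => //; lra.
have [b [d [Ab d0 dN zb [h h']]]] := Vs_good (VN N (ltnSn N)).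
have Bz : ball b d z by apply/ball_center_dist; lra.
have plips j : near_affine (Fs j) (ball b d) (G b) (eps j) ->
    plip (fun x => Fs j x - (0 : clin X Y) x) z c.
  case: j => [//|j] hj; apply: plip_le (good_plip Bz hj (e := L) _).
    by have := eps_le 1 j.+1 isT; lra.
  by rewrite subr0; exact: GL.
apply: plip_le (interpolation_plip nV VN (plips N h) (fun _ => plips N.+1 h')).
have := eps_le 0 N isT; have := eps_le 1 N.+1 isT; have := eps_le 2 N.+2 isT.
by lra.
Qed.

End strict_interpolation.

(** The zeroth map is [f] itself, whose error relative to [G b] is only known to be at most
    [(C + 1) * L]; the later errors are [L / 16] times powers of 1/2. With [c = C * L + L / 32] the
    interpolation has constant [3 * C * L + 2 * L + 3 * L / 16], below [5 * C * L + L / 5]. *)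
Lemma strict_lipschitz_extension {R : realType} (X Y : normedModType R) (C C' L : R)
    (y0 : Y) (A : set X) (f : X -> Y) (G : X -> clin X Y) :
  property_LE X Y C -> 1 <= C -> property_LA (SmoothN 1) X Y C' -> y0 != 0 -> closed A ->
  strict_jet A f G -> 0 < L -> (forall b, A b -> `|G b| <= L) ->
  (forall x y, `|f x - f y| <= C * L * `|x - y|) ->
  exists F : X -> Y, [/\ forall x, A x -> F x = f x,
    forall x y, `|F x - F y| <= (5 * C * L + L / 5) * `|x - y| &
    forall b e, A b -> 0 < e -> exists2 d, 0 < d & near_affine F (ball b d) (G b) e].
Proof.
move=> LE C1 LA y00 cA jet L0 GL fL.
pose eps n : R := if n is n'.+1 then L * 2^-1 ^+ n'.+1 / 16 else (C + 1) * L.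
have CL : L <= C * L by rewrite ler_peMl// ltW.
have eps_gt0 n : 0 < eps n.
  case: n => [|n]; first by rewrite mulr_gt0// addr_gt0//; lra.
  by rewrite divr_gt0// mulr_gt0// exprn_gt0.
have /choice[Fs' Fs'P] : forall n, exists F : X -> Y, (forall x, A x -> F x = f x) /\
    forall b, A b -> exists2 d, 0 < d & near_affine F (ball b d) (G b) (eps n).
  by move=> n; exact: (strict_extension LE LA y00 cA jet (eps_gt0 n)).
pose Fs n := if n is n'.+1 then Fs' n'.+1 else f.
have FsA n x : A x -> Fs n x = f x by case: n => //= n; exact: (Fs'P n.+1).1.
have Fs_affine n b : A b -> exists2 d, 0 < d & near_affine (Fs n) (ball b d) (G b) (eps n).
  case: n => [|n] Ab; last exact: (Fs'P n.+1).2.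
  exists 1 => // x y _ _; rewrite (le_trans (ler_normB _ _))// /eps mulrDl mul1r mulrDl lerD//.
  by rewrite (le_trans (clin_le _ _))// ler_wpM2r// GL.
have eps0 e : 0 < e -> exists n, forall m, (n <= m)%N -> eps m <= e.
  move=> e0; have [n hn] := pow_half_lt (divr_gt0 e0 L0).
  exists n.+1 => -[//|m] /= nm; have := hn m.+1 (leq_trans (leqnSn n) nm).
  rewrite ltr_pdivlMr// mulrC => h.
  have : 0 < L * 2^-1 ^+ m.+1 by rewrite mulr_gt0// exprn_gt0.
  lra.
have eps_anti n : eps n.+1 <= eps n.
  case: n => [|n] /=; first by rewrite expr1; lra.
  by rewrite exprS; have : 0 < L * 2^-1 ^+ n.+1 by [rewrite mulr_gt0// exprn_gt0]; lra.
exists (interpolation A f G Fs eps); split.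
- by move=> x Ax; exact: interpolationA.
- have Lc : L + eps 1 <= C * L + L / 32 by rewrite /= expr1; lra.
  have fc u v : `|f u - f v| <= (C * L + L / 32) * `|u - v|.
    by rewrite (le_trans (fL _ _))// ler_wpM2r//; lra.
  move=> x y.
  have := interpolation_lip cA erefl FsA eps_gt0 Fs_affine jet eps0 eps_anti GL Lc fc x y.
  move=> h; apply: le_trans h _.
  by rewrite ler_wpM2r// /= expr1 expr2; lra.
- exact: (interpolation_strict cA erefl FsA eps_gt0 Fs_affine jet eps0).
Qed.

(** * C^1 smoothing off [A] *)

Section jet_smoothing.
Context {R : realType}.
Implicit Types X Y : normedModType R.

Lemma near_affine_unique X Y (F : X -> Y) x r (S T : clin X Y) c d :
  0 < r -> 0 <= c + d -> near_affine F (ball x r) S c -> near_affine F (ball x r) T d ->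
  `|S - T| <= c + d.
Proof.
move=> r0 cd0 FS FT; apply: clin_norm_le => //.
apply/near_ball_dist; exists r => // v; rewrite subr0 => vr.
have Bx : ball x r x by exact: ballxx.
have Bv : ball x r (x + v) by apply/ball_center_dist; rewrite addrC addKr.
have := FS _ _ Bv Bx; have := FT _ _ Bv Bx.
have -> : x + v - x = v by module_ring.
move=> hT hS; have -> : (S - T) v = (F (x + v) - F x - T v) - (F (x + v) - F x - S v).
  by rewrite clinBE; module_ring.
by rewrite (le_trans (ler_normB _ _))// mulrDl addrC lerD.
Qed.

(** [T] nearly minimises the local Lipschitz constant of [F - T] at [x]. It is chosen without
    reference to [A], yet any competitor confines it: the slope 0 bounds it everywhere, and near [A]
    a slope [G b] with small error forces it close to [G b]. *)
Lemma almost_best_slope X Y (F : X -> Y) (x : X) (kappa M : R) : 0 < kappa -> 0 <= M ->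
  (forall u v, `|F u - F v| <= M * `|u - v|) ->
  exists (T : clin X Y) c r, [/\ 0 < r, 0 <= c, near_affine F (ball x r) T c &
    forall T' c' r', 0 < r' -> 0 <= c' -> near_affine F (ball x r') T' c' ->
      c <= c' + kappa /\ `|T - T'| <= c + c'].
Proof.
move=> kappa0 M0 FM.
pose S := [set c | 0 <= c /\ exists (T : clin X Y) r, 0 < r /\ near_affine F (ball x r) T c].
have hS : has_inf S.
  split; last by exists 0 => c [].
  exists M; split => //; exists 0, 1; split => // u v _ _.
  by rewrite clin0E subr0.
have [c [c0 [T [r [r0 FT]]]] cS] := inf_adherent kappa0 hS.
exists T, c, r; split => // T' c' r' r'0 c'0 FT'; split.
  rewrite (le_trans (ltW cS))// lerD2r; apply: ge_inf; first by case: hS.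
  by split => //; exists T', r'.
apply: (@near_affine_unique _ _ F x (Num.min r r')).
- by rewrite lt_min r0.
- exact: addr_ge0.
- by apply: near_affineW FT; apply: le_ball; rewrite ge_min lexx.
- by apply: near_affineW FT'; apply: le_ball; rewrite ge_min lexx orbT.
Qed.

Lemma tdist_ball X (A : set X) x z r : r <= tdist A x / 2 -> ball x r z ->
  tdist A x <= 2 * tdist A z.
Proof.
move=> rx /ball_center_dist zx; have := tdist_lip A x z.
rewrite distrC ler_norml => /andP[h _]; rewrite distrC in h; lra.
Qed.

(** Against the slope 0 with constant [M] one gets [c <= M + L / 16] and [|T| <= 2 * M + L / 16];
    the approximation adds [C * c] and a last [L / 16]. Against [G b] with small error both [c] and
    [T - G b] become small near [b]. *)
Lemma jet_smoothing X Y k C (y0 : Y) (A : set X) (F : X -> Y)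
    (G : X -> clin X Y) (L M : R) :
  property_LA k X Y C -> smooth_order k 1 -> y0 != 0 -> closed A -> 0 < L -> 0 <= M ->
  (forall x y, `|F x - F y| <= M * `|x - y|) ->
  (forall b e, A b -> 0 < e -> exists2 d, 0 < d & near_affine F (ball b d) (G b) e) ->
  exists g : X -> Y, [/\ Ck k (~` A) g,
    forall z, ~ A z -> `|g z - F z| <= tdist A z ^+ 2 * L,
    forall z, ~ A z -> `|frechet g z| <= (2 + C) * M + (2 + C) * (L / 16) &
    forall b e, A b -> 0 < e ->
      \forall z \near b, ~ A z -> `|frechet g z - G b| <= e].
Proof.
move=> LA k1 y00 cA L0 M0 FM FG; have [C0 _] := LA.
have oO : open (~` A) by exact: closed_openC.
(* The defect of optimality vanishes at [A], so it does not disturb the limit of the derivative. *)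
pose kappa x := tdist A x * (L / 16).
have L16 : 0 < L / 16 by rewrite divr_gt0.
have kappa_le x : kappa x <= L / 16 by rewrite ler_piMl ?tdist_le1// ltW.
have /choice[p pP] : forall x, exists p : clin X Y * R * R, ~ A x ->
   [/\ 0 < p.2, p.2 <= tdist A x / 2, 0 <= p.1.2, near_affine F (ball x p.2) p.1.1 p.1.2 &
    forall T' c' r', 0 < r' -> 0 <= c' -> near_affine F (ball x r') T' c' ->
      p.1.2 <= c' + kappa x /\ `|p.1.1 - T'| <= p.1.2 + c'].
  move=> x; have [Ax|nAx] := pselect (A x); first by exists (0, 0, 0).
  have tx := tdist_gt0 cA nAx.
  have [T [c [r [r0 c0 FT best]]]] := almost_best_slope x (mulr_gt0 tx L16) M0 FM.
  exists (T, c, Num.min r (tdist A x / 2)) => _ /=; split => //.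
  - by rewrite lt_min r0 divr_gt0.
  - by rewrite ge_min lexx orbT.
  - by apply: near_affineW FT; apply: le_ball; rewrite ge_min lexx.
pose T x := (p x).1.1; pose c x := (p x).1.2; pose r x := (p x).2.
(* Quadratic in the distance, so that the correction has derivative 0 at the points of [A]. *)
pose eps x := tdist A x ^+ 2 * (L / 16).
have OF x : (~` A) x -> [/\ 0 < r x, ball x (r x) `<=` ~` A, 0 <= c x & 0 < eps x] /\
     forall u v, ball x (r x) u -> ball x (r x) v ->
       `|F u - F v - T x (u - v)| <= c x * `|u - v|.
  move=> Ax; have [r0 rx c0 FT _] := pP x Ax; have tx := tdist_gt0 cA Ax; split => //.
  split => //; last by rewrite mulr_gt0// exprn_gt0.
  by move=> z /(tdist_ball rx) xz Az; move: xz; rewrite (tdist_eq0 Az) mulr0 leNgt tx.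
have [g [Cg gP]] := LA_approximation LA k1 y00 oO OF.
(* Radii of at most half the distance to [A] bound the distance at the centre by twice that at [z];
   the square 4 is absorbed by the divisor 16. *)
have eps_le x z : (~` A) x -> ball x (r x) z -> eps x <= tdist A z ^+ 2 * L /\ eps x <= L / 16.
  move=> Ax Bz; have [_ rx _ _ _] := pP x Ax; have xz := tdist_ball rx Bz.
  have tx0 := tdist_ge0 A x; have tx1 := tdist_le1 A x.
  have : tdist A x ^+ 2 <= (2 * tdist A z) ^+ 2 by rewrite ler_sqr ?nnegrE// (le_trans tx0).
  have sq1 : tdist A x ^+ 2 <= 1 by rewrite exprn_ile1.
  rewrite exprMn /eps => sq; split; last by rewrite ler_piMl// ltW.
  rewrite (@le_trans _ _ ((2 ^+ 2 * tdist A z ^+ 2) * (L / 16)))//.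
    by rewrite ler_wpM2r// ltW.
  have : 0 <= tdist A z ^+ 2 * L by rewrite mulr_ge0 ?exprn_ge0 ?tdist_ge0// ltW.
  have -> : 2 ^+ 2 * tdist A z ^+ 2 * (L / 16) = tdist A z ^+ 2 * L / 4 by field.
  lra.
exists g; split => //.
- move=> z Az; apply: (gP z Az).1 => x Ax Bz; exact: (eps_le x z Ax Bz).1.
- move=> z Az; rewrite -[frechet g z]subr0.
  have -> : (2 + C) * M + (2 + C) * (L / 16) =
    ((2 + C) * M + (1 + C) * (L / 16)) + L / 16 by ring.
  apply: (gP z Az).2 => x Ax Bz; split; last exact: (eps_le x z Ax Bz).2.
  have [_ _ c0 _ best] := pP x Ax.
  have F0 : near_affine F (ball x 1) 0 M by move=> u v _ _; rewrite clin0E subr0.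
  have [cM TM] := best 0 M 1 ltr01 M0 F0; have kx := kappa_le x.
  rewrite -/(T x) -/(c x) in c0 cM TM.
  have cM' : c x <= M + L / 16 by lra.
  have : C * c x <= C * (M + L / 16) by rewrite ler_wpM2l.
  lra.
- move=> b e Ab e0.
  pose e1 := e / (2 * (2 + C)).
  have C20 : 0 < 2 + C by lra.
  have e10 : 0 < e1 by rewrite divr_gt0// mulr_gt0.
  have e1E : e = 2 * (2 + C) * e1 by rewrite /e1; field; rewrite gt_eqF.
  have [d d0 hd] := FG b e1 Ab e10.
  pose q := Num.min (d / 2) (e1 / (2 + C) / (L + 1)).
  have L10 : 0 < L + 1 by lra.
  have q0 : 0 < q.
    rewrite lt_min; apply/andP; split; first exact: divr_gt0.
    by apply: divr_gt0 => //; exact: divr_gt0.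
  have q1 : q <= d / 2 by rewrite ge_min lexx.
  have q2 : (2 + C) * (q * (L + 1)) <= e1.
    by rewrite mulrC -ler_pdivlMr// -ler_pdivlMr// ge_min lexx orbT.
  apply: filterS (near_dist b q0) => z zb Az.
  have tz : tdist A z <= `|z - b| by exact: tdist_le.
  have tz0 := tdist_ge0 A z; have tz1 := tdist_le1 A z.
  have qL : q * L <= q * (L + 1) by rewrite ler_wpM2l//; lra.
  have tzL : tdist A z * L <= q * (L + 1).
    by rewrite ler_pM//; lra.
  pose rho := (2 + C) * e1 + (1 + C) * (q * (L + 1)).
  have Ce1 : 0 <= C * e1 by rewrite mulr_ge0// ltW.
  rewrite (@le_trans _ _ (rho + q * (L + 1)))//; last by rewrite /rho e1E; lra.
  apply: (gP z Az).2 => x Ax Bz; split; last first.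
    have [h _] := eps_le x z Ax Bz; rewrite (le_trans h)// (le_trans _ tzL)//.
    by rewrite expr2 -mulrA ler_piMl// mulr_ge0// ltW.
  have [r0 rx c0 _ best] := pP x Ax; have xz := tdist_ball rx Bz.
  have Bx : ball b d x.
    apply/ball_center_dist; have -> : x - b = - (z - x) + (z - b) by module_ring.
    move/ball_center_dist in Bz; rewrite -/(r x) in rx.
    by rewrite (le_lt_trans (ler_normD _ _))// normrN; lra.
  have [s s0 hs] : exists2 s, 0 < s & ball x s `<=` ball b d.
    have /near_ball_dist[s s0 hs] := open_near (ball_open b d) Bx (fun w Bw => Bw).
    by exists s => // w /ball_center_dist; exact: hs.
  have [cb Tb] := best _ _ s s0 (ltW e10) (near_affineW hs hd).
  have kq : kappa x <= q * (L + 1).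
    rewrite (le_trans _ tzL)// /kappa (@le_trans _ _ (2 * tdist A z * (L / 16)))//.
      by rewrite ler_wpM2r// ltW.
    have : 0 <= tdist A z * L by rewrite mulr_ge0// ltW.
    lra.
  rewrite -/(T x) -/(c x) in c0 cb Tb.
  have : C * c x <= C * (e1 + q * (L + 1)) by rewrite ler_wpM2l//; lra.
  rewrite /rho; lra.
Qed.

End jet_smoothing.

(** * C^k smoothing and assembly *)

Section jet_extension_theorem.
Context {R : realType}.
Implicit Types X Y : normedModType R.

(** The slopes are now the derivatives of [g], and [s x] bounds their oscillation on small balls.
    The divisor [1 + C] gives [s x + C * s x = tdist A x * (L / 16)], whatever the constant of
    (LA_k). *)
Lemma C1_fine_approximation X Y k C (y0 : Y) (A : set X) (g : X -> Y) (L : R) :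
  property_LA k X Y C -> smooth_order k 1 -> y0 != 0 -> closed A -> 0 < L ->
  Ck (SmoothN 1) (~` A) g ->
  exists h : X -> Y, [/\ Ck k (~` A) h,
    forall z, ~ A z -> `|h z - g z| <= tdist A z ^+ 2 * L &
    forall z, ~ A z -> `|frechet h z - frechet g z| <= tdist A z * L].
Proof.
move=> LA k1 y00 cA L0 C1g; have [C0 _] := LA.
have [gD Cg] := (CnSP _ 0 _).1 (C1g : Cn (~` A) 1 g).
have oO : open (~` A) by exact: closed_openC.
move/(Cn0P _ oO) in Cg.
have C10 : 0 < 1 + C by lra.
have L16 : 0 < L / 16 by rewrite divr_gt0.
pose s x := tdist A x * (L / 16) / (1 + C).
pose eps x := tdist A x ^+ 2 * (L / 16).
have s0 x : ~ A x -> 0 < s x.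
  by move=> Ax; rewrite divr_gt0// mulr_gt0// tdist_gt0.
have /choice[r rP] : forall x, exists r, ~ A x -> [/\ 0 < r, r <= tdist A x / 2 &
    forall w, ball x r w -> `|frechet g w - frechet g x| <= s x].
  move=> x; have [Ax|nAx] := pselect (A x); first by exists 0.
  have /cvgrPdist_le/(_ _ (s0 x nAx)) := Cg x nAx.
  move=> /near_ball_dist[r r0 hr].
  exists (Num.min r (tdist A x / 2)) => _; split.
  - by rewrite lt_min r0 divr_gt0// tdist_gt0.
  - by rewrite ge_min lexx orbT.
  - move=> w /ball_center_dist; rewrite lt_min => /andP[wx _].
    by rewrite distrC; exact: hr.
have rO x : ~ A x -> ball x (r x) `<=` ~` A.
  move=> Ax z Bz Az; have [_ rx _] := rP x Ax.
  have := tdist_ball rx Bz; rewrite (tdist_eq0 Az) mulr0 leNgt.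
  by rewrite tdist_gt0.
have OF x : (~` A) x -> [/\ 0 < r x, ball x (r x) `<=` ~` A, 0 <= s x & 0 < eps x] /\
     forall u v, ball x (r x) u -> ball x (r x) v ->
       `|g u - g v - frechet g x (u - v)| <= s x * `|u - v|.
  move=> Ax; have [r0 rx hr] := rP x Ax; split.
    split => //; [exact: rO|by rewrite ltW// s0|].
    by rewrite mulr_gt0// exprn_gt0// tdist_gt0.
  move=> u v Bu Bv.
  apply: (@is_fd_lip _ _ _ (ball x (r x)) g (frechet g) (frechet g x) (s x)) => //.
    exact: ball_segment_closed.
  by move=> z Bz; split; [apply: gD; exact: rO Bz|exact: hr].
have [h [Ch hP]] := LA_approximation LA k1 y00 oO OF.
have eps_le x z : ~ A x -> ball x (r x) z -> eps x <= tdist A z ^+ 2 * L / 4.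
  move=> Ax Bz; have [_ rx _] := rP x Ax; have xz := tdist_ball rx Bz.
  have tx0 := tdist_ge0 A x.
  have : tdist A x ^+ 2 <= (2 * tdist A z) ^+ 2 by rewrite ler_sqr ?nnegrE// (le_trans tx0).
  rewrite exprMn /eps => sq.
  have -> : tdist A z ^+ 2 * L / 4 = 2 ^+ 2 * tdist A z ^+ 2 * (L / 16) by field.
  by rewrite ler_wpM2r// ltW.
exists h; split => // z Az.
  apply: (hP z Az).1 => x Ax Bz; rewrite (le_trans (eps_le x z Ax Bz))//.
  have : 0 <= tdist A z ^+ 2 * L by rewrite mulr_ge0 ?exprn_ge0 ?tdist_ge0// ltW.
  lra.
have tz0 := tdist_ge0 A z; have tz1 := tdist_le1 A z.
have tzL : 0 <= tdist A z * L by rewrite mulr_ge0// ltW.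
rewrite (@le_trans _ _ (tdist A z * L / 8 + tdist A z * L / 4))//; last by lra.
apply: (hP z Az).2 => x Ax Bz; have [_ rx hr] := rP x Ax; split; last first.
  rewrite (le_trans (eps_le x z Ax Bz))// ler_wpM2r// ler_wpM2r//; first exact: ltW.
  by rewrite expr2 ler_piMl.
rewrite distrC (le_trans (lerD (hr z Bz) (lexx _)))//.
have -> : s x + C * s x = tdist A x * (L / 16) by rewrite /s; field; rewrite gt_eqF.
have xz := tdist_ball rx Bz.
have -> : tdist A z * L / 8 = (2 * tdist A z) * (L / 16) by field.
by rewrite ler_wpM2r// ltW.
Qed.

(** [F] is kept on [A] and replaced by [g2] off it. As [g2 - F] is at most [2 * L] times the squared
    distance to [A], differentiability on [A] is inherited; the derivative is continuous there since
    that of [g1] tends to [G] and that of [g2] differs from it by at most [tdist A z * L]. *)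
Lemma jet_extension X Y k C C' (y0 : Y) (A : set X) (F0 : X -> Y)
    (G : X -> clin X Y) (L : R) :
  property_LE X Y C -> 1 <= C -> property_LA (SmoothN 1) X Y C ->
  property_LA k X Y C' -> smooth_order k 1 -> y0 != 0 -> closed A ->
  strict_jet A F0 G -> 0 < L -> (forall b, A b -> `|G b| <= L) ->
  (forall x y, `|F0 x - F0 y| <= C * L * `|x - y|) ->
  exists g : X -> Y, [/\ forall x, A x -> g x = F0 x,
    forall x y, `|g x - g y| <= 17%:R * C ^+ 3 * L * `|x - y|,
    Ck (SmoothN 1) [set: X] g & Ck k (~` A) g].
Proof.
move=> LE C1 LA1 LAk k1 y00 cA jet L0 GL FL.
have [F [FA FM FG]] := strict_lipschitz_extension LE C1 LA1 y00 cA jet L0 GL FL.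
have oO : open (~` A) by exact: closed_openC.
have C0 : 0 < C by lra.
have CL0 : 0 < C * L by rewrite mulr_gt0.
set M := 5 * C * L + L / 5 in FM.
have M0 : 0 <= M by rewrite /M; lra.
have [g1 [Cg1 g1F g1D g1G]] :=
  jet_smoothing LA1 (isT : smooth_order (SmoothN 1) 1) y00 cA L0 M0 FM FG.
have [g2 [Cg2 g2g1 g2D]] := C1_fine_approximation LAk k1 y00 cA L0 Cg1.
pose g x := if `[< A x >] then F x else g2 x.
pose D x := if `[< A x >] then G x else frechet g2 x.
have gA x : A x -> g x = F x by move=> Ax; rewrite /g; case: asboolP.
have gO x : ~ A x -> g x = g2 x by move=> Ax; rewrite /g; case: asboolP.
have DA x : A x -> D x = G x by move=> Ax; rewrite /D; case: asboolP.
have DO x : ~ A x -> D x = frechet g2 x by move=> Ax; rewrite /D; case: asboolP.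
have C1g2 : Cn (~` A) 1 g2 by exact: (CkP _ _ oO).1 Cg2 1%N k1.
have [g2fd g2c] := (CnSP _ 0 _).1 C1g2.
have gD x : is_fd g x (D x).
  have [Ax|nAx] := pselect (A x); last first.
    rewrite DO//; apply: is_fd_near (g2fd x nAx).
    by apply: (open_near oO nAx) => w Aw; rewrite gO.
  rewrite DA// => e e0; have e2 : 0 < e / 2 by rewrite divr_gt0.
  have [d d0 hd] := FG x _ Ax e2.
  have q0 : 0 < e / 2 / (2 * L) by rewrite divr_gt0// mulr_gt0.
  have Bx : ball x d x by exact: ballxx.
  near=> w; have Bw : ball x d w by near: w; exact: (open_near (ball_open x d) Bx).
  rewrite (gA x Ax); have [Aw|nAw] := pselect (A w).
    rewrite gA// (le_trans (hd _ _ Bw Bx))// ler_wpM2r//; lra.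
  rewrite gO//.
  have -> : g2 w - F x - G x (w - x) = (g2 w - g1 w) + (g1 w - F w) + (F w - F x - G x (w - x)).
    by module_ring.
  rewrite (le_trans (ler_normD _ _))// (le_trans (lerD (ler_normD _ _) (hd _ _ Bw Bx)))//.
  rewrite (le_trans (lerD (lerD (g2g1 w nAw) (g1F w nAw)) (lexx _)))//.
  rewrite [X in _ <= X * _]splitr [leRHS]mulrDl lerD2r.
  have tw : tdist A w <= `|w - x| by exact: tdist_le.
  have tw0 := tdist_ge0 A w.
  have wx : `|w - x| * (2 * L) <= e / 2.
    by rewrite -ler_pdivlMr ?mulr_gt0// ltW//; near: w; exact: near_dist.
  rewrite (@le_trans _ _ (`|w - x| * (2 * L) * `|w - x|))//; last by rewrite ler_wpM2r.
  have -> : tdist A w ^+ 2 * L + tdist A w ^+ 2 * L = tdist A w * tdist A w * (2 * L) by ring.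
  rewrite [leRHS]mulrAC ler_wpM2r//; first by rewrite mulr_ge0// ltW.
  by rewrite ler_pM.
have Dc x : {for x, continuous D}.
  have [Ax|nAx] := pselect (A x); last first.
    have : {for x, continuous (frechet g2)} by exact: ((Cn0P _ oO).1 g2c).
    rewrite /continuous_at/prop_for => h.
    have : frechet g2 y @[y --> x] --> frechet g2 x by exact: h.
    have -> : frechet g2 x = D x by rewrite DO.
    apply: cvg_trans; apply: near_eq_cvg.
    by apply: (open_near oO nAx) => w Aw; rewrite DO.
  apply/cvgrPdist_le => e e0.
  have e2 : 0 < e / 2 by rewrite divr_gt0.
  have [d d0 [_ hd]] := jet x e Ax e0.
  have Bx : ball x d x by exact: ballxx.
  have q0 : 0 < e / 2 / L by rewrite divr_gt0.
  have nG := g1G x (e / 2) Ax e2.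
  near=> w.
  have wx : `|w - x| < e / 2 / L by near: w; exact: near_dist.
  rewrite distrC (DA x Ax); have [Aw|nAw] := pselect (A w).
    by rewrite DA//; apply: hd => //; near: w; exact: (open_near (ball_open x d) Bx).
  have Gw : ~ A w -> `|frechet g1 w - G x| <= e / 2 by near: w.
  rewrite DO//; have -> : frechet g2 w - G x =
     (frechet g2 w - frechet g1 w) + (frechet g1 w - G x) by module_ring.
  rewrite (le_trans (ler_normD _ _))// (le_trans (lerD (g2D w nAw) (Gw nAw)))//.
  rewrite [leRHS]splitr lerD2r -ler_pdivlMr// (le_trans (tdist_le w Ax))// ltW.
have CL : C * L <= C ^+ 3 * L.
  rewrite ler_wpM2r//; first exact: ltW.
  by rewrite exprS ler_peMr ?exprn_ege1//; exact: ltW.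
have CCL : C ^+ 2 * L <= C ^+ 3 * L.
  by rewrite ler_wpM2r//; [exact: ltW|rewrite ler_weXn2l].
have LCL : L <= C * L by rewrite ler_peMl// ltW.
have Dn x : `|D x| <= 17%:R * C ^+ 3 * L.
  have [Ax|nAx] := pselect (A x).
    by rewrite DA// (le_trans (GL x Ax))//; lra.
  rewrite DO//; have -> : frechet g2 x = (frechet g2 x - frechet g1 x) + frechet g1 x.
    by module_ring.
  rewrite (le_trans (ler_normD _ _))// (le_trans (lerD (g2D x nAx) (g1D x nAx)))//.
  have tL : tdist A x * L <= L by rewrite ler_piMl ?tdist_le1// ltW.
  (* With the extra [L] from the second smoothing the coefficients are 5, 10.2625 and 1.525; they
     sum to less than 17, and each accompanying product is at most [C ^+ 3 * L]. *)
  have -> : (2 + C) * M + (2 + C) * (L / 16) =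
    5 * (C ^+ 2 * L) + (10 + 1 / 5 + 1 / 16) * (C * L) + (2 / 5 + 1 / 8) * L.
    by rewrite /M; field.
  lra.
exists g; split.
- by move=> x Ax; rewrite gA// FA.
- move=> x y.
  have := @is_fd_lip _ _ _ setT g D 0 (17%:R * C ^+ 3 * L) (@setT_segment_closed _ _) _ y x I I.
  rewrite clin0E subr0; apply => z _; split; first exact: gD.
  by rewrite subr0.
- apply: (CnS openT (D := D)); first by move=> x _; exact: gD.
  by apply/(Cn0P _ openT) => x _; exact: Dc.
- apply: (Ck_ext oO _ Cg2) => x nAx; by rewrite gO.
Unshelve. all: by end_near. Qed.

End jet_extension_theorem.

Theorem theorem50 (R : realType) (X : normedModType R)
    (Y : completeNormedModType R) (k : smoothness) (C : R)
    (hC : 1 <= C)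
    (hLE : property_LE X Y C)
    (hLA1 : property_LA (SmoothN 1) X Y C)
    (hLAk : exists C' : R, property_LA k X Y C')
    (U : set X) (hU : open U) (hWQ : property_WQ U)
    (L : R) (hL : 0 <= L)
    (f : X -> Y) (hf : Ck (SmoothN 1) U f) (hfL : L.-lipschitz_U f)
    (G : X -> clin X Y)
    (hG : {within closure U, continuous G})
    (hGf : forall x, U x -> G x = frechet f x) :
  exists g : X -> Y,
    [/\ forall x, U x -> g x = f x,
        (17%:R * C ^+ 3 * L).-lipschitz g,
        Ck (SmoothN 1) [set: X] g &
        Ck k (~` closure U) g].
Proof.
have [C0 LE] := hLE.
have [F0 [/lipP F0L F0f]] := LE U L f hL hfL.
have F0L' x y : `|F0 x - F0 y| <= C * L * `|x - y| by exact: F0L.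
have M0 : 0 <= 17%:R * C ^+ 3 * L by apply: mulr_ge0 => //; apply: mulr_ge0 => //; apply/exprn_ge0/ltW.
have oO : open (~` closure U) by apply: closed_openC; exact: closed_closure.
(* A constant extension already serves. Otherwise two distinct values give the nonzero vector of [Y]
   behind the scalar approximations, and force [L > 0]. *)
have [F0c|] := pselect (forall x, F0 x = F0 0).
  exists (fun=> F0 0); split.
  - by move=> x Ux; rewrite -F0f.
  - by apply/lipP => x y _ _; rewrite subrr normr0 mulr_ge0.
  - exact: Ck_cst openT.
  - exact: Ck_cst oO.
move=> /existsNP[x1 /eqP F0x1].
have y00 : F0 x1 - F0 0 != 0 by rewrite subr_eq0.
have L0 : 0 < L.
  rewrite lt_neqAle hL andbT eq_sym; apply/eqP => L_eq0.
  have := F0L' x1 0; rewrite L_eq0 mulr0 mul0r normr_le0 subr_eq0.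
  exact/negP.
have fG x : U x -> is_fd f x (G x).
  by move=> Ux; rewrite hGf//; have [+ _] := (CnSP _ 0 _).1 (hf : Cn U 1 f); apply.
have jet := WQ_strict_jet hU hWQ fG hG F0f F0L'.
have GL := closure_jet_norm hU hL fG ((lipP _ _ _).1 hfL) jet.
(* The smoothing estimates derivatives, so order 0 is raised to 1, where [hLA1] applies, and the
   conclusion is weakened at the end. *)
pose k' := if k is SmoothN 0 then SmoothN 1 else k.
have k'1 : smooth_order k' 1 by rewrite /k'; case: (k) => [[|n]|].
have [C' LAk'] : exists C', property_LA k' X Y C'.
  by rewrite /k'; case: (k) hLAk => [[|n]|] // _; exists C.
have [g [gA gL Cg Cgk]] :=
  jet_extension hLE hC hLA1 LAk' k'1 y00 (@closed_closure _ U) jet L0 GL F0L'.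
exists g; split => //.
- by move=> x Ux; rewrite gA ?F0f//; exact: subset_closure.
- by apply/lipP => x y _ _; exact: gL.
- move: Cgk; rewrite /k'; case: (k) => [[|n]|] //.
  exact: CnW.
Qed.
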